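(* (1) For $n = 2,3,4,5$ let $K_n$ be the totally real number field $$K_2 = \mathbb{Q}(\zeta_5 + \zeta_5^{-1}),\quad K_3 = \mathbb{Q}(\zeta_7 + \zeta_7^{-1}),\quad K_4 = \mathbb{Q}\left(\sqrt{7 + 2 \sqrt{5}}\right),\quad K_5 = \mathbb{Q}(\zeta_{11} + \zeta_{11}^{-1}),$$ where $\zeta_m = e^{2\pi\sqrt{-1}/m}$. Let $\sigma_1, \ldots, \sigma_n$ be all the embeddings of $K_n$ into $\mathbb{C}$ over $\mathbb{Q}$, let $b_1, \ldots, b_n$ be a $\mathbb{Z}$-basis of the ring of integers of $K_n$, and let $B_n \in GL_n(\mathbb{R})$ be the matrix whose $(i,j)$-entry is $b_j^{\sigma_i} = \sigma_i(b_j)$. Then $$\Delta_2^\prime = \Delta^\prime(L(B_2)) = \frac{\pi}{2\sqrt{5}}, \qquad \Delta_3^\prime = \Delta^\prime(L(B_3)) = \frac{\sqrt{3}\,\pi}{14},$$ $$\Delta_4^\prime \ge \Delta^\prime(L(B_4)) = \frac{\pi^2}{10\sqrt{29}}, \qquad \Delta_5^\prime \ge \Delta^\prime(L(B_5)) = \frac{5\sqrt{5}\,\pi^2}{12\cdot 11^2}.$$ (2) For any distinct $\varphi_1, \varphi_2 \in \mathbb{R}\setminus\mathbb{Q}$ and any $\epsilon > 0$, let $L_{\varphi_1,\varphi_2}$ and $L_{\varphi_1,\varphi_2,\epsilon}$ be the lattices in $\mathbb{R}^2$ generated by the columns of $$\begin{pmatrix} 1 & -\varphi_1 \\ 1 &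 -\varphi_2 \end{pmatrix} \quad\text{and}\quad \begin{pmatrix} \epsilon^{-1/2} & 0 \\ 0 & \epsilon^{1/2} \end{pmatrix}\begin{pmatrix} 1 & -\varphi_1 \\ 1 & -\varphi_2 \end{pmatrix},$$ respectively. Then $$\liminf_{\epsilon \to +0} \Delta(L_{\varphi_1,\varphi_2,\epsilon}) = \frac{\pi}{2\mathcal{L}(\varphi_1)},$$ $$\Delta^\prime(L_{\varphi_1,\varphi_2}) = \inf_{\epsilon > 0} \Delta(L_{\varphi_1,\varphi_2,\epsilon}) = \frac{\pi}{2\mathcal{M}(f)},$$ where $\mathcal{L}(\varphi_1)$ is the Lagrange number of $\varphi_1$ and $\mathcal{M}(f)$ is the element of the Markoff spectrum corresponding to the quadratic form $f(x,y) := (x - \varphi_1 y)(x - \varphi_2 y)$.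
   Context: For $B \in GL_n(\mathbb{R})$, $L(B) \subset \mathbb{R}^n$ denotes the lattice generated by the columns of $B$. For a full-rank lattice $L \subset \mathbb{R}^n$, $\min L := \min\{ |l|^2 : 0 \ne l \in L\}$ (the squared Euclidean length of a shortest nonzero vector), and the packing density of $L$ is $$\Delta(L) := \frac{\pi^{n/2}}{\Gamma(n/2+1)} \cdot \frac{(\min L)^{n/2}}{2^n\, \mathrm{vol}(\mathbb{R}^n/L)}.$$ Define $$\Delta^\prime(L(B)) := \inf_{D \in GL_n(\mathbb{R})\text{ diagonal}} \Delta(L(DB)), \qquad \Delta_n^\prime := \sup_{B \in GL_n(\mathbb{R})} \Delta^\prime(L(B)).$$ Lagrange number: for a real number $\alpha$, $\mathcal{L}(\alpha)$ is the supremum of all $M$ such that infinitely many rationals $p/q$ satisfy $|\alpha - p/q| < \frac{1}{M q^2}$ (it may be $+\infty$). Markoff spectrum: for an indefinite binary quadratic form $f(x,y) = ax^2 + bxy + cy^2$ with real coefficients, $d(f) = b^2 - 4ac$, $m(f) = \inf\{ |f(x,y)| : (0,0) \ne (x,y) \in \mathbb{Z}^2 \}$, and $\mathcal{M}(f) := \sqrt{d(f)}/m(f)$ (equal to $+\infty$ if $m(f) = 0$). The convention $\pi/(2\cdot\infty) = 0$ is used. *)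

(* Defs.v *)
From HB Require Import structures.
From mathcomp Require Import all_boot all_order all_algebra.
From mathcomp Require Import mxpoly complex.
From mathcomp Require Import all_classical all_reals all_analysis.

Set Implicit Arguments.
Unset Strict Implicit.
Unset Printing Implicit Defensive.

Import Order.TTheory GRing.Theory Num.Theory.
Import numFieldNormedType.Exports.

Local Open Scope classical_set_scope.
Local Open Scope ring_scope.

Section Lattices.
Context {R : realType}.

Definition lattice n (B : 'M[R]_n) : set 'cV[R]_n :=
  [set B *m map_mx intr z | z in [set: 'cV[int]_n]].

(* Written out because the library norm on matrices is the sup norm. *)
Definition sqnorm n (l : 'cV[R]_n) : R := \sum_i l i 0 ^+ 2.

Definition lattice_min n (L : set 'cV[R]_n) : R :=
  inf [set sqnorm l | l in L `\ 0].

(* vol(R^n / L) is |det B| for any basis matrix B of L, see [covolE];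
   it is 0 if L is not a full-rank lattice. *)
Definition covol n (L : set 'cV[R]_n) : R :=
  xget 0 [set `|\det B| | B in [set B : 'M[R]_n | B \in unitmx /\ lattice B = L]].

Definition Gamma (x : R) : R :=
  Rintegral lebesgue_measure `]0, +oo[ (fun t => t `^ (x - 1) * expR (- t)).

Definition density n (L : set 'cV[R]_n) : R :=
  pi `^ (n%:R / 2) / Gamma (n%:R / 2 + 1) *
  (lattice_min L `^ (n%:R / 2) / (2 ^+ n * covol L)).

Definition density' n (B : 'M[R]_n) : \bar R :=
  ereal_inf [set (density (lattice (D *m B)))%:E
            | D in [set D : 'M[R]_n | is_diag_mx D /\ D \in unitmx]].

Definition sup_density' n : \bar R :=
  ereal_sup [set density' B | B in [set B : 'M[R]_n | B \in unitmx]].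

Lemma sub_latticeP n (B C : 'M[R]_n) : lattice B `<=` lattice C ->
  exists U : 'M[int]_n, B = C *m map_mx intr U.
Proof.
move=> BC.
have colB j : exists z : 'cV[int]_n, col j B = C *m map_mx intr z.
  have [] := BC (col j B); last by move=> z _ <-; exists z.
  by exists (delta_mx j 0) => //; rewrite map_delta_mx -colE.
have {colB} [u uP] := choice colB.
exists (\matrix_(i, j) u j i 0); apply/matrixP => i j.
have /matrixP/(_ i 0) := uP j; rewrite !mxE => ->.
by apply: eq_bigr => k _; rewrite !mxE.
Qed.

Lemma eq_lattice_det n (B C : 'M[R]_n) : B \in unitmx ->
  lattice B = lattice C -> `|\det B| = `|\det C|.
Proof.
move=> Bu BC.
have [U BE] : exists U : 'M[int]_n, B = C *m map_mx intr U.
  by apply: sub_latticeP; rewrite BC.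
have [V CE] : exists V : 'M[int]_n, C = B *m map_mx intr V.
  by apply: sub_latticeP; rewrite BC.
have dB0 : \det B != 0 by rewrite -unitfE -unitmxE.
have dB : \det B = \det C * (\det U)%:~R by rewrite {1}BE det_mulmx det_map_mx.
have dC : \det C = \det B * (\det V)%:~R by rewrite {1}CE det_mulmx det_map_mx.
have : (\det U * \det V)%:~R = 1 :> R.
  by apply: (mulfI dB0); rewrite mulr1 intrM mulrCA -dC mulrC -dB.
rewrite -[1]/(1%:~R) => /intr_inj/(congr1 absz)/eqP.
rewrite abszM muln_eq1 => /andP[/eqP U1 _].
by rewrite dB normrM -intr_norm -abszE U1 mulr1.
Qed.

Lemma covolE n (B : 'M[R]_n) : B \in unitmx -> covol (lattice B) = `|\det B|.
Proof.
move=> Bu; rewrite /covol; case: xgetP => [v _ [C [Cu CB] <-]|noB].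
  exact: eq_lattice_det.
by have := noB `|\det B|; case; exists B.
Qed.

End Lattices.

Section NumberFields.
Variables (R : realType) (theta : R[i]).

(* The intersection of all subfields of R[i] containing theta. *)
Definition adjoinQ : {pred R[i]} :=
  [pred x | `[< forall S : {pred R[i]},
                divring_closed S -> theta \in S -> x \in S >]].

Fact adjoinQ_divring_closed : divring_closed adjoinQ.
Proof.
split=> [|x y /asboolP Kx /asboolP Ky|x y /asboolP Kx /asboolP Ky].
- by apply/asboolP => S [].
- by apply/asboolP => S Sc St; case: (Sc) => _ + _; apply; [exact: Kx|exact: Ky].
- by apply/asboolP => S Sc St; case: (Sc) => _ _; apply; [exact: Kx|exact: Ky].
Qed.
HB.instance Definition _ :=
  GRing.isDivringClosed.Build R[i] adjoinQ adjoinQ_divring_closed.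

Record Qadjoin := QAdjoin { nfval :> R[i]; nfvalP : nfval \in adjoinQ }.

HB.instance Definition _ := [isSub for nfval].
HB.instance Definition _ := [Choice of Qadjoin by <:].
HB.instance Definition _ := [SubChoice_isSubIntegralDomain of Qadjoin by <:].
HB.instance Definition _ := [SubIntegralDomain_isSubField of Qadjoin by <:].

(* A morphism fixes the rationals, so "over Q" needs no extra condition. *)
Definition all_embeddings n (sigma : 'I_n -> {rmorphism Qadjoin -> R[i]}) :=
  (forall i j, sigma i =1 sigma j -> i = j) /\
  (forall f : {rmorphism Qadjoin -> R[i]}, exists i, f =1 sigma i).

Definition integral_basis n (b : 'I_n -> Qadjoin) :=
  (forall j, integralOver (intr : int -> Qadjoin) (b j)) /\
  (forall x, integralOver (intr : int -> Qadjoin) x ->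
     exists! z : {ffun 'I_n -> int}, x = \sum_j b j *~ z j).

Definition embedding_matrix n (B : 'M[R]_n) :=
  exists (sigma : 'I_n -> {rmorphism Qadjoin -> R[i]}) (b : 'I_n -> Qadjoin),
    [/\ all_embeddings sigma, integral_basis b &
        forall i j, (B i j)%:C%C = sigma i (b j)].

End NumberFields.

(* exp(2 pi i / m) *)
Definition zeta (R : realType) (m : nat) : R[i] :=
  (cos (2 * pi / m%:R) +i* sin (2 * pi / m%:R))%C.

Section Spectra.
Context {R : realType}.

(* A rational r is its fraction p/q in lowest terms, with q = denq r > 0. *)
Definition lagrange_number (alpha : R) : \bar R :=
  ereal_sup [set M%:E | M in [set M : R | 0 < M /\
    infinite_set [set r : rat |
      `|alpha - ratr r| < 1 / (M * (denq r)%:~R ^+ 2)]]].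

Record quadform := Quadform { qfa : R; qfb : R; qfc : R }.

Definition qfeval (f : quadform) (x y : R) : R :=
  qfa f * x ^+ 2 + qfb f * x * y + qfc f * y ^+ 2.

Definition qfdisc (f : quadform) : R := qfb f ^+ 2 - 4 * qfa f * qfc f.

Definition qfmin (f : quadform) : R :=
  inf [set `|qfeval f z.1%:~R z.2%:~R| | z in [set z : int * int | z != (0, 0)]].

Definition markoff (f : quadform) : \bar R :=
  if qfmin f == 0 then +oo%E else (Num.sqrt (qfdisc f) / qfmin f)%:E.

Definition phi_mx (phi1 phi2 : R) : 'M[R]_2 :=
  \matrix_(i, j) nth 0 (nth [::] [:: [:: 1; - phi1]; [:: 1; - phi2]] i) j.

Definition phi_mx_eps (phi1 phi2 eps : R) : 'M[R]_2 :=
  diag_mx (\row_j nth 0 [:: eps `^ (- (1 / 2)); eps `^ (1 / 2)] j)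
  *m phi_mx phi1 phi2.

End Spectra.

(* Main.v *)
(** Let [N(B)] be the infimum of [|prod_i (B z)_i|] over nonzero integer vectors
    [z].  By AM-GM, with equality for a suitable diagonal scaling, the infimum of
    the density over diagonal scalings is a constant times
    [N(B) n^(n/2) / (2^n |det B|)], so the theorem is about the ratio
    [N(B) / |det B|].

    For [n = 2, 3] the upper bounds follow Davenport: rescaling a nearly minimal
    vector to [(1, ..., 1)] and completing it to a basis, every other vector [v]
    satisfies [|prod_i (k + v_i)| >= t] for all integers [k], with [t] close to 1.
    This forces [sum_(i < j) (v_i - v_j)^2] to be at least [4 t^2 + 1] for [n = 2]
    and [2 (4 t^2 + 3)] for [n = 3].  For [n = 3] this sum of squares is a binary
    quadratic form, of determinant [3 det^2], to which Hermite's bound applies.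
    In the limit, [|det|] is at least [sqrt 5], resp. [7], times [N].

    For the four fields, norms of algebraic integers give [N = 1], and [det^2] is
    the discriminant.  An integer [sum_j c_j x^j] of the field satisfies
    [disc * c_j^2 \in Z], so only one prime can occur in the denominators of the
    [c_j]; it is excluded by an Eisenstein argument, [x^n] being that prime times a
    unit in the cyclotomic cases.

    For lattices in the plane, AM-GM picks the scaling making both coordinates of
    a given vector of equal size.  As [eps] tends to 0, only vectors with
    [x / y] close to [phi1] matter, and for these
    [|x - phi1 y| |x - phi2 y|] is asymptotically [|phi1 - phi2| |x/y - phi1| y^2]. *)
From HB Require Import structures.
Require Import Defs.
From mathcomp Require Import all_boot all_order all_algebra.
From mathcomp Require Import perm mxpoly complex.
From mathcomp Require Import all_classical all_reals all_analysis.
From mathcomp Require Import measurable_realfun.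
From mathcomp Require Import ring lra zify.

Set Implicit Arguments.
Unset Strict Implicit.
Unset Printing Implicit Defensive.

Import Order.TTheory GRing.Theory Num.Theory.
Import numFieldNormedType.Exports.

Local Open Scope classical_set_scope.
Local Open Scope ring_scope.

(** * Values of the Gamma function *)

Section GammaValues.
Context {R : realType}.
Let mu := @lebesgue_measure R.

(** The term of degree [n + 1] of the exponential series bounds [expR t] from below, so the product
    is at most [(n + 1)! / t]. *)
Lemma cvg_exprM_expRN n : t ^+ n * expR (- t) @[t --> +oo] --> (0 : R).
Proof.
apply: (@squeeze_cvgr _ _ _ _ (cst 0) (fun t => n.+1`!%:R * t^-1)).
- near=> t.
  have t0 : 0 < t by near: t; exact: nbhs_pinfty_gt.
  rewrite mulr_ge0 ?exprn_ge0 ?expR_ge0 ?(ltW t0)//= expRN.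
  rewrite ler_pdivrMr ?expR_gt0// mulrAC ler_pdivlMr// -exprSr.
  rewrite mulrC -ler_pdivrMr ?ltr0n ?fact_gt0//.
  by apply: le_trans (expR_ge1Dxn n (ltW t0)); rewrite lerDr.
- exact: cvg_cst.
- rewrite -[0 in X in _ --> X](mulr0 (n.+1`!%:R : R)); apply: cvgMl_tmp.
  apply/gtr0_cvgV0; last exact: cvg_id.
  by near=> t; near: t; exact: nbhs_pinfty_gt.
Unshelve. all: by end_near. Qed.

(** The improper fundamental theorem of calculus for the Gamma integrand. [f] is a version of the
    integrand that is continuous on the whole line, and [F] an antiderivative of it on the positive
    axis. *)
Lemma Gamma_FTC (x l : R) (f F : R -> R) :
  {in `[0, +oo[, forall t, t `^ (x - 1) * expR (- t) = f t} ->
  (forall t, 0 <= t -> 0 <= f t) -> continuous f ->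
  F t @[t --> +oo] --> l -> F t @[t --> 0^'+] --> F 0 ->
  (forall t : R, 0 < t -> is_derive t 1 F (f t)) ->
  Gamma x = l - F 0.
Proof.
move=> fE f0 cf Fl F0 dF; rewrite /Gamma /Rintegral.
rewrite (@eq_integral _ _ _ mu `]0, +oo[ (EFin \o f)); last first.
  move=> t; rewrite inE/= in_itv/= andbT => t0.
  by rewrite fE// in_itv/= andbT ltW.
rewrite integral_itv_obnd_cbnd//; last first.
  apply/measurable_EFinP; apply: measurable_funTS.
  exact: continuous_measurable_fun.
rewrite (@ge0_continuous_FTC2y _ f F 0 l)//.
- exact: continuous_subspaceT.
- by move=> t t0; have := dF t t0 => -[].
- move=> t; rewrite in_itv/= andbT => t0.
  by rewrite derive1E; have := dF t t0 => -[].
Qed.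

Let G : R -> R := gauss_integral_proof.integral0_gauss.

(** The known limit is that of the square, [pi / 4]; the integral is nonnegative, so its limit is
    the square root. *)
Lemma cvg_integral0_gauss : G x @[x --> +oo] --> Num.sqrt pi / 2.
Proof.
have : Num.sqrt (G x ^+ 2) @[x --> +oo] --> Num.sqrt (pi / 4 : R).
  apply: continuous_cvg; first exact: sqrt_continuous.
  exact: gauss_integral_proof.cvg_integral0_gauss_sqr.
rewrite sqrtrM ?pi_ge0// sqrtrV// (_ : 4 = 2 ^+ 2); last first.
  by rewrite expr2 -natrM.
rewrite sqrtr_sqr ger0_norm// (_ : (fun _ => Num.sqrt _) = G)//.
apply/funext => r; rewrite sqrtr_sqr// ger0_norm//.
exact: gauss_integral_proof.integral0_gauss_ge0.
Qed.

Lemma is_derive_integral0_gauss (x : R) : 0 < x ->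
  is_derive x 1 G (gauss_fun x).
Proof.
move=> x0.
have [] := @continuous_FTC1 R gauss_fun (BLeft 0) x (x + 1) _ _ _ _.
- by rewrite ltrDl.
- apply: continuous_compact_integrable => //; first exact: segment_compact.
  by apply: continuous_subspaceT; exact: continuous_gauss_fun.
- by rewrite /= lte_fin.
- exact: continuous_gauss_fun.
rewrite derive1E => dG Gx; rewrite -Gx.
exact: DeriveDef.
Qed.

Lemma integral0_gauss0 : G 0 = 0.
Proof. by rewrite /G /gauss_integral_proof.integral0_gauss set_itv1 Rintegral_set1. Qed.

Lemma cvg_integral0_gauss0 : G x @[x --> 0] --> (0 : R).
Proof.
apply: (@parameterized_integral_cvg_left R 0 1 gauss_fun ltr01).
apply: continuous_compact_integrable => //; first exact: segment_compact.
by apply: continuous_subspaceT; exact: continuous_gauss_fun.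
Qed.

Lemma cvg_sqrty : (Num.sqrt t : R) @[t --> +oo] --> +oo.
Proof.
apply/cvgryPge => A; near=> t.
have A2 : A ^+ 2 <= t by near: t; apply: nbhs_pinfty_ge; rewrite num_real.
by rewrite (le_trans (ler_norm A))// -sqrtr_sqr ler_wsqrtr.
Unshelve. all: by end_near. Qed.

(* [PE] says that [F] below is an antiderivative of the Gamma integrand, [G]
   being the Gaussian integral from 0. *)
Lemma Gamma_half_odd n (k C : R) m (P dP : R -> R) :
  (forall t : R, is_derive t 1 P (dP t)) ->
  (forall t, k - 2 * t * dP t - P t + 2 * t * P t = 2 * t ^+ n.+1) ->
  (forall t, 1 <= t -> 0 <= P t <= C * t ^+ m) ->
  Gamma (n%:R + 3 / 2) = k * (Num.sqrt pi / 2).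
Proof.
move=> dP' PE PC.
pose F t := k * G (Num.sqrt t) - P t * Num.sqrt t * expR (- t).
have cP : continuous P.
  by move=> t; apply/differentiable_continuous/derivable1_diffP; have [] := dP' t.
have F0 : F 0 = 0.
  by rewrite /F sqrtr0 integral0_gauss0 !mulr0 mul0r subr0.
have dF (t : R) : 0 < t -> is_derive t 1 F (t ^+ n * Num.sqrt t * expR (- t)).
  move=> t0; rewrite /F.
  have ds := is_derive1_sqrt t0.
  have s0 : 0 < Num.sqrt t by rewrite sqrtr_gt0.
  have dG := is_derive_integral0_gauss s0.
  have dGs := is_derive1_comp dG ds.
  have dE : is_derive t 1 (expR \o -%R) (- expR (- t)).
    by apply: is_derive_eq; rewrite /GRing.scale/= ?(mulN1r, mulrN1).
  have h1 := is_deriveM (is_derive_cst k t (1 : R)) dGs.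
  have h2 := is_deriveM (is_deriveM (dP' t) ds) dE.
  apply: (is_derive_eq (is_deriveB h1 h2)).
  rewrite /GRing.scale/= /gauss_fun sqr_sqrtr ?(ltW t0)//.
  have st : Num.sqrt t ^+ 2 = t by rewrite sqr_sqrtr ?(ltW t0).
  have PEt := PE t.
  (* Multiplying by [2 sqrt t] clears the denominators coming from the derivative of the square root
     and produces the left-hand side of [PE]. *)
  apply: (@mulIf _ (2 * Num.sqrt t)); first by rewrite mulf_neq0// gt_eqF.
  rewrite !fctE/=.
  transitivity ((k - 2 * Num.sqrt t ^+ 2 * dP t - P t + 2 * Num.sqrt t ^+ 2 * P t) * expR (- t)).
    by field; rewrite gt_eqF.
  rewrite st PEt [RHS](_ : _ = 2 * (Num.sqrt t ^+ 2 * t ^+ n) * expR (- t)); last by ring.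
  by rewrite st exprS.
rewrite (@Gamma_FTC _ (k * (Num.sqrt pi / 2))
  (fun t => t ^+ n * Num.sqrt t * expR (- t)) F _ _ _ _ _ dF).
- by rewrite F0 subr0.
- move=> t; rewrite in_itv/= andbT => t0; congr (_ * _).
  rewrite (_ : n%:R + 3 / 2 - 1 = n%:R + 2^-1); last by field.
  move: t0; rewrite le_eqVlt => /predU1P[<-|t0].
    by rewrite sqrtr0 mulr0 powR0// gt_eqF// ltr_wpDl.
  by rewrite powRD ?gt_eqF ?implybT// powR_mulrn ?powR12_sqrt// ltW.
- by move=> t t0; rewrite !mulr_ge0 ?exprn_ge0 ?sqrtr_ge0 ?expR_ge0.
- move=> t; apply: cvgM; last first.
    apply: (@continuous_comp _ _ _ -%R expR); first exact: opp_continuous.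
    exact: continuous_expR.
  by apply: cvgM; [exact: exprn_continuous|exact: sqrt_continuous].
- rewrite -[X in _ --> X]subr0; apply: cvgB.
    apply: cvgMl_tmp; apply: cvg_comp cvg_integral0_gauss; exact: cvg_sqrty.
  (* For [t >= 1], [sqrt t <= t], so the boundary term is at most [C t^(m+1) e^(-t)]. *)
  apply: (@squeeze_cvgr _ _ _ _ (cst 0) (fun t => C * (t ^+ m.+1 * expR (- t)))).
  + near=> t.
    have t1 : 1 <= t by near: t; apply: nbhs_pinfty_ge; rewrite num_real.
    have /andP[P0 PCt] := PC t t1.
    rewrite /= !mulr_ge0 ?sqrtr_ge0 ?expR_ge0//= mulrA ler_wpM2r ?expR_ge0//.
    rewrite exprSr mulrA ler_pM ?sqrtr_ge0//.
    rewrite -[leRHS]ger0_norm ?(le_trans _ t1)// -sqrtr_sqr ler_wsqrtr// expr2.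
    by rewrite ler_peMr// (le_trans _ t1).
  + exact: cvg_cst.
  + rewrite -[0 in X in _ --> X](mulr0 C); apply: cvgMl_tmp.
    exact: cvg_exprM_expRN.
- rewrite F0; apply: cvg_at_right_filter; rewrite -[X in _ --> X]subr0.
  have s0 : Num.sqrt t @[t --> (0:R)] --> (0 : R).
    by rewrite -[X in _ --> X](@sqrtr0 R); exact: sqrt_continuous.
  apply: cvgB.
    rewrite -[X in _ --> X](mulr0 k); apply: cvgMl_tmp.
    by apply: cvg_comp cvg_integral0_gauss0; exact: s0.
  rewrite -[X in _ --> X](mul0r (expR (- 0))); apply: cvgM.
    by rewrite -[X in _ --> X](mulr0 (P 0)); apply: cvgM; [exact: cP|exact: s0].
  apply: (@continuous_comp _ _ _ -%R expR); first exact: opp_continuous.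
  exact: continuous_expR.
Unshelve. all: by end_near. Qed.

(** As [P - P'] is the monomial [t^n], an antiderivative of the integrand is [- P(t) e^(-t)]; it
    tends to 0 at infinity by the growth bound on [P], and only its value at 0 remains. *)
Lemma Gamma_nat n C m (P dP : R -> R) :
  (forall t : R, is_derive t 1 P (dP t)) ->
  (forall t, P t - dP t = t ^+ n) ->
  (forall t, 1 <= t -> 0 <= P t <= C * t ^+ m) ->
  Gamma (n.+1%:R) = P 0.
Proof.
move=> dP' PE PC.
pose F t := - (P t * expR (- t)).
have cP : continuous P.
  by move=> t; apply/differentiable_continuous/derivable1_diffP; have [] := dP' t.
have cE : continuous (fun t : R => expR (- t)).
  move=> t; apply: (@continuous_comp _ _ _ -%R expR); first exact: opp_continuous.
  exact: continuous_expR.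
have dF (t : R) : 0 < t -> is_derive t 1 F (t ^+ n * expR (- t)).
  move=> t0; rewrite /F.
  have dE : is_derive t 1 (expR \o -%R) (- expR (- t)).
    by apply: is_derive_eq; rewrite /GRing.scale/= ?(mulN1r, mulrN1).
  have -> : (fun t => - (P t * expR (- t))) =
    (- (P * (expR \o -%R)) : R -> R) by [].
  have dPt := dP' t.
  apply: is_derive_eq.
  rewrite /GRing.scale/= -PE; ring.
rewrite (@Gamma_FTC _ 0 (fun t => t ^+ n * expR (- t)) F _ _ _ _ _ dF).
- by rewrite /F oppr0 expR0 mulr1 sub0r opprK.
- move=> t; rewrite in_itv/= andbT => t0; congr (_ * _).
  by rewrite -natr1 addrK powR_mulrn.
- by move=> t t0; rewrite !mulr_ge0 ?exprn_ge0 ?expR_ge0.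
- by move=> t; apply: cvgM; [exact: exprn_continuous|exact: cE].
- rewrite -[X in _ --> X]oppr0; apply: cvgN.
  apply: (@squeeze_cvgr _ _ _ _ (cst 0) (fun t => C * (t ^+ m * expR (- t)))).
  + near=> t.
    have t1 : 1 <= t by near: t; apply: nbhs_pinfty_ge; rewrite num_real.
    have /andP[P0 PCt] := PC t t1.
    by rewrite /= mulr_ge0 ?expR_ge0//= mulrA ler_wpM2r ?expR_ge0.
  + exact: cvg_cst.
  + rewrite -[0 in X in _ --> X](mulr0 C); apply: cvgMl_tmp.
    exact: cvg_exprM_expRN.
- by apply: cvg_at_right_filter; apply: cvgN; apply: cvgM; [exact: cP|exact: cE].
Unshelve. all: by end_near. Qed.

Lemma Gamma2 : Gamma (2 / 2 + 1) = 1 :> R.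
Proof.
rewrite (_ : 2 / 2 + 1 = 2%:R); last by field.
have dP (t : R) : is_derive t 1 (fun t => t + 1) ((fun=> 1 : R) t).
  by apply: is_derive_eq; rewrite addr0.
rewrite (Gamma_nat (n := 1) (C := 2) (m := 1) dP); first by rewrite add0r.
- by move=> t; rewrite addrK expr1.
- by move=> t t1; rewrite expr1; apply/andP; split; lra.
Qed.

Lemma Gamma3 : Gamma (4 / 2 + 1) = 2 :> R.
Proof.
rewrite (_ : 4 / 2 + 1 = 3%:R); last by field.
have dP (t : R) : is_derive t 1 (fun t => t ^+ 2 + (2 * t + 2)) ((fun t => 2 * t + 2) t).
  by apply: is_derive_eq; rewrite /GRing.scale/=; ring.
rewrite (Gamma_nat (n := 2) (C := 5) (m := 2) dP).
- by rewrite expr0n mulr0 !add0r.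
- by move=> t; rewrite addrK.
- by move=> t t1; apply/andP; split; nra.
Qed.

Lemma Gamma52 : Gamma (3 / 2 + 1) = 3 / 4 * Num.sqrt pi :> R.
Proof.
rewrite (_ : 3 / 2 + 1 = 1%:R + 3 / 2); last by field.
have dP (t : R) : is_derive t 1 (fun t => t + 3 / 2) ((fun=> 1 : R) t).
  by apply: is_derive_eq; rewrite addr0.
rewrite (Gamma_half_odd (n := 1) (k := 3 / 2) (C := 3) (m := 1) dP); first by field.
- by move=> t; field.
- by move=> t t1; rewrite expr1; apply/andP; split; lra.
Qed.

Lemma Gamma72 : Gamma (5 / 2 + 1) = 15 / 8 * Num.sqrt pi :> R.
Proof.
rewrite (_ : 5 / 2 + 1 = 2%:R + 3 / 2); last by field.
have dP (t : R) :
      is_derive t 1 (fun t => t ^+ 2 + (5 / 2 * t + 15 / 4)) ((fun t => 2 * t + 5 / 2) t).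
  by apply: is_derive_eq; rewrite /GRing.scale/=; field.
rewrite (Gamma_half_odd (n := 2) (k := 15 / 4) (C := 8) (m := 2) dP).
- by field.
- by move=> t; field.
- by move=> t t1; apply/andP; split; nra.
Qed.

End GammaValues.

(** * Densities and the norm minimum *)

Section Density.
Context {R : realType}.

Definition ivec n (B : 'M[R]_n) (z : 'cV[int]_n) : 'cV[R]_n :=
  B *m map_mx intr z.

(** The [N(B)] of the overview. For the embedding matrix of a totally real field it is the least
    absolute norm of a nonzero algebraic integer. *)
Definition normmin n (B : 'M[R]_n) : R :=
  inf [set `|\prod_i ivec B z i 0| | z in [set z : 'cV[int]_n | z != 0]].

Lemma ivec_eq0 n (B : 'M[R]_n) z : B \in unitmx -> (ivec B z == 0) = (z == 0).
Proof.
move=> Bu; rewrite /ivec; apply/eqP/eqP => [/(congr1 (mulmx (invmx B)))|->].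
  rewrite mulKmx// mulmx0 => /matrixP z0; apply/matrixP => i j.
  by have := z0 i j; rewrite !mxE => /eqP; rewrite intr_eq0 => /eqP.
by rewrite map_mx0 mulmx0.
Qed.

Lemma const1_neq0 n : (0 < n)%N -> (const_mx 1 : 'cV[int]_n) != 0.
Proof.
move=> n0; apply/eqP => /matrixP/(_ (Ordinal n0) 0).
by rewrite !mxE.
Qed.

Lemma sqnorm_ge0 n (v : 'cV[R]_n) : 0 <= sqnorm v.
Proof. by apply: sumr_ge0 => i _; exact: sqr_ge0. Qed.

Lemma lattice_min_le n (B : 'M[R]_n) z : B \in unitmx -> z != 0 ->
  lattice_min (lattice B) <= sqnorm (ivec B z).
Proof.
move=> Bu z0; apply: ge_inf.
  by exists 0 => _ [v _ <-]; exact: sqnorm_ge0.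
exists (ivec B z) => //; split; first by exists z.
by move=> /= /eqP; rewrite ivec_eq0// (negPf z0).
Qed.

Lemma lattice_min_ge n (B : 'M[R]_n) y : (0 < n)%N -> B \in unitmx ->
  (forall z, z != 0 -> y <= sqnorm (ivec B z)) ->
  y <= lattice_min (lattice B).
Proof.
move=> n0 Bu yB; apply: lb_le_inf.
  exists (sqnorm (ivec B (const_mx 1))), (ivec B (const_mx 1)) => //; split.
    by exists (const_mx 1).
  by move=> /= /eqP; rewrite ivec_eq0// (negPf (const1_neq0 n0)).
move=> _ [_ [[z _ <-] /= z0] <-]; apply: yB.
by apply: contra_not_neq z0 => ->; rewrite map_mx0 mulmx0.
Qed.

Lemma normmin_le n (B : 'M[R]_n) z : z != 0 ->
  normmin B <= `|\prod_i ivec B z i 0|.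
Proof.
move=> z0; apply: ge_inf; last by exists z.
by exists 0 => _ [v _ <-]; exact: normr_ge0.
Qed.

Lemma normmin_ge n (B : 'M[R]_n) y : (0 < n)%N ->
  (forall z, z != 0 -> y <= `|\prod_i ivec B z i 0|) -> y <= normmin B.
Proof.
move=> n0 yB; apply: lb_le_inf; last by move=> _ [z z0 <-]; exact: yB.
exists `|\prod_i ivec B (const_mx 1) i 0|, (const_mx 1) => //=.
exact: const1_neq0.
Qed.

Lemma normmin_ge0 n (B : 'M[R]_n) : (0 < n)%N -> 0 <= normmin B.
Proof. by move=> n0; apply: normmin_ge. Qed.

Lemma normmin_lt n (B : 'M[R]_n) y : (0 < n)%N -> normmin B < y ->
  exists2 z, z != 0 & `|\prod_i ivec B z i 0| < y.
Proof.
move=> n0 By; apply: contrapT => h; move: By; apply/negP; rewrite -leNgt.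
apply: normmin_ge => // z z0; rewrite leNgt; apply/negP => zy; apply: h.
by exists z.
Qed.

Lemma diag_mulE n (D : 'M[R]_n) (v : 'cV[R]_n) i : is_diag_mx D ->
  (D *m v) i 0 = D i i * v i 0.
Proof.
move=> /is_diag_mxP Dd; rewrite mxE (bigD1 i)//= big1 ?addr0// => j ji.
by rewrite Dd ?mul0r// eq_sym.
Qed.

Lemma det_is_diag n (D : 'M[R]_n) : is_diag_mx D -> \det D = \prod_i D i i.
Proof.
by move=> Dd; rewrite det_trig//; exact: is_diag_mx_is_trig.
Qed.

Lemma diag_prod n (D : 'M[R]_n) (B : 'M[R]_n) z : is_diag_mx D ->
  \prod_i ivec (D *m B) z i 0 = \det D * \prod_i ivec B z i 0.
Proof.
move=> Dd; rewrite det_is_diag// -big_split; apply: eq_bigr => i _.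
by rewrite /ivec -mulmxA diag_mulE.
Qed.

(** AM-GM for the squares of the coordinates. *)
Lemma prod_le_sqnorm n (v : 'cV[R]_n) : (0 < n)%N ->
  (\prod_i v i 0) ^+ 2 <= (sqnorm v / n%:R) ^+ n.
Proof.
move=> n0; have := @leif_AGM R 'I_n predT (fun i => v i 0 ^+ 2).
rewrite card_ord => /(_ _)[]; first by move=> i _; exact: sqr_ge0.
by rewrite prodrXl.
Qed.

(** The volume of the unit ball of dimension [n]. *)
Definition ball_const n : R := pi `^ (n%:R / 2) / Gamma (n%:R / 2 + 1).

Lemma ball_const_ge0 n : 0 <= ball_const n.
Proof.
rewrite /ball_const divr_ge0 ?powR_ge0//; apply: Rintegral_ge0 => // t _.
by rewrite mulr_ge0 ?powR_ge0 ?expR_ge0.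
Qed.

Lemma densityE n (B : 'M[R]_n) : B \in unitmx -> density (lattice B) =
  ball_const n * (lattice_min (lattice B) `^ (n%:R / 2) / (2 ^+ n * `|\det B|)).
Proof. by move=> Bu; rewrite /density covolE. Qed.

Lemma unitmx_normdet_gt0 n (B : 'M[R]_n) : B \in unitmx -> 0 < `|\det B|.
Proof. by rewrite unitmxE unitfE normr_gt0. Qed.

Lemma lattice_min_powR_ge n (B : 'M[R]_n) : (0 < n)%N -> B \in unitmx ->
  n%:R `^ (n%:R / 2) * normmin B <= lattice_min (lattice B) `^ (n%:R / 2).
Proof.
move=> n0 Bu; have m0 := normmin_ge0 B n0.
have n0' : 0 < n%:R :> R by rewrite ltr0n.
have n20 : 0 <= n%:R / 2 :> R by rewrite divr_ge0.
(* With [X = N(B)^(2/n)] the claim becomes [n X <= lattice_min], which is AM-GM applied to each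
   lattice vector. *)
pose X := normmin B `^ (2 / n%:R).
have XE : X `^ (n%:R / 2) = normmin B.
  rewrite /X -powRrM (_ : _ * _ = 1) ?powRr1//.
  by field; rewrite gt_eqF.
rewrite -{1}XE -powRM ?powR_ge0//.
apply: ge0_ler_powR => //; rewrite ?nnegrE ?mulr_ge0 ?powR_ge0 ?(ltW n0')//.
  by apply: lattice_min_ge => // z _; exact: sqnorm_ge0.
apply: lattice_min_ge => // z z0.
rewrite mulrC -ler_pdivlMr// -(@ler_pXn2r _ n)// ?nnegrE ?powR_ge0//; last first.
  by rewrite divr_ge0 ?sqnorm_ge0 ?ltW.
apply: le_trans (prod_le_sqnorm _ n0).
have -> : X ^+ n = normmin B ^+ 2.
  by rewrite -powR_mulrn ?powR_ge0// -powRrM divfK ?gt_eqF// powR_mulrn.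
rewrite -[leRHS]real_normK ?num_real// ler_pXn2r ?nnegrE//.
exact: normmin_le.
Qed.

Lemma normmin_diag n (D B : 'M[R]_n) : (0 < n)%N -> is_diag_mx D ->
  D \in unitmx -> `|\det D| * normmin B <= normmin (D *m B).
Proof.
move=> n0 Dd Du; apply: normmin_ge => // z z0.
by rewrite diag_prod// normrM ler_wpM2l// normmin_le.
Qed.

(** The density formula with [n N(B)^(2/n)] as squared length of a shortest vector, the equality
    case of AM-GM. *)
Definition optimal_density n (B : 'M[R]_n) : R :=
  ball_const n * (n%:R `^ (n%:R / 2) * normmin B / (2 ^+ n * `|\det B|)).

(** AM-GM bounds the density of [D B] below through [normmin (D *m B)]. Scaling by [D] brings the
    factor [|\det D|] into this bound and into the covolume, where it cancels. *)
Lemma density_diag_ge n (D B : 'M[R]_n) : (0 < n)%N -> is_diag_mx D ->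
  D \in unitmx -> B \in unitmx ->
  optimal_density B <= density (lattice (D *m B)).
Proof.
move=> n0 Dd Du Bu; rewrite densityE ?unitmx_mul ?Du// ler_wpM2l ?ball_const_ge0//.
have d0 := unitmx_normdet_gt0 Du; have b0 := unitmx_normdet_gt0 Bu.
have p0 : 0 < 2 ^+ n :> R by exact: exprn_gt0.
rewrite det_mulmx normrM ler_pdivlMr ?mulr_gt0//.
apply: le_trans (lattice_min_powR_ge n0 _); last by rewrite unitmx_mul Du.
apply: le_trans (ler_wpM2l (powR_ge0 _ _) (normmin_diag B n0 Dd Du)).
rewrite le_eqVlt; apply/orP; left; apply/eqP; field.
by rewrite !gt_eqF.
Qed.

Lemma density_le_sqnorm n (B : 'M[R]_n) z : B \in unitmx -> z != 0 ->
  density (lattice B) <=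
  ball_const n * (sqnorm (ivec B z) `^ (n%:R / 2) / (2 ^+ n * `|\det B|)).
Proof.
move=> Bu z0; rewrite densityE// ler_wpM2l ?ball_const_ge0//.
rewrite ler_wpM2r ?invr_ge0 ?mulr_ge0 ?exprn_ge0//.
have [n0|n0] := posnP n.
  by rewrite (_ : n%:R / 2 = 0) ?powRr0// n0 mul0r.
apply: ge0_ler_powR; rewrite ?divr_ge0 ?nnegrE ?sqnorm_ge0//.
  by apply: lattice_min_ge => // y _; exact: sqnorm_ge0.
exact: lattice_min_le.
Qed.

(** If no coordinate of [v = B z] vanishes, scaling by their inverses turns [v] into the all-ones
    vector, of squared length [n], and divides the determinant by the product of the coordinates. If
    some coordinate vanishes, stretching that axis keeps the length of [v] while the covolume grows
    without bound, so the infimum is at most 0. *)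
Lemma density'_le_prod n (B : 'M[R]_n) z : (0 < n)%N -> B \in unitmx -> z != 0 ->
  (density' B <= (ball_const n * (n%:R `^ (n%:R / 2) *
     `|\prod_i ivec B z i 0| / (2 ^+ n * `|\det B|)))%:E)%E.
Proof.
move=> n0 Bu z0; have b0 := unitmx_normdet_gt0 Bu.
have p0 : 0 < 2 ^+ n :> R by exact: exprn_gt0.
set v := ivec B z.
have dmx (d : 'I_n -> R) : (forall i, d i != 0) ->
    is_diag_mx (diag_mx (\row_i d i)) /\ diag_mx (\row_i d i) \in unitmx.
  move=> d0; split; first exact: diag_mx_is_diag.
  rewrite unitmxE det_diag unitfE; apply/prodf_neq0 => i _.
  by rewrite mxE.
have le (d : 'I_n -> R) s : (forall i, d i != 0) ->
    \sum_i (d i * v i 0) ^+ 2 = s ->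
    (density' B <= (ball_const n * (s `^ (n%:R / 2) /
       (2 ^+ n * (`|\prod_i d i| * `|\det B|))))%:E)%E.
  move=> d0 sE; have [Dd Du] := dmx _ d0.
  apply: (@le_trans _ _ (density (lattice (diag_mx (\row_i d i) *m B)))%:E).
    by apply: ereal_inf_lbound; exists (diag_mx (\row_i d i)).
  rewrite lee_fin.
  have DBu : diag_mx (\row_i d i) *m B \in unitmx by rewrite unitmx_mul Du.
  have := density_le_sqnorm DBu z0.
  rewrite det_mulmx det_diag normrM.
  have -> : sqnorm (ivec (diag_mx (\row_i d i) *m B) z) = s.
    rewrite -sE; apply: eq_bigr => i _.
    by rewrite /ivec -mulmxA diag_mulE// !mxE eqxx mulr1n.
  by under eq_bigr do rewrite mxE.
have [/existsP[j /eqP vj0]|/existsPn v0] := boolP [exists j, v j 0 == 0]; last first.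
  have := le (fun i => (v i 0)^-1) n%:R.
  move=> /(_ _ _)/le_trans; apply.
  - by move=> i; rewrite invr_eq0; exact: v0.
  - under eq_bigr do rewrite mulVf ?v0// expr1n.
    by rewrite sumr_const card_ord.
  rewrite lee_fin prodfV normfV.
  have v0' : `|\prod_i v i 0| != 0.
    by rewrite normr_eq0; apply/prodf_neq0 => i _; exact: v0.
  rewrite le_eqVlt; apply/orP; left; apply/eqP; field.
  by rewrite v0' !gt_eqF.
have -> : \prod_i v i 0 = 0 by rewrite (bigD1 j)//= vj0 mul0r.
rewrite normr0 mulr0 mul0r mulr0.
pose s := \sum_i v i 0 ^+ 2.
apply/lee_addgt0Pr => e e0; rewrite add0e.
pose A := ball_const n * (s `^ (n%:R / 2) / (2 ^+ n * `|\det B|)).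
have A0 : 0 <= A.
  by rewrite mulr_ge0 ?ball_const_ge0// divr_ge0 ?powR_ge0// mulr_ge0// ltW.
(* Stretching by [K] divides the bound [A] by [K], and [A / K <= e]; the 1 keeps [K] positive when
   [A = 0]. *)
pose K := (A + 1) / e.
have K0 : 0 < K by rewrite divr_gt0// ltr_wpDl.
have := le (fun i => if i == j then K else 1) s.
move=> /(_ _ _)/le_trans; apply.
- by move=> i; case: ifP => _; rewrite ?oner_eq0// gt_eqF.
- apply: eq_bigr => i _; case: eqP => [->|_]; last by rewrite mul1r.
  by rewrite vj0 mulr0.
rewrite lee_fin (bigD1 j)//= eqxx big1 ?mulr1; last first.
  by move=> i /negPf ->.
rewrite (gtr0_norm K0).
have -> : ball_const n * (s `^ (n%:R / 2) / (2 ^+ n * (K * `|\det B|))) = A / K.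
  by rewrite /A; field; rewrite !gt_eqF.
rewrite ler_pdivrMr// /K mulrC divfK ?gt_eqF//.
by rewrite lerDl.
Qed.

Lemma le_optimal_density n (B : 'M[R]_n) (x : \bar R) : (0 < n)%N ->
  B \in unitmx ->
  (forall z, z != 0 -> (x <= (ball_const n * (n%:R `^ (n%:R / 2) *
     `|\prod_i ivec B z i 0| / (2 ^+ n * `|\det B|)))%:E)%E) ->
  (x <= (optimal_density B)%:E)%E.
Proof.
move=> n0 Bu hx; apply/lee_addgt0Pr => e e0.
have b0 := unitmx_normdet_gt0 Bu.
have p0 : 0 < 2 ^+ n :> R by exact: exprn_gt0.
pose A := ball_const n * (n%:R `^ (n%:R / 2) / (2 ^+ n * `|\det B|)).
have A0 : 0 <= A.
  by rewrite mulr_ge0 ?ball_const_ge0// divr_ge0 ?powR_ge0// mulr_ge0// ltW.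
have AK y : ball_const n * (n%:R `^ (n%:R / 2) * y / (2 ^+ n * `|\det B|)) = A * y.
  by rewrite /A; field; rewrite !gt_eqF.
(* The infimum need not be attained; a vector within [e / (A + 1)] of it costs at most [e] after
   multiplication by [A]. *)
have [|z z0 zlt] := @normmin_lt n B (normmin B + e / (A + 1)) n0.
  by rewrite ltrDl divr_gt0// ltr_wpDl.
apply: (le_trans (hx _ z0)).
rewrite /optimal_density !AK -EFinD lee_fin.
apply: le_trans (ler_wpM2l A0 (ltW zlt)) _.
rewrite mulrDr lerD2l mulrA ler_pdivrMr ?ltr_wpDl// mulrC.
by rewrite ler_wpM2l ?(ltW e0)// lerDl.
Qed.

Theorem density'E n (B : 'M[R]_n) : (0 < n)%N -> B \in unitmx ->
  density' B = (optimal_density B)%:E.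
Proof.
move=> n0 Bu; apply/eqP; rewrite eq_le; apply/andP; split.
  by apply: le_optimal_density => // z z0; exact: density'_le_prod.
apply: le_ereal_inf_tmp => _ [D [Dd Du] <-]; rewrite lee_fin.
exact: density_diag_ge.
Qed.

End Density.

(** * Davenport's bounds for the norm minimum *)

Section Spread.
Context {R : realType}.

(** [X^2 + p X + q] has real roots and is at least [t] in absolute value at -1, 0 and 1. Real roots
    and [|p| <= 1] force [q <= -t]. A value at least [t] at 1 or -1 then gives [|p| >= 2 t - 1], and
    [(2 t - 1)^2 + 4 t] is the bound; if both values are at most [-t], then [q <= -1 - t]. *)
Lemma spread2_reduced (p q t : R) : 1 / 2 <= t <= 1 -> 0 <= p ^+ 2 - 4 * q ->
  `|p| <= 1 -> t <= `|q| -> t <= `|1 + p + q| -> t <= `|1 - p + q| ->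
  4 * t ^+ 2 + 1 <= p ^+ 2 - 4 * q.
Proof.
move=> /andP[t1 t2] d0; rewrite ler_norml => /andP[p1 p2] h0 h1 h2.
move: h0; case: (ger0P q) => q0 h0; first by nra.
move: h1; case: (ger0P (1 + p + q)) => q1 h1; first by nra.
move: h2; case: (ger0P (1 - p + q)) => q2 h2; first by nra.
nra.
Qed.

Lemma near_int (x : R) : exists k : int, `|k%:~R + x| <= 1 / 2.
Proof.
exists (Num.floor (1 / 2 - x)).
have := floor_itv (1 / 2 - x); rewrite intrD => /andP[h1 h2].
by rewrite ler_norml; apply/andP; split; lra.
Qed.

Lemma spread2 (a b t : R) : 1 / 2 <= t <= 1 ->
  (forall k : int, t <= `|(k%:~R + a) * (k%:~R + b)|) ->
  4 * t ^+ 2 + 1 <= (a - b) ^+ 2.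
Proof.
(* Translating by this [k] makes the linear coefficient [2 k + a + b] at most 1 in absolute value;
   the values at 0, 1 and -1 are those of the hypothesis at [k], [k + 1] and [k - 1]. *)
move=> t01 h; have [k hk] := near_int ((a + b) / 2).
have -> : (a - b) ^+ 2 =
    (2 * k%:~R + a + b) ^+ 2 - 4 * ((k%:~R + a) * (k%:~R + b)) by ring.
apply: spread2_reduced => //.
- by rewrite (_ : _ - _ = (a - b) ^+ 2) ?sqr_ge0//; ring.
- rewrite (_ : 2 * k%:~R + a + b = 2 * (k%:~R + (a + b) / 2)); last by field.
  by rewrite normrM ger0_norm//; lra.
- have := h (k + 1); rewrite intrD; congr (_ <= `|_|); ring.
- have := h (k - 1); rewrite intrB; congr (_ <= `|_|); ring.
Qed.

(* [X^3 + p X^2 + q X + r] has a root in each of ]-oo, 0[, [0, 1[ and [1, +oo[;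
   the right-hand side is half the sum of squares of the root differences. *)
Lemma spread3_signs (p q r t : R) : 9 / 10 <= t <= 1 -> t <= r ->
  1 + p + q + r <= - t -> t <= `|- 1 + p - q + r| ->
  t <= `|8 + 4 * p + 2 * q + r| -> 4 * t ^+ 2 + 3 <= p ^+ 2 - 3 * q.
Proof.
move=> /andP[t1 t2] h0 h1 h2 h3.
(* The signs at 0 and 1 give [p^2 - 3 q >= p^2 + 3 p + 3 + 6 t], which exceeds the target by
   [(p - (2 t - 3)) (p + 2 t)]. Only [p] strictly between [-2 t] and [2 t - 3] escapes, and the
   signs at 2 and -1 exclude it or supply a better bound on [q]. *)
have end1 : (2 * t - 3 <= p) || (p <= - 2 * t) -> 4 * t ^+ 2 + 3 <= p ^+ 2 - 3 * q.
  move=> hp; have : p ^+ 2 + 3 * p + 3 + 6 * t <= p ^+ 2 - 3 * q by nra.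
  apply: le_trans; case/orP: hp => hp.
    have : 0 <= (p - (2 * t - 3)) * (p + 2 * t) by apply: mulr_ge0; lra.
    nra.
  have : 0 <= ((2 * t - 3) - p) * (- 2 * t - p) by apply: mulr_ge0; lra.
  nra.
move: h3; case: (ger0P (8 + 4 * p + 2 * q + r)) => q3 h3.
  by apply: end1; apply/orP; left; lra.
move: h2; case: (ger0P (- 1 + p - q + r)) => q2 h2; last first.
  by apply: end1; apply/orP; right; lra.
have [hp|hp] := boolP ((2 * t - 3 <= p) || (p <= - 2 * t)); first exact: end1.
move: hp; rewrite negb_or -!ltNge => /andP[hp1 hp2].
(* This uses the value at 2, which is at most [-t] here. As [p + 3 > 3 - 2 t > 0], the bound is at
   least [(3 - 2 t)^2 + 3 + 3 t], and [t <= 1] finishes. *)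
have : p ^+ 2 + 6 * p + 12 + 3 * t <= p ^+ 2 - 3 * q by nra.
apply: le_trans.
have : 0 <= (p + 3 - (3 - 2 * t)) * (p + 3 + (3 - 2 * t)) by apply: mulr_ge0; lra.
nra.
Qed.

(* The two hypotheses multiply to [t^2 <= |x(1-x) y(1-y) z(1-z)|] with
   [0 <= u(1-u) <= 1/4] for [u = x, y], which pushes [z] far from [0, 1]. *)
Lemma two_roots_far (x y z t : R) : 9 / 10 <= t <= 1 -> 0 <= x < 1 -> 0 <= y < 1 ->
  t <= `|x * y * z| -> t <= `|(1 - x) * (1 - y) * (1 - z)| ->
  2 * (4 * t ^+ 2 + 3) <= (x - y) ^+ 2 + (y - z) ^+ 2 + (z - x) ^+ 2.
Proof.
move=> /andP[t1 t2] /andP[x0 x1] /andP[y0 y1] h0 h1.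
have quarter (u : R) : 0 <= u -> u < 1 -> 0 <= u * (1 - u) <= 1 / 4.
  move=> u0 u1; apply/andP; split; first by apply: mulr_ge0; lra.
  by have := sqr_ge0 (u - 1 / 2); lra.
have hx := quarter _ x0 x1; have hy := quarter _ y0 y1.
have hz : 16 * t ^+ 2 <= `|z * (1 - z)|.
  have := ler_pM (_ : 0 <= t) (_ : 0 <= t) h0 h1.
  have t0 : 0 <= t by lra.
  rewrite -normrM => /(_ t0 t0).
  have -> : x * y * z * ((1 - x) * (1 - y) * (1 - z)) =
    x * (1 - x) * (y * (1 - y)) * (z * (1 - z)) by ring.
  rewrite normrM (@ger0_norm _ (_ * (y * _))); last first.
    by apply: mulr_ge0; case/andP: hx; case/andP: hy.
  have h : x * (1 - x) * (y * (1 - y)) <= 1 / 4 * (1 / 4).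
    by case/andP: hx => ? ?; case/andP: hy => ? ?; exact: ler_pM.
  have := ler_wpM2r (normr_ge0 (z * (1 - z))) h.
  by move: (x * (1 - x) * _) => ?; nra.
have z2 : 12 <= z ^+ 2 - z.
  have tt : 81 / 100 <= t ^+ 2 by nra.
  move: hz; case: (ger0P (z * (1 - z))) => h hz; last by lra.
  by have := sqr_ge0 (z - 1 / 2); lra.
have [z0|z0] := lerP z 0.
  have : z <= - 3 by nra.
  by move=> z3; nra.
have z4 : 4 <= z by nra.
nra.
Qed.

(** If [x] or [z] lies in [[0, 1[] together with [y], [two_roots_far] applies. Otherwise [x < 0] and
    [1 <= z], which fixes the signs of the cubic at 0 and 1, as [spread3_signs] requires. *)
Lemma spread3_sorted (x y z t : R) : 9 / 10 <= t <= 1 -> x <= y <= z ->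
  (forall k : int, t <= `|(k%:~R - x) * (k%:~R - y) * (k%:~R - z)|) ->
  0 <= y < 1 ->
  2 * (4 * t ^+ 2 + 3) <= (x - y) ^+ 2 + (y - z) ^+ 2 + (z - x) ^+ 2.
Proof.
move=> t01 /andP[xy yz] h y01.
have h0 := h 0; have h1 := h 1; have h2 := h 2; have hN := h (- 1).
rewrite !sub0r in h0; rewrite intrN in hN.
case/andP: (t01) (y01) => t1 t2 /andP[y0 y1].
have [x0|x0] := lerP 0 x.
  apply: two_roots_far => //; first by apply/andP; split; lra.
  by move: h0; congr (_ <= _); rewrite mulrNN mulrN normrN.
have [z1|z1] := ltrP z 1.
  rewrite [leRHS](_ : _ = (y - z) ^+ 2 + (z - x) ^+ 2 + (x - y) ^+ 2); last by ring.
  apply: two_roots_far => //; first by apply/andP; split; lra.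
  - by move: h0; congr (_ <= _); rewrite mulrNN mulrN normrN; congr `|_|; ring.
  - by move: h1; congr (_ <= `|_|); ring.
have {}h0 : t <= - (x * y * z).
  move: h0; rewrite mulrNN mulrN normrN ler0_norm//.
  by rewrite -mulrA; apply: mulr_le0_ge0; [lra|apply: mulr_ge0; lra].
have {}h1 : (1 - x) * (1 - y) * (1 - z) <= - t.
  rewrite lerNr -ler0_norm//; apply: mulr_ge0_le0; last by lra.
  by apply: mulr_ge0; lra.
rewrite [leRHS](_ : _ = 2 * ((- (x + y + z)) ^+ 2 - 3 * (x * y + y * z + z * x))); last by ring.
rewrite ler_pM2l//; apply: (@spread3_signs _ _ (- (x * y * z))) => //.
- by move: h1; congr (_ <= _); ring.
- by move: hN; congr (_ <= `|_|); ring.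
- by move: h2; congr (_ <= `|_|); ring.
Qed.

(** After sorting, an integer translation brings the middle root into [[0, 1[]. The roots of the
    cubic are the negatives of [a], [b], [c], whence the reversed order. *)
Lemma spread3 (a b c t : R) : 9 / 10 <= t <= 1 ->
  (forall k : int, t <= `|(k%:~R + a) * (k%:~R + b) * (k%:~R + c)|) ->
  2 * (4 * t ^+ 2 + 3) <= (a - b) ^+ 2 + (b - c) ^+ 2 + (c - a) ^+ 2.
Proof.
move=> t01.
wlog ab : a b / a <= b.
  move=> wh; have [/wh//|/ltW/wh{}wh h] := lerP a b.
  rewrite [leRHS](_ : _ = (b - a) ^+ 2 + (a - c) ^+ 2 + (c - b) ^+ 2); last by ring.
  by apply: wh => k; have := h k; congr (_ <= `|_|); ring.
have sorted x y z : x <= y <= z ->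
    (forall k : int, t <= `|(k%:~R + x) * (k%:~R + y) * (k%:~R + z)|) ->
    2 * (4 * t ^+ 2 + 3) <= (x - y) ^+ 2 + (y - z) ^+ 2 + (z - x) ^+ 2.
  move=> /andP[xy yz] h.
  have := floor_itv (- y); set n := Num.floor _; rewrite intrD => /andP[n1 n2].
  rewrite [leRHS](_ : _ = (- z - n%:~R - (- y - n%:~R)) ^+ 2 +
     (- y - n%:~R - (- x - n%:~R)) ^+ 2 + (- x - n%:~R - (- z - n%:~R)) ^+ 2); last by ring.
  apply: spread3_sorted => //; try by apply/andP; split; lra.
  move=> k; have := h (k + n); rewrite intrD; congr (_ <= `|_|); ring.
move=> h; have [bc|/ltW bc] := lerP b c.
  by apply: sorted => //; rewrite ab.
have [ac|/ltW ac] := lerP a c.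
  rewrite [leRHS](_ : _ = (a - c) ^+ 2 + (c - b) ^+ 2 + (b - a) ^+ 2); last by ring.
  apply: sorted; first by rewrite ac.
  by move=> k; have := h k; congr (_ <= `|_|); ring.
rewrite [leRHS](_ : _ = (c - a) ^+ 2 + (a - b) ^+ 2 + (b - c) ^+ 2); last by ring.
apply: sorted; first by rewrite ac.
by move=> k; have := h k; congr (_ <= `|_|); ring.
Qed.

End Spread.

(** * Small determinants, and primitive vectors as basis vectors *)

Lemma det_mx22 (A : comNzRingType) (M : 'M[A]_2) :
  \det M = M 0 0 * M 1 1 - M 0 1 * M 1 0.
Proof.
(* Indexing the entries by natural numbers lets the lifted ordinals of the cofactors and the literal
   ones be identified by computation. *)
pose f i j := M (inord i) (inord j).
have E i j : M i j = f (val i) (val j) by rewrite /f !inord_val.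
rewrite (expand_det_row _ 0) !big_ord_recl big_ord0 /cofactor !det_mx11 !mxE !E.
by rewrite /= /bump /= ?addn0 ?add0n; ring.
Qed.

Lemma det_mx33 (A : comNzRingType) (M : 'M[A]_3) :
  \det M = M 0 0 * (M 1 1 * M 2 2 - M 1 2 * M 2 1)
         - M 0 1 * (M 1 0 * M 2 2 - M 1 2 * M 2 0)
         + M 0 2 * (M 1 0 * M 2 1 - M 1 1 * M 2 0).
Proof.
pose f i j := M (inord i) (inord j).
have E i j : M i j = f (val i) (val j) by rewrite /f !inord_val.
rewrite (expand_det_row _ 0) !big_ord_recl big_ord0 /cofactor !det_mx22 !mxE !E.
by rewrite /= /bump /= ?addn0 ?add0n; ring.
Qed.

(** The Smith normal form of a single column: a unimodular matrix times a multiple of the first unit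
    vector. Up to sign, [d] is the gcd of the coordinates. *)
Lemma primitive_col n (z : 'cV[int]_n.+1) : z != 0 ->
  exists2 U : 'M[int]_n.+1, U \in unitmx &
    exists2 d : int, d != 0 & z = d *: col 0 U.
Proof.
move=> z0; have [L Lu [S Su [d _ zE]]] := int_Smith_normal_form z.
exists L => //; exists (d`_0 * S 0 0).
  apply: contra_neq z0 => dS; rewrite zE; apply/matrixP => i j.
  rewrite !mxE big_ord1 ord1 mxE big_distrl big1//= => k _.
  rewrite !mxE; case: eqP => [->|_]; last by rewrite mulr0n mulr0 mul0r.
  by rewrite mulr1n -mulrA ord1 dS mulr0.
apply/matrixP => i j; rewrite {1}zE !mxE big_ord1 !ord1 mxE (bigD1 ord0)//= big1 ?addr0.
  by rewrite mxE/= mulr1n mulrC mulrA mulrAC; congr (_ * _); rewrite mulrC.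
move=> k k0; rewrite mxE; case: eqP => [k0'|_]; last by rewrite mulr0n mulr0.
by move: k0; rewrite -val_eqE/= k0'.
Qed.

(** * Hermite's bound for positive binary quadratic forms *)

Section Hermite.
Context {R : realType}.

(** Reduction of the form in a unimodular basis whose first vector is nearly minimal. With [mu] the
    infimum of the form, that vector has value [Q] between [mu] and [2 mu]. A shift of the second
    vector makes the middle coefficient at most [Q / 2], so the determinant is at least
    [Q mu - Q^2 / 4], which is at least [3/4 mu^2] on this range. *)
Lemma hermite2 (A B C l : R) : 0 < l ->
  (forall x y : int, (x, y) != (0, 0) ->
     l <= A * x%:~R ^+ 2 + 2 * B * x%:~R * y%:~R + C * y%:~R ^+ 2) ->
  3 / 4 * l ^+ 2 <= A * C - B ^+ 2.
Proof.
move=> l0 hl.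
pose Q (x y : int) : R := A * x%:~R ^+ 2 + 2 * B * x%:~R * y%:~R + C * y%:~R ^+ 2.
pose S := [set Q z.1 z.2 | z in [set z : int * int | z != (0, 0)]].
have S0 : S !=set0 by exists (Q 1 0), (1, 0).
have lbS : lbound S l by move=> _ [[x y] /= xy <-]; exact: hl.
have hS : has_inf S by split => //; exists l.
set mu := inf S.
have lmu : l <= mu by exact: lb_le_inf.
have muQ x y : (x, y) != (0, 0) -> mu <= Q x y.
  by move=> xy; apply: ge_inf; [exists l|exists (x, y)].
have mu0 : 0 < mu by exact: lt_le_trans lmu.
have [_ [[x y] /= xy <-] Qlt] := inf_adherent mu0 hS.
have [|U Uu [d d0 zE]] := @primitive_col 1 (\col_i (if i == 0 then x else y)).
  apply: contra_neq xy => /matrixP h.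
  by move: (h 0 0) (h 1 0); rewrite !mxE/= => -> ->.
have xE : x = d * U 0 0 by move/matrixP/(_ 0 0) : zE; rewrite !mxE.
have yE : y = d * U 1 0 by move/matrixP/(_ 1 0) : zE; rewrite !mxE.
set a : int := U 0 0 in xE; set b : int := U 1 0 in yE.
pose c : int := U 0 1; pose e : int := U 1 1.
have dU : ((a * e - c * b) ^+ 2)%:~R = 1 :> R.
  have : \det U \is a GRing.unit by rewrite -unitmxE.
  rewrite det_mx22 -/a -/b -/c -/e.
  by rewrite qualifE/= => /orP[]/eqP ->; rewrite ?sqrrN expr1n.
have A1 : mu <= Q a b.
  apply: muQ; apply: contra_neq xy => -[a0 b0].
  by rewrite xE yE a0 b0 mulr0.
(* [(x, y)] is [d] times the primitive vector [(a, b)], whose value can only be smaller. *)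
have A2 : Q a b <= 2 * mu.
  have : Q a b * 1 <= Q a b * d%:~R ^+ 2.
    rewrite ler_wpM2l ?(le_trans _ A1) ?(ltW mu0)// -rmorphXn/= ler1z.
    by rewrite -gtz0_ge1 exprn_even_gt0.
  have -> : Q a b * d%:~R ^+ 2 = Q x y by rewrite xE yE /Q !intrM; ring.
  by rewrite -/mu in Qlt; lra.
pose B' := A * a%:~R * c%:~R + B * (a%:~R * e%:~R + c%:~R * b%:~R) + C * b%:~R * e%:~R.
(* Adding [k] times the first basis vector to the second changes the middle coefficient [B'] to
   [B' + k Q], of size at most [Q / 2]. *)
have [k hk] := near_int (B' / Q a b).
have Q0 : 0 < Q a b by exact: lt_le_trans A1.
have Cmu : mu <= Q (c + k * a) (e + k * b).
  apply: muQ; apply/eqP => -[h1 h2]; move: dU.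
  have -> : c = - (k * a) by apply/eqP; rewrite -addr_eq0 h1.
  have -> : e = - (k * b) by apply/eqP; rewrite -addr_eq0 h2.
  rewrite (_ : _ ^+ 2 = 0) ?mulr0z; last by ring.
  by move/eqP; rewrite eq_sym oner_eq0.
have disc : Q a b * Q (c + k * a) (e + k * b) - (B' + k%:~R * Q a b) ^+ 2 = A * C - B ^+ 2.
  have dU' : (a%:~R * e%:~R - c%:~R * b%:~R) ^+ 2 = 1 :> R.
    by rewrite -!intrM -intrB -rmorphXn.
  by rewrite /Q /B' !intrD !intrM -[RHS]mulr1 -[in RHS]dU'; ring.
have hB : (B' + k%:~R * Q a b) ^+ 2 <= Q a b ^+ 2 / 4.
  have -> : B' + k%:~R * Q a b = Q a b * (k%:~R + B' / Q a b).
    by field; rewrite gt_eqF.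
  rewrite exprMn -(real_normK (num_real (_ + B' / _))).
  have : `|k%:~R + B' / Q a b| ^+ 2 <= (1 / 2) ^+ 2 by rewrite ler_pXn2r// nnegrE.
  by have := sqr_ge0 (Q a b); nra.
rewrite -disc.
have : Q a b * mu <= Q a b * Q (c + k * a) (e + k * b) by rewrite ler_wpM2l// ltW.
nra.
Qed.

End Hermite.

(** * From nearly minimal vectors to bounds on the determinant *)

Section NormMinBounds.
Context {R : realType}.

(** A vector with coordinate product below [N(B) / t] is made primitive, completed to a basis, and
    scaled to [(1, ..., 1)]. This divides all products, and the determinant, by its own product
    [nu], and [N(B) <= nu < N(B) / t]. *)
Lemma near_min_basis n (B : 'M[R]_n.+1) t : B \in unitmx -> 0 < normmin B ->
  0 < t < 1 -> exists B' : 'M[R]_n.+1,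
    [/\ forall i, B' i 0 = 1,
        forall z, z != 0 -> t <= `|\prod_i ivec B' z i 0| &
        `|\det B'| * normmin B <= `|\det B|].
Proof.
move=> Bu m0 /andP[t0 t1].
have [|z z0 zlt] := @normmin_lt _ _ B (normmin B / t) isT.
  by rewrite ltr_pdivlMr// gtr_pMr.
have [U Uu [d d0 zE]] := primitive_col z0.
pose B1 := B *m map_mx intr U.
have detU : `|\det (map_mx intr U : 'M[R]_n.+1)| = 1.
  rewrite det_map_mx.
  have : \det U \is a GRing.unit by rewrite -unitmxE.
  by rewrite qualifE/= => /orP[]/eqP ->; rewrite ?mulrN1z ?normrN normr1.
have B1E w : ivec B1 w = ivec B (U *m w).
  by rewrite /ivec /B1 map_mxM mulmxA.
pose e := delta_mx 0 0 : 'cV[int]_n.+1.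
have nu_le : `|\prod_i ivec B1 e i 0| <= `|\prod_i ivec B z i 0|.
  have -> : ivec B z = d%:~R *: ivec B1 e.
    rewrite B1E zE colE /ivec; apply/matrixP => i j.
    rewrite !mxE big_distrr; apply: eq_bigr => k _.
    by rewrite !mxE intrM mulrCA.
  under [in leRHS]eq_bigr do rewrite mxE.
  rewrite big_split/= prodr_const card_ord normrM normrX.
  rewrite ler_peMl// exprn_ege1// -intr_norm ler1z.
  by rewrite -gtz0_ge1 normr_gt0.
have e0 : U *m e != 0.
  apply/eqP => /(congr1 (mulmx (invmx U))); rewrite mulKmx// mulmx0.
  by move/matrixP/(_ 0 0); rewrite !mxE !eqxx.
set nu := `|\prod_i ivec B1 e i 0| in nu_le.
have m_nu : normmin B <= nu by rewrite /nu B1E; exact: normmin_le.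
have nu0 : 0 < nu by exact: lt_le_trans m_nu.
have ve i : ivec B1 e i 0 != 0.
  move: nu0; rewrite /nu normr_gt0 => /prodf_neq0; exact.
pose D := diag_mx (\row_i (ivec B1 e i 0)^-1).
have Dd : is_diag_mx D by exact: diag_mx_is_diag.
have detD : `|\det D| = nu^-1.
  rewrite det_diag; under eq_bigr do rewrite mxE.
  by rewrite prodfV normfV.
exists (D *m B1); split.
- move=> i; have -> : (D *m B1) i 0 = (ivec (D *m B1) e) i 0.
    by rewrite /ivec map_delta_mx -colE [RHS]mxE.
  have Dii : D i i = (ivec B1 e i 0)^-1 by rewrite mxE eqxx mulr1n mxE.
  by rewrite /ivec -mulmxA diag_mulE// Dii mulVf ?ve.
- move=> w w0; rewrite diag_prod// normrM detD B1E mulrC ler_pdivlMr//.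
  apply: le_trans (_ : normmin B <= _).
    by rewrite mulrC -ler_pdivlMr// (le_trans nu_le)// ltW.
  apply: normmin_le; apply/eqP => /(congr1 (mulmx (invmx U))).
  by rewrite mulKmx// mulmx0 => /eqP; rewrite (negPf w0).
- rewrite !det_mulmx !normrM detD detU mulr1 mulrAC -{2}[`|\det B|]mul1r.
  by rewrite ler_wpM2r// mulrC ler_pdivrMr// mul1r.
Qed.

(** Lets [t] tend to 1 from the left in the bounds obtained from nearly minimal vectors. *)
Lemma le_limit1 (x y : R) (t0 : R) (c : R -> R) : continuous c -> t0 < 1 ->
  (forall t, t0 <= t < 1 -> c t * x <= y) -> c 1 * x <= y.
Proof.
move=> cc t01 h; have cx : c t * x @[t --> 1^'-] --> c 1 * x.
  by apply: cvgMr_tmp; exact/cvg_at_left_filter/cc.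
rewrite -(cvg_lim _ cx)//; apply: limr_le; first by apply/cvg_ex; exists (c 1 * x).
near=> t; apply: h; apply/andP; split; near: t.
  exact: nbhs_left_ge.
exact: nbhs_left_lt.
Unshelve. all: by end_near. Qed.

Lemma normmin_upper2 (B : 'M[R]_2) : B \in unitmx ->
  Num.sqrt 5 * normmin B <= `|\det B|.
Proof.
move=> Bu; have := @normmin_ge0 _ _ B isT; rewrite le_eqVlt => /predU1P[<-|m0].
  by rewrite mulr0.
have -> : Num.sqrt 5 = (fun t : R => Num.sqrt (4 * t ^+ 2 + 1)) 1.
  by rewrite expr1n mulr1; congr Num.sqrt; ring.
apply: (@le_limit1 _ _ (1 / 2) (fun t => Num.sqrt (4 * t ^+ 2 + 1))); last 2 first.
- lra.
- move=> t /andP[t1 t2].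
  have [|B' [B'1 ht hd]] := near_min_basis Bu m0 (t := t).
    by apply/andP; split; lra.
  apply: le_trans hd; rewrite ler_wpM2r ?(ltW m0)// -sqrtr_sqr ler_wsqrtr//.
  (* As the first column consists of ones, the determinant is the difference of the entries of the
     second column, to which [spread2] applies. *)
  have -> : \det B' ^+ 2 = (B' 0 1 - B' 1 1) ^+ 2.
    by rewrite det_mx22 !B'1; ring.
  apply: spread2; first by apply/andP; split; lra.
  move=> k; have := ht (\col_i (if i == 0 then k else 1)).
  rewrite /ivec !big_ord_recl big_ord0 !mxE !big_ord_recl !big_ord0 !mxE/= mulr1.
  have -> : lift ord0 ord0 = 1 :> 'I_2 by exact/val_inj.
  rewrite !B'1 !addr0 !mul1r !mulr1; apply.
  by apply/eqP => /matrixP/(_ 1 0); rewrite !mxE.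
- move=> t; apply: (@continuous_comp _ _ _ (fun t : R => 4 * t ^+ 2 + 1) Num.sqrt); last exact: sqrt_continuous.
  apply: cvgD; last exact: cvg_cst.
  by apply: cvgMl_tmp; exact: exprn_continuous.
Qed.

Lemma normmin_upper3 (B : 'M[R]_3) : B \in unitmx ->
  7 * normmin B <= `|\det B|.
Proof.
move=> Bu; have := @normmin_ge0 _ _ B isT; rewrite le_eqVlt => /predU1P[<-|m0].
  by rewrite mulr0.
have -> : 7 = (fun t : R => 4 * t ^+ 2 + 3) 1.
  by rewrite expr1n mulr1; ring.
apply: (@le_limit1 _ _ (9 / 10) (fun t => 4 * t ^+ 2 + 3)); last 2 first.
- lra.
- move=> t /andP[t1 t2].
  have [|B' [B'1 ht hd]] := near_min_basis Bu m0 (t := t).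
    by apply/andP; split; lra.
  apply: le_trans hd; rewrite ler_wpM2r ?(ltW m0)//.
  pose u1 := B' 0 1 - B' 1 1; pose u2 := B' 1 1 - B' 2 1; pose u3 := B' 2 1 - B' 0 1.
  pose v1 := B' 0 2 - B' 1 2; pose v2 := B' 1 2 - B' 2 2; pose v3 := B' 2 2 - B' 0 2.
  have l0 : 0 < 2 * (4 * t ^+ 2 + 3) by nra.
  have := @hermite2 _ (u1 ^+ 2 + u2 ^+ 2 + u3 ^+ 2) (u1 * v1 + u2 * v2 + u3 * v3)
    (v1 ^+ 2 + v2 ^+ 2 + v3 ^+ 2) _ l0.
  (* Lagrange's identity: the left-hand side is the squared length of the cross product of [u] and
     [v]. Both have coordinate sum 0, so its three entries are equal, each being the determinant up
     to sign. *)
  have -> : (u1 ^+ 2 + u2 ^+ 2 + u3 ^+ 2) * (v1 ^+ 2 + v2 ^+ 2 + v3 ^+ 2) -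
      (u1 * v1 + u2 * v2 + u3 * v3) ^+ 2 = 3 * \det B' ^+ 2.
    by rewrite det_mx33 !B'1 /u1 /u2 /u3 /v1 /v2 /v3; ring.
  move=> hh; rewrite -(@ler_pXn2r _ 2)// ?nnegrE//; last by nra.
  rewrite real_normK ?num_real//.
  suff : 3 / 4 * (2 * (4 * t ^+ 2 + 3)) ^+ 2 <= 3 * \det B' ^+ 2 by nra.
  apply: hh => x y xy.
  pose P i := B' i 1 * x%:~R + B' i 2 * y%:~R.
  have -> : (u1 ^+ 2 + u2 ^+ 2 + u3 ^+ 2) * x%:~R ^+ 2 +
      2 * (u1 * v1 + u2 * v2 + u3 * v3) * x%:~R * y%:~R +
      (v1 ^+ 2 + v2 ^+ 2 + v3 ^+ 2) * y%:~R ^+ 2 =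
      (P 0 - P 1) ^+ 2 + (P 1 - P 2) ^+ 2 + (P 2 - P 0) ^+ 2.
    by rewrite /P /u1 /u2 /u3 /v1 /v2 /v3; ring.
  apply: spread3; first by apply/andP; split; lra.
  move=> k; have := ht (\col_i (if i == 0 then k else if i == 1 then x else y)).
  rewrite /ivec !big_ord_recl big_ord0 !mxE !big_ord_recl !big_ord0 !mxE/= mulr1.
  have -> : lift ord0 ord0 = 1 :> 'I_3 by exact/val_inj.
  have -> : lift ord0 (lift ord0 ord0) = 2 :> 'I_3 by exact/val_inj.
  rewrite !B'1 !addr0 !mul1r mulrA; apply.
  apply: contra_neq xy => /matrixP z0.
  by move: (z0 1 0) (z0 2 0); rewrite !mxE/= => -> ->.
- move=> t; apply: cvgD; last exact: cvg_cst.
  by apply: cvgMl_tmp; exact: exprn_continuous.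
Qed.

End NormMinBounds.

(** * Power integral bases *)

(** Gauss's lemma: the factor [X - x] of a monic integer polynomial is a rational multiple of an
    integer polynomial [p1] dividing it, and the leading coefficient of [p1] is a unit. *)
Lemma integral_rat (F : numFieldType) (x : rat) :
  integralOver (intr : int -> F) (ratr x) -> x \is a Num.int.
Proof.
case=> p p_mon px.
have px' : root (map_poly (intr : int -> rat) p) x.
  move: px; rewrite /root.
  have -> : map_poly (intr : int -> F) p = map_poly ratr (map_poly (intr : int -> rat) p).
    by rewrite -map_poly_comp; apply: eq_map_poly => k /=; rewrite ratr_int.
  by rewrite horner_map fmorph_eq0.
move: px'; rewrite root_factor_theorem => /dvdpP_rat_int[p1 [a a0 pE] [q qE]].
have lc : lead_coef p1 * lead_coef q = 1.
  by rewrite -lead_coefM -qE; exact/eqP.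
have size_p1 : size p1 = 2%N.
  by rewrite -(size_rat_int_poly p1) -(size_scale _ a0) -pE size_XsubC.
have a1 : 1 = a * (p1`_1)%:~R.
  by have /(congr1 (fun u : {poly rat} => u`_1)) := pE; rewrite coefB coefX coefC coefZ coef_map/= subr0.
have x1 : x = - (a * (p1`_0)%:~R).
  have /(congr1 (fun u : {poly rat} => u`_0)) := pE.
  rewrite coefB coefX coefC coefZ coef_map/= sub0r => h.
  by rewrite -h opprK.
have p11 : p1`_1 \is a GRing.unit.
  have := lc; rewrite lead_coefE size_p1/= => h.
  by apply/unitrP; exists (lead_coef q); rewrite h mulrC h.
have aint : a \is a Num.int.
  move: p11 a1; rewrite qualifE/= => /orP[]/eqP ->.
    by rewrite mulr1 => <-.
  by rewrite mulrN1 => /(congr1 -%R); rewrite opprK => <-; rewrite rpredN.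
by rewrite x1 rpredN; apply: rpredM => //; exact: intr_int.
Qed.

(** * Closure properties of algebraic integers *)

Section IntegralClosure.
Variable F : fieldType.
Local Notation Zint := (integralOver (intr : int -> F)).

Lemma integralOver_int (k : int) : Zint k%:~R.
Proof. exact: integral_id. Qed.

Lemma integralOver_zero : Zint 0.
Proof. by have := integralOver_int 0; rewrite mulr0z. Qed.

Lemma integralOver_sum (I : Type) (s : seq I) (P : pred I) (E : I -> F) :
  (forall i, P i -> Zint (E i)) -> Zint (\sum_(i <- s | P i) E i).
Proof.
move=> h; elim/big_rec: _ => [|i x Pi hx]; first exact: integralOver_zero.
by apply: integral_add => //; exact: h.
Qed.

Lemma integralOver_prod (I : Type) (s : seq I) (P : pred I) (E : I -> F) :
  (forall i, P i -> Zint (E i)) -> Zint (\prod_(i <- s | P i) E i).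
Proof.
move=> h; elim/big_rec: _ => [|i x Pi hx]; first exact: integral1.
by apply: integral_mul => //; exact: h.
Qed.

Lemma integralOver_exp x k : Zint x -> Zint (x ^+ k).
Proof.
move=> hx; elim: k => [|k ih]; first by rewrite expr0; exact: integral1.
by rewrite exprS; exact: integral_mul.
Qed.

Lemma integralOver_det n (M : 'M[F]_n) : (forall i j, Zint (M i j)) -> Zint (\det M).
Proof.
move=> h; apply: integralOver_sum => s _; apply: integral_mul.
  by apply/integralOver_exp/integral_opp/integral1.
by apply: integralOver_prod => i _; exact: h.
Qed.

Lemma integralOver_cofactor n (M : 'M[F]_n) i j : (forall i j, Zint (M i j)) ->
  Zint (cofactor M i j).
Proof.
move=> h; apply: integral_mul; first by apply/integralOver_exp/integral_opp/integral1.
by apply: integralOver_det => k l; rewrite !mxE.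
Qed.

Lemma integralOver_mulrz x (k : int) : Zint x -> Zint (x *~ k).
Proof. by move=> hx; rewrite -mulrzr; apply: integral_mul => //; exact: integralOver_int. Qed.

End IntegralClosure.

(** * Fields whose ring of integers is spanned by the powers of one element *)

Section PowerBasis.
(** [r] lists the real roots of the monic [g], and the first of them, [gen], generates the same
    field as [theta], which is [h] evaluated at it. The discriminant of the powers is [d]; it allows
    only divisors of [l^m] as denominators of the coefficients of integers, and [l_descent] then
    removes them. *)
Variables (R : realType) (theta : R[i]) (n : nat) (r : 'I_n.+1 -> R).
Variables (g : {poly int}) (h : {poly rat}) (l m : nat) (d : int).
Local Notation C := R[i].
Local Notation Zint := (integralOver (intr : int -> C)).
Local Notation rc i := ((r i)%:C)%C.
Local Notation gen := (rc 0).
Local Notation qev q x := (map_poly (ratr : rat -> C) q).[x].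
Local Notation G := (map_poly (intr : int -> rat) g).
Local Notation K := (Qadjoin theta).

Hypotheses (g_monic : g \is monic) (size_g : size g = n.+2).
Hypothesis g_root : forall i, root (map_poly intr g) (r i).
Hypotheses (gen_theta : gen \in adjoinQ theta) (theta_gen : theta = qev h gen).
Hypothesis l_gt1 : (1 < l)%N.
Hypothesis l_descent : forall a : 'I_n.+1 -> int,
  Zint (\sum_j (a j)%:~R * gen ^+ j / l%:R) ->
  exists b : 'I_n.+1 -> int, forall j, a j = b j * l%:Z.
Hypotheses (d_neq0 : d != 0)
  (detV : (\det (\matrix_(i, j) r i ^+ j : 'M[R]_n.+1)) ^+ 2 = d%:~R).
Hypothesis d_denom : forall c : rat, c ^+ 2 * d%:~R \is a Num.int ->
  c * l%:R ^+ m \is a Num.int.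

Lemma root_gC i : root (map_poly (intr : int -> C) g) (rc i).
Proof.
have -> : map_poly (intr : int -> C) g =
    map_poly (real_complex R) (map_poly (intr : int -> R) g).
  by rewrite -map_poly_comp; apply: eq_map_poly => k /=; rewrite rmorph_int.
by rewrite /root horner_map; have /eqP -> := g_root i; rewrite rmorph0.
Qed.

Lemma integral_r i : Zint (rc i).
Proof. by exists g => //; exact: root_gC. Qed.

Lemma qev_GE x : qev G x = (map_poly (intr : int -> C) g).[x].
Proof.
rewrite -map_poly_comp (@eq_map_poly _ _ _ (intr : int -> C))//.
by move=> k /=; rewrite ratr_int.
Qed.

Lemma qev_G i : qev G (rc i) = 0.
Proof. by rewrite qev_GE; apply/eqP; exact: root_gC. Qed.

Lemma lC_neq0 : (l%:R : C) != 0.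
Proof. by rewrite pnatr_eq0 -lt0n (ltn_trans _ l_gt1). Qed.

Lemma qev_wide (q : {poly rat}) x : (size q <= n.+1)%N ->
  qev q x = \sum_(j < n.+1) ratr q`_j * x ^+ j.
Proof.
move=> sq; rewrite (@horner_coef_wide _ n.+1); last first.
  by rewrite (leq_trans (size_poly _ _)).
by apply: eq_bigr => j _; rewrite coef_map.
Qed.

Lemma qevB p q x : qev (p - q) x = qev p x - qev q x.
Proof. by rewrite rmorphB hornerD hornerN. Qed.

Lemma qevD p q x : qev (p + q) x = qev p x + qev q x.
Proof. by rewrite rmorphD hornerD. Qed.

Lemma qevM p q x : qev (p * q) x = qev p x * qev q x.
Proof. by rewrite rmorphM hornerM. Qed.

Lemma qevZ c q x : qev (c *: q) x = ratr c * qev q x.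
Proof. by rewrite map_polyZ hornerZ. Qed.

Lemma qev1 x : qev 1 x = 1.
Proof. by rewrite rmorph1 hornerC. Qed.

Lemma l_descent_exp k (a : 'I_n.+1 -> int) :
  Zint (\sum_j (a j)%:~R * gen ^+ j / l%:R ^+ k) ->
  exists b : 'I_n.+1 -> int, forall j, a j = b j * l%:Z ^+ k.
Proof.
elim: k a => [|k ih] a ha; first by exists a => j; rewrite expr0 mulr1.
have l0 := lC_neq0.
have [b hb] : exists b : 'I_n.+1 -> int, forall j, a j = b j * l%:Z.
  apply: l_descent.
  have -> : \sum_j (a j)%:~R * gen ^+ j / l%:R =
      (l%:Z ^+ k)%:~R * \sum_j (a j)%:~R * gen ^+ j / l%:R ^+ k.+1 :> C.
    rewrite big_distrr; apply: eq_bigr => j _ /=; rewrite rmorphXn/= exprS.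
    by rewrite -pmulrn; field; rewrite expf_neq0 ?l0.
  by apply: integral_mul => //; exact: integralOver_int.
have [|b' hb'] := ih b.
  move: ha; congr integralOver; apply: eq_bigr => j _.
  by rewrite hb intrM -pmulrn exprS; field; rewrite expf_neq0 ?l0.
by exists b' => j; rewrite hb hb' exprS mulrAC -mulrA.
Qed.

(** A vanishing combination stays integral after division by every power of [l], so every power of
    [l] divides each [a j]. With exponent [k = |a j|] this forces [a j = 0], since [l^k > k]. *)
Lemma power_free_int (a : 'I_n.+1 -> int) :
  \sum_j (a j)%:~R * gen ^+ j = 0 -> forall j, a j = 0.
Proof.
move=> a0 j; pose k := absz (a j).
have [|b hb] := @l_descent_exp k a.
  by rewrite -big_distrl/= a0 mul0r; exact: integralOver_zero.
have := hb j; have [->|b0 aE] := eqVneq (b j) 0; first by rewrite mul0r.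
have : (k < l ^ k)%N by exact: ltn_expl.
have : (l ^ k <= k)%N.
  rewrite {2}/k aE abszM abszX/= leq_pmull// absz_gt0//.
by rewrite leqNgt => /negPf ->.
Qed.

Lemma qev_inj0 (q : {poly rat}) : (size q <= n.+1)%N -> qev q gen = 0 -> q = 0.
Proof.
have [q' [a a0 ->]] := rat_poly_scale q.
have a0' : a%:~R^-1 != 0 :> rat by rewrite invr_eq0 intr_eq0.
rewrite size_scale// size_rat_int_poly map_polyZ/= hornerZ => sq /eqP.
rewrite mulf_eq0 fmorph_eq0 (negPf a0')/= -map_poly_comp => /eqP.
rewrite (@eq_map_poly _ _ _ (intr : int -> C)); last first.
  by move=> k /=; rewrite ratr_int.
rewrite (@horner_coef_wide _ n.+1); last by rewrite (leq_trans (size_poly _ _)).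
under eq_bigr do rewrite coef_map.
move=> /power_free_int q0; suff -> : q' = 0 by rewrite map_poly0 scaler0.
apply/polyP => j; rewrite coef0; have [jn|nj] := ltnP j n.+1.
  exact: (q0 (Ordinal jn)).
by rewrite nth_default// (leq_trans sq).
Qed.

Lemma G_size : size G = n.+2.
Proof. by rewrite size_rat_int_poly. Qed.

Lemma G_neq0 : G != 0.
Proof. by rewrite -size_poly_eq0 G_size. Qed.

Lemma size_modG (q : {poly rat}) : (size (q %% G)%R <= n.+1)%N.
Proof. by have := ltn_modp q G; rewrite G_neq0 G_size ltnS. Qed.

Lemma qev_mod q i : qev (q %% G) (rc i) = qev q (rc i).
Proof.
by rewrite {2}(divp_eq q G) qevD qevM qev_G mulr0 add0r.
Qed.

(** [G] is thus the minimal polynomial of [gen] over the rationals. *)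
Lemma dvd_G q : qev q gen = 0 -> G %| q.
Proof.
move=> q0; apply/modp_eq0P; apply: qev_inj0; first exact: size_modG.
by rewrite qev_mod.
Qed.

Lemma qev_conj q i : qev q gen = 0 -> qev q (rc i) = 0.
Proof.
move=> /dvd_G/dvdpP[q' ->].
by rewrite qevM qev_G mulr0.
Qed.

Lemma qev_conj2 p q i : qev p gen = qev q gen -> qev p (rc i) = qev q (rc i).
Proof.
move=> pq; apply/eqP; rewrite -subr_eq0 -qevB.
by apply/eqP/qev_conj; rewrite qevB pq subrr.
Qed.

(** A nontrivial common factor of [q] and [G] would make either a proper factor of [G] or [q] itself
    vanish at [gen]. So the two are coprime, and a Bezout relation provides the inverse. *)
Lemma qev_inv q : qev q gen != 0 -> exists p, (qev q gen)^-1 = qev p gen.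
Proof.
move=> q0; have cop : coprimep q G.
  apply/negPn/negP => ncop.
  have /dvdpP[f fE] := dvdp_gcdr q G; have /dvdpP[e eE] := dvdp_gcdl q G.
  have gcd0 : gcdp q G != 0 by rewrite gcdp_eq0 (negPf G_neq0) andbF.
  have f0 : f != 0 by apply: contraTneq G_neq0 => f0; rewrite fE f0 mul0r negbK.
  have : qev f gen * qev (gcdp q G) gen = 0.
    by rewrite -qevM -fE qev_G.
  move/eqP; rewrite mulf_eq0 => /orP[/eqP/dvd_G/dvdp_leq|/eqP gcd_root].
    move=> /(_ f0); rewrite {1}fE size_mul// addnC -ltnS.
    have : (1 < size (gcdp q G))%N.
      by rewrite ltn_neqAle eq_sym ncop lt0n size_poly_eq0.
    case: (size (gcdp q G)) => [|[|k]]// _; rewrite addSn/=.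
    by lia.
  by move: q0; rewrite eE qevM gcd_root mulr0 eqxx.
have /Bezout_coprimepP[[u v] /= /eqpf_eq[c c0 uv]] := cop.
have uq : qev u gen * qev q gen = ratr c.
  have : qev (u * q + v * G) gen = ratr c by rewrite uv qevZ qev1 mulr1.
  by rewrite qevD !qevM qev_G mulr0 addr0.
exists (c^-1 *: u); rewrite qevZ fmorphV.
have c0' : ratr c != 0 :> C by rewrite fmorph_eq0.
by apply: (mulIf q0); rewrite mulVf// -mulrA uq mulVf.
Qed.

(** The values of rational polynomials at [gen] form a subfield containing [theta]. *)
Lemma adjoinQ_qev x : x \in adjoinQ theta -> exists q, x = qev q gen.
Proof.
move=> /asboolP/(_ [pred x | `[< exists q, x = qev q gen >]]) xS.
apply/asboolP; apply: xS; last by apply/asboolP; exists h.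
split=> [|_ _ /asboolP[p ->] /asboolP[q ->]|_ _ /asboolP[p ->] /asboolP[q ->]].
- by apply/asboolP; exists 1; rewrite qev1.
- by apply/asboolP; exists (p - q); rewrite qevB.
- apply/asboolP; have [->|/qev_inv[q' ->]] := eqVneq (qev q gen) 0.
    by exists 0; rewrite invr0 mulr0 rmorph0 horner0.
  by exists (p * q'); rewrite qevM.
Qed.

Definition xi : K := QAdjoin gen_theta.

Definition vK : {rmorphism K -> C} := (val : K -> C).

Lemma vKE (x : K) : val x = vK x. Proof. by []. Qed.

(** The embedding replaces [gen] by its conjugate [r i]. It does not depend on the polynomial chosen
    for [x], because the minimal polynomial [G] of [gen] also vanishes at [r i]. *)
Lemma conj_morph i : exists f : {rmorphism K -> C},
  forall (x : K) q, val x = qev q gen -> f x = qev q (rc i).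
Proof.
have [qof qofE] := choice (fun x : K => adjoinQ_qev (valP x)).
pose f (x : K) := qev (qof x) (rc i).
have fE (x : K) q : val x = qev q gen -> f x = qev q (rc i).
  by rewrite qofE => /qev_conj2; exact.
have fB : zmod_morphism f.
  move=> x y; rewrite -qevB; apply: fE.
  by rewrite vKE rmorphB qevB -!qofE.
have fM : monoid_morphism f.
  split; first by rewrite (fE 1 1) ?qev1// vKE rmorph1.
  move=> x y; rewrite -qevM; apply: fE.
  by rewrite vKE rmorphM qevM -!qofE.
pose M1 := GRing.isZmodMorphism.Build K C f fB.
pose M2 := GRing.isMonoidMorphism.Build K C f fM.
by exists (HB.pack f M1 M2 : {rmorphism K -> C}).
Qed.

Lemma K_qev (x : K) q : val x = qev q gen ->
  x = (map_poly (ratr : rat -> K) q).[xi].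
Proof.
move=> xq; apply: val_inj; rewrite xq vKE -horner_map; congr _.[_].
rewrite -map_poly_comp; apply: eq_map_poly => c.
exact/esym/fmorph_rat.
Qed.

Lemma morph_qev (f : {rmorphism K -> C}) (x : K) q : val x = qev q gen ->
  f x = qev q (f xi).
Proof.
move=> /K_qev ->; rewrite -horner_map -map_poly_comp.
by congr _.[_]; apply: eq_map_poly => c /=; rewrite fmorph_rat.
Qed.

Lemma det_neq0 : \det (\matrix_(i, j) r i ^+ j : 'M[R]_n.+1) != 0.
Proof.
apply: contra_neq d_neq0 => dV0; move: detV; rewrite dV0 expr0n/=.
by move/eqP; rewrite eq_sym intr_eq0 => /eqP.
Qed.

Lemma r_inj : injective r.
Proof.
move=> i j rij; apply: contraTeq det_neq0 => ij; rewrite negbK.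
apply/eqP/(determinant_alternate ij) => k; by rewrite !mxE rij.
Qed.

(** The image of [xi] is a root of [g]; as one more root besides the [n + 1] distinct [r i] it would
    exceed the degree. *)
Lemma morph_root (f : {rmorphism K -> C}) : exists i, f xi = rc i.
Proof.
apply: contrapT => nf.
have fr : root (map_poly (intr : int -> C) g) (f xi).
  have : (map_poly (ratr : rat -> K) G).[xi] = 0.
    apply: val_inj; rewrite !vKE rmorph0 -horner_map -[RHS](qev_G 0); congr _.[_].
    by rewrite -[LHS]map_poly_comp; apply: eq_map_poly => c; exact: fmorph_rat.
  move/(congr1 f); rewrite rmorph0 -horner_map.
  have -> : map_poly f (map_poly (ratr : rat -> K) G) = map_poly (ratr : rat -> C) G.
    by rewrite -[LHS]map_poly_comp; apply: eq_map_poly => c; exact: fmorph_rat.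
  by rewrite qev_GE => /eqP.
pose s := f xi :: [seq rc i | i <- enum 'I_n.+1].
have := @max_poly_roots _ (map_poly (intr : int -> C) g) s.
have sC : size (map_poly (intr : int -> C) g) = n.+2.
  by rewrite size_map_inj_poly//; exact: intr_inj.
rewrite -size_poly_eq0 sC /= size_map size_enum_ord ltnn => /(_ isT) abs.
suff : false by [].
apply: abs.
  by rewrite fr; apply/allP => _ /mapP[i _ ->]; exact: root_gC.
rewrite map_inj_uniq ?enum_uniq ?andbT; last first.
  by move=> i j /(@fmorph_inj _ _ (real_complex R)); exact: r_inj.
by apply/mapP => -[i _ fi]; apply: nf; exists i.
Qed.

Lemma integral_val (x : K) : integralOver (intr : int -> K) x -> Zint (val x).
Proof.
case=> p p_mon px; exists p => //.
have -> : map_poly (intr : int -> C) p = map_poly vK (map_poly intr p).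
  by rewrite -map_poly_comp; apply: eq_map_poly => k; exact/esym/rmorph_int.
by rewrite vKE rmorph_root.
Qed.

Lemma integral_morph (f : {rmorphism K -> C}) (x : K) :
  integralOver (intr : int -> K) x -> Zint (f x).
Proof.
case=> p p_mon px; exists p => //.
have -> : map_poly (intr : int -> C) p = map_poly f (map_poly intr p).
  by rewrite -map_poly_comp; apply: eq_map_poly => k /=; rewrite rmorph_int.
by rewrite rmorph_root.
Qed.

Lemma integral_xi : integralOver (intr : int -> K) xi.
Proof.
exists g => //; rewrite -(fmorph_root vK) -map_poly_comp.
have := root_gC 0; congr (root _ _); apply: eq_map_poly => k.
exact/esym/rmorph_int.
Qed.

Lemma xi_sum_int (z : 'I_n.+1 -> int) :
  val (\sum_(j < n.+1) xi ^+ j *~ z j) = \sum_j (z j)%:~R * gen ^+ j.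
Proof.
rewrite vKE rmorph_sum; apply: eq_bigr => j _.
by rewrite -mulrzr rmorphM rmorph_int rmorphXn mulrC.
Qed.

(** The conjugates of [x] are the Vandermonde matrix [V] applied to its rational coefficients. By
    Cramer's rule [\det V] times a coefficient is integral, and so is its square, [d] times the
    squared coefficient, which is rational. Hence the denominators divide [l^m], and the descent
    removes them. *)
Lemma power_span (x : K) : integralOver (intr : int -> K) x ->
  exists z : 'I_n.+1 -> int, x = \sum_(j < n.+1) xi ^+ j *~ z j.
Proof.
move=> xint; have [q0 xq0] := adjoinQ_qev (valP x).
pose q := q0 %% G; have sq : (size q <= n.+1)%N := size_modG q0.
have xq : val x = qev q gen by rewrite /q qev_mod.
pose V : 'M[C]_n.+1 := \matrix_(i, j) rc i ^+ j.
pose c : 'cV[C]_n.+1 := \col_j ratr q`_j.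
have Vint i j : Zint (V i j) by rewrite mxE; exact/integralOver_exp/integral_r.
have Vc i : Zint ((V *m c) i 0).
  have [f fE] := conj_morph i; have := integral_morph f xint.
  rewrite (fE _ _ xq) qev_wide// mxE; congr integralOver; apply: eq_bigr => j _.
  by rewrite !mxE mulrC.
have dV : (\det V) ^+ 2 = d%:~R.
  have -> : V = map_mx (real_complex R) (\matrix_(i, j) r i ^+ j).
    by apply/matrixP => i j; rewrite !mxE rmorphXn.
  by rewrite det_map_mx -rmorphXn/= detV rmorph_int.
have cint j : q`_j * l%:R ^+ m \is a Num.int.
  have [jn|nj] := ltnP j n.+1; last by rewrite nth_default ?mul0r ?(leq_trans sq).
  apply: d_denom; apply: (@integral_rat C).
  have -> : ratr (q`_j ^+ 2 * d%:~R) = (\det V * c (Ordinal jn) 0) ^+ 2.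
    by rewrite exprMn dV mxE rmorphM rmorphXn/= ratr_int mulrC.
  apply: integralOver_exp.
  have -> : \det V * c (Ordinal jn) 0 = (\adj V *m (V *m c)) (Ordinal jn) 0.
    by rewrite mulmxA mul_adj_mx mul_scalar_mx [RHS]mxE.
  rewrite mxE; apply: integralOver_sum => i _; apply: integral_mul => //.
  by rewrite mxE; exact: integralOver_cofactor.
pose a (j : 'I_n.+1) : int := Num.floor (q`_j * l%:R ^+ m).
have aE j : (a j)%:~R = q`_j * l%:R ^+ m by exact/floorK.
have l0 := lC_neq0.
have qE (j : 'I_n.+1) : ratr q`_j = (a j)%:~R / l%:R ^+ m :> C.
  by rewrite -[(a j)%:~R](ratr_int C) aE rmorphM rmorphXn/= ratr_nat mulfK// expf_neq0.
have [|b bE] := @l_descent_exp m a.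
  have := integral_val xint; rewrite xq qev_wide//; congr integralOver.
  by apply: eq_bigr => j _; rewrite qE mulrAC.
exists b; apply: val_inj; rewrite xi_sum_int xq qev_wide//.
apply: eq_bigr => j _; rewrite qE bE intrM rmorphXn/= -pmulrn mulfK//.
by rewrite expf_neq0.
Qed.

Lemma power_inj (z z' : 'I_n.+1 -> int) :
  \sum_(j < n.+1) xi ^+ j *~ z j = \sum_(j < n.+1) xi ^+ j *~ z' j -> forall j, z j = z' j.
Proof.
move/(congr1 val); rewrite !xi_sum_int => /eqP; rewrite -subr_eq0 -sumrB => /eqP e.
move=> j; apply/eqP; rewrite -subr_eq0; apply/eqP.
apply: (@power_free_int (fun j => z j - z' j)).
by rewrite -[RHS]e; apply: eq_bigr => k _; rewrite intrB mulrBl.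
Qed.

Theorem embedding_matrix_power :
  embedding_matrix theta (\matrix_(i, j) r i ^+ j : 'M[R]_n.+1).
Proof.
have [f fE] := choice conj_morph.
have xiE : val xi = qev 'X gen by rewrite map_polyX hornerX.
have fxi i : f i xi = rc i by rewrite (fE _ _ _ xiE) map_polyX hornerX.
exists f, (fun j : 'I_n.+1 => xi ^+ j); split.
- split=> [i j fij|f'].
    have := fij xi; rewrite !fxi => /(@fmorph_inj _ _ (real_complex R)).
    exact: r_inj.
  have [i f'i] := morph_root f'; exists i => x.
  have [q xq] := adjoinQ_qev (valP x).
  by rewrite (fE _ _ _ xq) (morph_qev f' xq) f'i.
- split=> [j|x /power_span[z ->]]; first exact/integralOver_exp/integral_xi.
  exists [ffun j => z j]; split; first by under [RHS]eq_bigr do rewrite ffunE.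
  move=> z' zz'; apply/ffunP => j; rewrite ffunE.
  exact: (power_inj zz').
- by move=> i j; rewrite mxE !rmorphXn/= fxi.
Qed.

(** Up to a permutation of the rows and a unimodular change of basis, [B] is the Vandermonde matrix
    of [r]. The coordinates of [B z] are the conjugates of an algebraic integer, whose norm is a
    nonzero integer; the vector of ones comes from the element 1. *)
Theorem embedding_matrix_norm (B : 'M[R]_n.+1) : embedding_matrix theta B ->
  [/\ (\det B) ^+ 2 = d%:~R,
      forall z : 'cV[int]_n.+1, z != 0 ->
        1 <= `|\prod_i (B *m map_mx intr z) i 0| &
      exists2 z : 'cV[int]_n.+1, z != 0 & B *m map_mx intr z = const_mx 1].
Proof.
move=> [sigma [b [[sigma_inj _] [b_int b_span] BE]]].
have [s sE] := choice (fun i => morph_root (sigma i)).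
have s_inj : injective s.
  move=> i j sij; apply: sigma_inj => x; have [q xq] := adjoinQ_qev (valP x).
  by rewrite !(morph_qev _ xq) !sE sij.
have [M ME] := choice (fun j => power_span (b_int j)).
have xik_span k : exists z : {ffun 'I_n.+1 -> int}, xi ^+ k = \sum_j b j *~ z j.
  have /b_span[z [zE _]] : integralOver (intr : int -> K) (xi ^+ k).
    exact/integralOver_exp/integral_xi.
  by exists z.
have [N NE] := choice xik_span.
pose Mm : 'M[int]_n.+1 := \matrix_(k, j) M j k.
pose Nm : 'M[int]_n.+1 := \matrix_(j, k) N k j.
(* [Mm] and [Nm] are the integer matrices of the change of basis between [b] and the powers of [xi],
   in both directions. *)
have MN : Mm *m Nm = 1%:M.
  apply/matrixP => k k'.
  have e : \sum_(k < n.+1) xi ^+ k *~ (Mm *m Nm) k k' =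
      \sum_(k < n.+1) xi ^+ k *~ (1%:M : 'M[int]_n.+1) k k'.
    transitivity (xi ^+ k').
      rewrite NE; under [RHS]eq_bigr do rewrite ME mulrz_suml.
      rewrite exchange_big/=; apply: eq_bigr => i _.
      rewrite mxE mulrz_sumr; apply: eq_bigr => j _.
      by rewrite !mxE mulrzA.
    rewrite (bigD1 k')//= mxE eqxx big1 ?addr0// => i ik.
    by rewrite mxE (negPf ik).
  exact: (power_inj e).
have detM : (\det Mm) ^+ 2 = 1.
  have : \det Mm \is a GRing.unit.
    by rewrite -unitmxE; case/mulmx1_unit: MN.
  by rewrite qualifE/= => /orP[]/eqP ->; rewrite ?sqrrN expr1n.
have BM : B = row_perm (perm s_inj) (\matrix_(i, j) r i ^+ j) *m map_mx intr Mm.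
  apply/matrixP => i j; apply: (@fmorph_inj _ _ (real_complex R)).
  rewrite /= BE ME rmorph_sum mxE rmorph_sum/=; apply: eq_bigr => k _.
  rewrite -mulrzr rmorphM rmorphXn/= rmorph_int sE !mxE permE.
  by rewrite rmorphM rmorphXn/= rmorph_int.
have detB : (\det B) ^+ 2 = d%:~R.
  rewrite BM det_mulmx row_permE det_mulmx det_perm det_map_mx !exprMn detV.
  by rewrite -signr_odd -exprM mulnC exprM sqrrN !expr1n -rmorphXn/= detM mulr1 mul1r.
have detB0 : \det B != 0.
  apply: contra_neq d_neq0 => dB0; move: detB; rewrite dB0 expr0n/=.
  by move/eqP; rewrite eq_sym intr_eq0 => /eqP.
pose elt (z : 'cV[int]_n.+1) : K := \sum_j b j *~ z j 0.
have BzE z i : ((B *m map_mx intr z) i 0)%:C%C = sigma i (elt z).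
  rewrite mxE !rmorph_sum/=; apply: eq_bigr => j _.
  by rewrite mxE rmorphM/= BE rmorph_int -[in RHS]mulrzr rmorphM/= rmorph_int.
have elt_int z : integralOver (intr : int -> K) (elt z).
  by rewrite /elt; apply: integralOver_sum => j _; exact: integralOver_mulrz.
split=> // [z z0|].
- have elt0 : elt z != 0.
    apply: contra_neq z0 => e0.
    have /b_span[u [_ u_uniq]] : integralOver (intr : int -> K) 0 by exact: integralOver_zero.
    have uz : u = [ffun j => z j 0].
      by apply: u_uniq; apply: etrans (esym e0) _; apply: eq_bigr => j _; rewrite ffunE.
    have u0 : u = [ffun=> 0].
      by apply: u_uniq; rewrite big1// => j _; rewrite ffunE mulr0z.
    apply/matrixP => j k; rewrite ord1 mxE.
    by have /ffunP/(_ j) := uz; rewrite u0 !ffunE.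
  have span_mul j : exists y : {ffun 'I_n.+1 -> int}, elt z * b j = \sum_k b k *~ y k.
    have /b_span[y [yE _]] : integralOver (intr : int -> K) (elt z * b j).
      by apply: integral_mul.
    by exists y.
  have [A AE] := choice span_mul.
  pose Am : 'M[int]_n.+1 := \matrix_(k, j) A j k.
  pose v := B *m map_mx intr z.
  (* Multiplication by [elt z] has the integer matrix [Am] in the basis [b], and [B] diagonalises it
     with the coordinates of [B z] as eigenvalues; their product is therefore [\det Am]. *)
  have BA : diag_mx (\row_i v i 0) *m B = B *m map_mx intr Am.
    apply/matrixP => i j; apply: (@fmorph_inj _ _ (real_complex R)).
    rewrite mul_diag_mx [in LHS]mxE [in LHS]mxE rmorphM/= BzE BE -rmorphM/= AE.
    rewrite !rmorph_sum/= mxE rmorph_sum/=; apply: eq_bigr => k _.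
    by rewrite !mxE rmorphM/= BE rmorph_int -mulrzr rmorphM/= rmorph_int.
  have prodE : \prod_i v i 0 = (\det Am)%:~R.
    have /(congr1 determinant) := BA.
    rewrite !det_mulmx det_diag det_map_mx mulrC => /(mulfI detB0) <-.
    by apply: eq_bigr => i _; rewrite [RHS]mxE.
  rewrite prodE -intr_norm ler1z -gtz0_ge1 normr_gt0 -(intr_eq0 R) -prodE.
  apply/prodf_neq0 => i _; rewrite -(fmorph_eq0 (real_complex R)) /= BzE.
  by rewrite fmorph_eq0.
- have /b_span[u [uE _]] : integralOver (intr : int -> K) 1 by exact: integral1.
  have e1 : elt (\col_j u j) = 1.
    by rewrite uE /elt; apply: eq_bigr => j _; rewrite mxE.
  have B1 : B *m map_mx intr (\col_j u j) = const_mx 1.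
    apply/matrixP => i j; rewrite ord1; apply: (@fmorph_inj _ _ (real_complex R)).
    by rewrite /= BzE e1 mxE !rmorph1.
  exists (\col_j u j) => //; apply: contra_eq_neq B1 => ->.
  rewrite map_mx0 mulmx0; apply/eqP => /matrixP/(_ 0 0); rewrite !mxE => /eqP.
  by rewrite eq_sym oner_eq0.
Qed.

End PowerBasis.

(** * Lattices in the plane *)

Section BinaryForms.
Context {R : realType}.
Variables phi1 phi2 : R.
Hypothesis (phi12 : phi1 != phi2).

Let lin (phi : R) (z : 'cV[int]_2) : R := (z 0 0)%:~R - phi * (z 1 0)%:~R.

Lemma sum_ord2 (V : nmodType) (F : 'I_2 -> V) : \sum_i F i = F 0 + F 1.
Proof.
rewrite !big_ord_recl big_ord0 addr0.
by have -> : lift ord0 ord0 = 1 :> 'I_2 by exact/val_inj.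
Qed.

Lemma prod_ord2 (V : comPzSemiRingType) (F : 'I_2 -> V) : \prod_i F i = F 0 * F 1.
Proof.
rewrite !big_ord_recl big_ord0 mulr1.
by have -> : lift ord0 ord0 = 1 :> 'I_2 by exact/val_inj.
Qed.

Lemma cV2_eq0 (z : 'cV[int]_2) : (z == 0) = (z 0 0 == 0) && (z 1 0 == 0).
Proof.
apply/eqP/andP => [->|[/eqP z0 /eqP z1]]; first by rewrite !mxE.
apply/matrixP => i j; rewrite ord1 mxE.
case: (unliftP 0 i) => [k ->|-> //].
by rewrite (_ : lift 0 k = 1) // ord1; exact/val_inj.
Qed.

Lemma det_phi_mx : \det (phi_mx phi1 phi2) = phi1 - phi2.
Proof. by rewrite det_mx22 !mxE/=; ring. Qed.

Lemma phi_mx_unit : phi_mx phi1 phi2 \in unitmx.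
Proof. by rewrite unitmxE det_phi_mx unitfE subr_eq0. Qed.

Lemma ivec_phi_mx z i :
  ivec (phi_mx phi1 phi2) z i 0 = lin (if i == 0 then phi1 else phi2) z.
Proof.
rewrite /ivec mxE sum_ord2 !mxE/= /lin.
case: (unliftP 0 i) => [k ->|->] /=; last by rewrite mul1r mulNr.
by rewrite ord1/= mul1r mulNr.
Qed.

Definition diag_eps (eps : R) : 'M[R]_2 :=
  diag_mx (\row_j nth 0 [:: eps `^ (- (1 / 2)); eps `^ (1 / 2)] j).

Lemma diag_eps_diag eps : is_diag_mx (diag_eps eps).
Proof. exact: diag_mx_is_diag. Qed.

Lemma det_diag_eps eps : 0 < eps -> \det (diag_eps eps) = 1.
Proof.
move=> e0; rewrite det_diag prod_ord2 !mxE/= -powRD ?addNr ?powRr0//.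
by rewrite (gt_eqF e0) implybT.
Qed.

Lemma diag_eps_unit eps : 0 < eps -> diag_eps eps \in unitmx.
Proof. by move=> e0; rewrite unitmxE det_diag_eps// unitr1. Qed.

Lemma phi_mx_eps_unit eps : 0 < eps -> phi_mx_eps phi1 phi2 eps \in unitmx.
Proof. by move=> e0; rewrite unitmx_mul diag_eps_unit ?phi_mx_unit. Qed.

Lemma det_phi_mx_eps eps : 0 < eps ->
  \det (phi_mx_eps phi1 phi2 eps) = phi1 - phi2.
Proof. by move=> e0; rewrite det_mulmx det_diag_eps// mul1r det_phi_mx. Qed.

Lemma sqnorm_phi_mx_eps eps z : 0 < eps ->
  sqnorm (ivec (phi_mx_eps phi1 phi2 eps) z) =
  lin phi1 z ^+ 2 / eps + eps * lin phi2 z ^+ 2.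
Proof.
move=> e0; rewrite /sqnorm sum_ord2.
have E i : ivec (phi_mx_eps phi1 phi2 eps) z i 0 =
    diag_eps eps i i * ivec (phi_mx phi1 phi2) z i 0.
  by rewrite /ivec -mulmxA diag_mulE.
rewrite !E !ivec_phi_mx /= !exprMn.
have s2 : (eps `^ (1 / 2)) ^+ 2 = eps.
  by rewrite div1r powR12_sqrt ?sqr_sqrtr// ltW.
by rewrite !mxE/= powRN exprVn s2 mulrC.
Qed.

Lemma ball_const2 : ball_const 2 = pi :> R.
Proof.
by rewrite /ball_const Gamma2 divr1 divff// powRr1// pi_ge0.
Qed.

Lemma density2E (B : 'M[R]_2) : B \in unitmx ->
  density (lattice B) = pi * lattice_min (lattice B) / (4 * `|\det B|).
Proof.
move=> Bu; rewrite densityE// ball_const2 divff// powRr1; last first.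
  by apply: lattice_min_ge => // z _; exact: sqnorm_ge0.
by rewrite mulrA; congr (_ / (_ * _)); ring.
Qed.

Lemma optimal_density2E (B : 'M[R]_2) : B \in unitmx ->
  optimal_density B = pi * normmin B / (2 * `|\det B|).
Proof.
move=> Bu; rewrite /optimal_density ball_const2 divff// powRr1//.
by field; rewrite normr_eq0 -unitfE -unitmxE Bu.
Qed.

Hypotheses (irr1 : irrational phi1) (irr2 : irrational phi2).

Lemma lin_neq0 (phi : R) z : irrational phi -> z != 0 -> lin phi z != 0.
Proof.
move=> irr; apply: contra_neq; rewrite /lin => /eqP; rewrite subr_eq0 => /eqP pq.
apply/eqP; rewrite cV2_eq0; have [q0|q0] := eqVneq (z 1 0) 0.
  by move: pq => /eqP; rewrite q0 mulr0z mulr0 intr_eq0 => ->.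
exfalso; apply: irr; exists ((z 0 0)%:~R / (z 1 0)%:~R) => //=.
by rewrite fmorph_div/= !ratr_int pq mulfK// intr_eq0.
Qed.

Lemma eps_form_ge0 eps z : 0 < eps ->
  0 <= lin phi1 z ^+ 2 / eps + eps * lin phi2 z ^+ 2.
Proof.
move=> e0; apply: addr_ge0.
  by apply: divr_ge0; rewrite ?sqr_ge0 ?ltW.
by apply: mulr_ge0; rewrite ?sqr_ge0 ?ltW.
Qed.

Theorem inf_density_eps :
  ereal_inf [set (density (lattice (phi_mx_eps phi1 phi2 eps)))%:E
            | eps in [set eps : R | 0 < eps]] =
  (optimal_density (phi_mx phi1 phi2))%:E.
Proof.
apply/eqP; rewrite eq_le; apply/andP; split; last first.
  apply: le_ereal_inf_tmp => _ [eps /= e0 <-]; rewrite lee_fin.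
  exact: (@density_diag_ge _ _ (diag_eps eps) _ isT (diag_eps_diag _)
    (diag_eps_unit e0) phi_mx_unit).
apply: le_optimal_density => //; first exact: phi_mx_unit.
move=> z z0; have v1 := lin_neq0 irr1 z0; have v2 := lin_neq0 irr2 z0.
(* The scaling that makes the two coordinates of [z] equal in absolute value, the equality case of
   AM-GM. Irrationality makes both of them nonzero. *)
pose eps := `|lin phi1 z| / `|lin phi2 z|.
have e0 : 0 < eps by rewrite divr_gt0 ?normr_gt0.
apply: (@le_trans _ _ (density (lattice (phi_mx_eps phi1 phi2 eps)))%:E).
  by apply: ereal_inf_lbound; exists eps.
rewrite lee_fin; apply: le_trans (density_le_sqnorm (phi_mx_eps_unit e0) z0) _.
rewrite sqnorm_phi_mx_eps// det_phi_mx_eps// det_phi_mx prod_ord2 !ivec_phi_mx/=.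
rewrite le_eqVlt; apply/orP; left; apply/eqP; congr (_ * (_ / _)).
rewrite divff// !powRr1//; last exact: eps_form_ge0.
rewrite normrM -(real_normK (num_real (lin phi1 z))) -(real_normK (num_real (lin phi2 z))).
by rewrite /eps; field; rewrite !normr_eq0 v1 v2.
Qed.

Theorem optimal_density_markoff (f : quadform) :
  (forall x y : R, qfeval f x y = (x - phi1 * y) * (x - phi2 * y)) ->
  (optimal_density (phi_mx phi1 phi2))%:E = (pi%:E / (2%:E * markoff f))%E.
Proof.
move=> fE.
have d0 : 0 < `|phi1 - phi2| by rewrite normr_gt0 subr_eq0.
have fa : qfa f = 1.
  by have := fE 1 0; rewrite /qfeval; move=> h; ring: h.
have fc : qfc f = phi1 * phi2.
  by have := fE 0 1; rewrite /qfeval; move=> h; ring: h.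
have fb : qfb f = - (phi1 + phi2).
  by have := fE 1 1; rewrite /qfeval fa fc; lra.
have disc : Num.sqrt (qfdisc f) = `|phi1 - phi2|.
  rewrite -sqrtr_sqr /qfdisc fa fb fc; congr Num.sqrt; ring.
have mE : qfmin f = normmin (phi_mx phi1 phi2).
  rewrite /qfmin /normmin; congr inf; apply/seteqP; split => _ [z /= z0 <-].
    exists (\col_i (if i == 0 then z.1 else z.2)).
      by rewrite /= cV2_eq0 !mxE/=; case: z z0.
    by rewrite prod_ord2 !ivec_phi_mx/= fE /lin !mxE.
  exists (z 0 0, z 1 0); first by move: z0; rewrite /= cV2_eq0.
  by rewrite prod_ord2 !ivec_phi_mx/= fE.
rewrite optimal_density2E ?phi_mx_unit// det_phi_mx /markoff mE disc.
(* For minimum 0 the Markoff value is infinite and both sides are 0. *)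
have [->|m0] := eqVneq (normmin _) 0.
  by rewrite mulr0 mul0r gt0_muley ?lte_fin// invey mule0.
have dm : `|phi1 - phi2| / normmin (phi_mx phi1 phi2) != 0.
  by rewrite mulf_neq0 ?invr_eq0// gt_eqF.
rewrite -EFinM inver mulf_eq0 (negPf dm) pnatr_eq0/= -EFinM; congr EFin.
by field; rewrite m0 gt_eqF.
Qed.

Local Notation gmin eps := (lattice_min (lattice (phi_mx_eps phi1 phi2 eps))).

Lemma gmin_le eps z : 0 < eps -> z != 0 ->
  gmin eps <= lin phi1 z ^+ 2 / eps + eps * lin phi2 z ^+ 2.
Proof.
move=> e0 z0; rewrite -sqnorm_phi_mx_eps//; apply: lattice_min_le => //.
exact: phi_mx_eps_unit.
Qed.

Lemma gmin_ge eps y : 0 < eps ->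
  (forall z, z != 0 -> y <= lin phi1 z ^+ 2 / eps + eps * lin phi2 z ^+ 2) ->
  y <= gmin eps.
Proof.
move=> e0 h; apply: lattice_min_ge => //; first exact: phi_mx_eps_unit.
by move=> z z0; rewrite sqnorm_phi_mx_eps//; exact: h.
Qed.

(** Hermite's bound for [(x - phi1 y)^2 / eps + eps (x - phi2 y)^2], whose determinant is
    [(phi1 - phi2)^2] for every [eps]. *)
Lemma gmin_hermite eps : 0 < eps -> 3 * gmin eps ^+ 2 <= 4 * (phi1 - phi2) ^+ 2.
Proof.
move=> e0.
have g0 : 0 <= gmin eps.
  by apply: gmin_ge => // z _; exact: eps_form_ge0.
move: g0; rewrite le_eqVlt => /predU1P[<-|g0].
  by rewrite expr0n mulr0 mulr_ge0 ?sqr_ge0.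
have := @hermite2 _ (eps^-1 + eps) (- (phi1 / eps + eps * phi2))
  (phi1 ^+ 2 / eps + eps * phi2 ^+ 2) _ g0.
have -> : (eps^-1 + eps) * (phi1 ^+ 2 / eps + eps * phi2 ^+ 2) -
    (- (phi1 / eps + eps * phi2)) ^+ 2 = (phi1 - phi2) ^+ 2.
  by field; rewrite gt_eqF.
move=> h; suff : 3 / 4 * gmin eps ^+ 2 <= (phi1 - phi2) ^+ 2 by lra.
apply: h => x y xy.
have := @gmin_le eps (\col_i (if i == 0 then x else y)) e0.
rewrite cV2_eq0 /lin !mxE/= => /(_ xy).
by congr (_ <= _); field; rewrite gt_eqF.
Qed.

Let approx (M : R) := [set r : rat |
  `|phi1 - ratr r| < 1 / (M * (denq r)%:~R ^+ 2)].

Lemma den_gt0 (r : rat) : 0 < (denq r)%:~R :> R.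
Proof. by rewrite ltr0z denq_gt0. Qed.

Lemma ratr_num_den (r : rat) : ratr r = (numq r)%:~R / (denq r)%:~R :> R.
Proof. by rewrite -{1}(divq_num_den r) fmorph_div/= !ratr_int. Qed.

Lemma lin_rat (r : rat) : ((numq r)%:~R - phi1 * (denq r)%:~R : R) =
  - ((phi1 - ratr r) * (denq r)%:~R).
Proof. by rewrite ratr_num_den; field; rewrite gt_eqF ?den_gt0. Qed.

(** A vector of value below [K] has [u = x - phi1 y] so small that [x / y] is none of the finitely
    many good approximations; hence [|y| |u| >= 1 / M]. Since [|x - phi2 y|] is at least
    [|phi1 - phi2| |y| - |u|], AM-GM bounds the value below by [K - 2 u^2]. *)
Lemma gmin_lower M e : 0 < M -> 0 < e -> finite_set (approx M) ->
  \forall eps \near 0^'+, 2 * `|phi1 - phi2| / M - e <= gmin eps.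
Proof.
move=> M0 e0 /finite_seqP[s sE].
set K := 2 * `|phi1 - phi2| / M.
have d0 : 0 < `|phi1 - phi2| by rewrite normr_gt0 subr_eq0.
have K0 : 0 < K by rewrite divr_gt0// mulr_gt0.
pose colr (r : rat) : 'cV[int]_2 := \col_i (if i == 0 then numq r else denq r).
have colr0 r : colr r != 0 by rewrite cV2_eq0 !mxE/= (negPf (denq_neq0 r)) andbF.
(* A positive lower bound for [|p - phi1 q|] over the finite list; it exists because [phi1] is
   irrational. *)
have [c c0 hc] : exists2 c : R, 0 < c & forall r, r \in s -> c <= `|lin phi1 (colr r)|.
  elim: s {sE} => [|r s [c c0 ih]]; first by exists 1.
  exists (Num.min c `|lin phi1 (colr r)|).
    by rewrite lt_min c0 normr_gt0 lin_neq0.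
  move=> r'; rewrite inE => /predU1P[->|r's]; first by rewrite ge_min lexx orbT.
  by rewrite ge_min ih.
have Kd (x : R) : 0 < x -> \forall eps \near 0^'+, K * eps < x.
  move=> x0; near=> eps; rewrite mulrC -ltr_pdivlMr//; near: eps.
  by apply: nbhs_right_lt; rewrite divr_gt0.
near=> eps.
have eps0 : 0 < eps by near: eps; exact: nbhs_right_gt.
(* Since [u^2 < K eps], the three bounds on [eps] respectively exclude [y = 0], keep [x / y] off the
   list, and make the error [2 u^2] at most [e]. *)
have eps1 : K * eps < 1 by near: eps; exact: Kd.
have eps2 : K * eps < c ^+ 2 by near: eps; apply: Kd; rewrite exprn_gt0.
have eps3 : K * eps < e / 2 by near: eps; apply: Kd; rewrite divr_gt0.
apply: gmin_ge => // z z0.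
have [big|small] := lerP K (lin phi1 z ^+ 2 / eps + eps * lin phi2 z ^+ 2).
  by apply: le_trans big; rewrite lerBlDr lerDl ltW.
set u := lin phi1 z in small *; set w := lin phi2 z in small *.
have u2 : u ^+ 2 < K * eps.
  rewrite -ltr_pdivrMr//; apply: le_lt_trans small.
  by rewrite lerDl mulr_ge0 ?sqr_ge0// ltW.
have q0 : z 1 0 != 0.
  apply: contraTneq (lt_trans u2 eps1) => q0; rewrite -leNgt /u /lin q0 mulr0z mulr0 subr0.
  rewrite -rmorphXn/= ler1z -gtz0_ge1 exprn_even_gt0//=.
  by move: z0; rewrite cV2_eq0 q0 eqxx andbT.
have q0' : (z 1 0)%:~R != 0 :> R by rewrite intr_eq0.
pose r : rat := (z 0 0)%:~R / (z 1 0)%:~R.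
have rE : ratr r = (z 0 0)%:~R / (z 1 0)%:~R :> R.
  by rewrite /r fmorph_div/= !ratr_int.
have uE : `|u| = `|phi1 - ratr r| * `|(z 1 0)%:~R|.
  by rewrite -normrM rE -normrN; congr `|_|; rewrite /u /lin; field.
(* [x / y] need not be in lowest terms; its reduced denominator divides [y]. *)
have den_le : (denq r)%:~R <= `|(z 1 0)%:~R| :> R.
  rewrite -intr_norm ler_int.
  have : z 1 0 \in dvdz (denq r).
    have := divq_num_den r; rewrite {3}/r => /eqP.
    rewrite eqr_div ?intr_eq0 ?denq_neq0// -!intrM eqr_int => /eqP h.
    have : numq r * z 1 0 \in dvdz (denq r) by rewrite h dvdz_mull.
    rewrite Gauss_dvdzr// coprimezE coprime_sym; exact: coprime_num_den.
  move=> /dvdzP[m mE]; rewrite mE normrM (gtr0_norm (denq_gt0 r)).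
  apply: ler_peMl; first by rewrite ltW ?denq_gt0.
  rewrite -gtz0_ge1 normr_gt0.
  by apply: contra_neq q0 => m0; rewrite mE m0 mul0r.
have rs : ~ approx M r.
  move=> ar; have : r \in s by move: ar; rewrite sE.
  move=> /hc; apply/negP; rewrite -ltNge.
  apply: le_lt_trans (_ : `|u| < c); last first.
    rewrite -(@ltr_pXn2r _ 2)// ?nnegrE ?(ltW c0)// real_normK ?num_real//.
    exact: lt_trans eps2.
  rewrite uE /lin !mxE/= lin_rat normrN normrM ler_wpM2l//.
  by rewrite gtr0_norm ?den_gt0.
have {}rs : 1 / (M * (denq r)%:~R ^+ 2) <= `|phi1 - ratr r| by rewrite leNgt; exact/negP.
have qu : 1 / M <= `|(z 1 0)%:~R| * `|u|.
  rewrite uE mulrCA -expr2.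
  apply: le_trans (ler_pM _ _ rs (_ : (denq r)%:~R ^+ 2 <= _)).
  - rewrite le_eqVlt; apply/orP; left; apply/eqP; field.
    by rewrite !gt_eqF ?den_gt0.
  - by rewrite divr_ge0// mulr_ge0 ?sqr_ge0// ltW.
  - exact: sqr_ge0.
  - by rewrite ler_pXn2r ?nnegrE// ltW ?den_gt0.
have wE : `|phi1 - phi2| * `|(z 1 0)%:~R| - `|u| <= `|w|.
  rewrite -normrM (_ : (phi1 - phi2) * _ = w - u); last by rewrite /w /u /lin; ring.
  by rewrite lerBlDr ler_normB.
have amgm : 2 * `|u| * `|w| <= u ^+ 2 / eps + eps * w ^+ 2.
  rewrite -(real_normK (num_real u)) -(real_normK (num_real w)).
  rewrite -subr_ge0 (_ : _ - _ = (`|u| - eps * `|w|) ^+ 2 / eps); last by field; rewrite gt_eqF.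
  by rewrite divr_ge0 ?sqr_ge0// ltW.
apply: le_trans amgm.
have : 2 * `|u| * (`|phi1 - phi2| * `|(z 1 0)%:~R| - `|u|) <= 2 * `|u| * `|w|.
  by rewrite ler_wpM2l// mulr_ge0.
apply: le_trans.
have -> : 2 * `|u| * (`|phi1 - phi2| * `|(z 1 0)%:~R| - `|u|) =
  2 * `|phi1 - phi2| * (`|(z 1 0)%:~R| * `|u|) - 2 * u ^+ 2.
  by rewrite -(real_normK (num_real u)); ring.
apply: lerB; last by lra.
by rewrite /K -[M^-1]div1r ler_wpM2l ?mulr_ge0.
Unshelve. all: by end_near. Qed.

Lemma finite_bounded_den (N : nat) (c : R) :
  finite_set [set r : rat | denq r <= N%:Z /\ `|ratr r : R| <= c].
Proof.
have [c0|c0] := ltrP c 0.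
  rewrite (_ : [set _ | _] = set0); first exact: finite_set0.
  by apply/seteqP; split => // r [_ /=]; rewrite leNgt (lt_le_trans c0).
(* [K] exceeds the numerators in absolute value; shifting by [K] lets them be listed as natural
   numbers. *)
pose K := (Num.truncn (N%:R * c)).+1.
pose s := [seq (i%:R - K%:R) / d%:R : rat | i <- iota 0 (K + K), d <- iota 0 N.+1].
apply: (@sub_finite_set _ _ [set` s]); last exact: finite_seq.
move=> r [/= dN rc]; apply/allpairsP.
have num_lt : `|numq r| < K%:Z.
  rewrite -(ltr_int R) intr_norm.
  have -> : (numq r)%:~R = ratr r * (denq r)%:~R :> R.
    by rewrite ratr_num_den divfK// gt_eqF ?den_gt0.
  rewrite normrM (gtr0_norm (den_gt0 r)).
  apply: le_lt_trans (_ : N%:R * c < _); last first.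
    by rewrite /K; exact: truncnS_gt.
  rewrite mulrC ler_pM ?(ltW (den_gt0 r))//.
  by rewrite -(ler_int R) in dN.
exists (absz (numq r + K%:Z), absz (denq r)); split.
- rewrite [X in X \in _]/= mem_iota.
  have /andP[n1 n2] : - K%:Z < numq r < K%:Z by rewrite -ltr_norml.
  by lia.
- by rewrite [X in X \in _]/= mem_iota; have := denq_gt0 r; lia.
- rewrite -[LHS]divq_num_den; congr (_ / _); last first.
    by rewrite natr_absz gtr0_norm// denq_gt0.
  rewrite natr_absz ger0_norm; last by lia.
  by rewrite intrD -pmulrn addrK.
Qed.

(** Infinitely many good approximations include one with a large denominator [q]. Balancing the two
    coordinates of its vector by [eps = u / w] gives the value [2 u w], where [u <= 1 / (M q)] and
    [w] is within [u] of [|phi1 - phi2| q]. *)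
Lemma gmin_upper M e eps0 : 0 < M -> 0 < e -> 0 < eps0 ->
  infinite_set (approx M) ->
  exists eps, 0 < eps < eps0 /\ gmin eps <= 2 * `|phi1 - phi2| / M + e.
Proof.
move=> M0 e0 eps00 infM.
set d := `|phi1 - phi2|.
have d0 : 0 < d by rewrite normr_gt0 subr_eq0.
(* The four bounds on [sg] ensure in turn that [w >= d / 2], that [sg^2 <= sg], that [u / w < eps0],
   and that the error [2 sg^2] is at most [e]. *)
pose s0 := Num.min (Num.min (d / 2) 1) (Num.min (eps0 * d / 4) (e / 2)).
have s00 : 0 < s0.
  by rewrite !lt_min ltr01 !divr_gt0// mulr_gt0.
have [N [N0 hN]] : exists N : nat, (0 < N)%N /\ 1 / (M * N%:R) <= s0.
  exists (Num.truncn (1 / (M * s0))).+1; split => //.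
  rewrite ler_pdivrMr ?mulr_gt0 ?ltr0n// mulrA [s0 * M]mulrC -ler_pdivrMl ?mulr_gt0//.
  by rewrite mulr1 -[leLHS]mul1r ltW// truncnS_gt.
(* The approximations lie in a bounded interval, which holds only finitely many fractions of
   denominator at most [N]. *)
have [r ar rN] : exists2 r, approx M r & (N%:Z < denq r).
  apply: contrapT => h; apply: infM.
  apply: sub_finite_set (finite_bounded_den N (`|phi1| + 1 / M)) => r ar; split => /=.
    by rewrite leNgt; apply/negP => rN; apply: h; exists r.
  rewrite (_ : ratr r = phi1 - (phi1 - ratr r)); last by ring.
  apply: le_trans (ler_normB _ _) _; rewrite lerD2l (le_trans (ltW ar))//.
  rewrite ler_pM2l// lef_pV2 ?posrE ?mulr_gt0 ?exprn_gt0 ?den_gt0//.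
  by rewrite ler_peMr ?(ltW M0)// exprn_ege1// ler1z -gtz0_ge1 denq_gt0.
pose z : 'cV[int]_2 := \col_i (if i == 0 then numq r else denq r).
have z0 : z != 0 by rewrite cV2_eq0 !mxE/= (negPf (denq_neq0 r)) andbF.
set q : R := (denq r)%:~R; have q0 : 0 < q := den_gt0 r.
have q1 : 1 <= q by rewrite /q ler1z -gtz0_ge1 denq_gt0.
pose u := `|lin phi1 z|; pose w := `|lin phi2 z|.
have u0 : 0 < u by rewrite normr_gt0 lin_neq0.
pose sg := 1 / (M * q).
have sg0 : 0 < sg by rewrite divr_gt0// mulr_gt0.
have sgs : sg <= s0.
  apply: le_trans hN; rewrite ler_pM2l// lef_pV2 ?posrE ?mulr_gt0 ?ltr0n//.
  rewrite ler_pM2l//; move: rN; rewrite -(ltr_int R) => /ltW; exact.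
have us : u <= sg.
  rewrite /u /lin !mxE/= lin_rat normrN normrM (gtr0_norm q0).
  rewrite -ler_pdivlMr// (le_trans (ltW ar))//.
  rewrite le_eqVlt; apply/orP; left; apply/eqP; rewrite /sg /q; field.
  by rewrite !gt_eqF.
have w1 : d * q - u <= w.
  rewrite /u /w -{1}(gtr0_norm q0) -normrM (_ : _ * _ = lin phi2 z - lin phi1 z); last first.
    by rewrite /lin !mxE/= /q; ring.
  by rewrite lerBlDr ler_normB.
have w2 : w <= d * q + u.
  rewrite /u /w -{1}(gtr0_norm q0) -normrM.
  rewrite (_ : lin phi2 z = (phi1 - phi2) * q + lin phi1 z); last first.
    by rewrite /lin !mxE/= /q; ring.
  exact: ler_normD.
move: (sgs); rewrite !le_min => /andP[/andP[sg1 sg2] /andP[sg3 sg4]].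
have dq : d <= d * q by rewrite ler_peMr// ltW.
have wd : d / 2 <= w by lra.
have w0 : 0 < w by lra.
exists (u / w); split.
  rewrite divr_gt0//= ltr_pdivrMr//.
  have : eps0 * (d / 2) <= eps0 * w by rewrite ler_wpM2l// ltW.
  have : 0 < eps0 * d by rewrite mulr_gt0.
  lra.
apply: le_trans (gmin_le _ z0) _; first by rewrite divr_gt0.
rewrite -(real_normK (num_real (lin phi1 z))) -(real_normK (num_real (lin phi2 z))) -/u -/w.
have -> : u ^+ 2 / (u / w) + u / w * w ^+ 2 = 2 * u * w by field; rewrite !gt_eqF.
have : 2 * u * w <= 2 * sg * (d * q + sg).
  apply: ler_pM; rewrite ?mulr_ge0 ?(ltW u0) ?(ltW w0)//; first by rewrite ler_pM2l.
  by apply: le_trans w2 _; rewrite lerD2l.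
move/le_trans; apply.
have -> : 2 * sg * (d * q + sg) = 2 * d / M + 2 * (sg * sg).
  by rewrite /sg; field; rewrite !gt_eqF.
rewrite lerD2l; have : sg * sg <= sg * 1 by rewrite ler_wpM2l// ltW.
lra.
Qed.

Lemma scaled_error (p d M e : R) : 0 < p -> 0 < d -> 0 < M ->
  p / (4 * d) * (2 * d / M + e * (4 * d) / p) = p / (2 * M) + e.
Proof. by move=> p0 d0 M0; field; rewrite !gt_eqF. Qed.

(** Passing from the Lagrange number [r] to a number strictly above it costs [e r / (2 M)] in the
    density, which is less than [e / 2]. *)
Lemma perturbed_bound (p r e : R) : 0 < p -> 0 < r -> 0 < e ->
  p / (2 * r) - e <= p / (2 * (r + e * r ^+ 2 / p)) - e / 2.
Proof.
move=> p0 r0 e0; set M := r + _.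
have rM : r < M by rewrite ltrDl divr_gt0// mulr_gt0// exprn_gt0.
have M0 : 0 < M by exact: lt_trans rM.
have -> : p / (2 * M) = p / (2 * r) - p * (M - r) / (2 * r * M).
  by field; rewrite !gt_eqF.
have -> : p * (M - r) = e * r ^+ 2.
  by rewrite /M; field; rewrite gt_eqF.
have : e * r ^+ 2 / (2 * r * M) <= e / 2.
  rewrite ler_pdivrMr ?mulr_gt0//.
  have : e * r * r <= e * r * M by rewrite ler_wpM2l ?mulr_ge0 ?ltW.
  lra.
lra.
Qed.

(** Dirichlet's approximation theorem, derived from Hermite's bound. Were the set finite,
    [gmin_lower] would give [gmin >= 3/2 |phi1 - phi2|] for small [eps], against
    [gmin^2 <= 4/3 (phi1 - phi2)^2]. *)
Lemma approx1_infinite : infinite_set (approx 1).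
Proof.
move=> fin1; have d0 : 0 < `|phi1 - phi2| by rewrite normr_gt0 subr_eq0.
have := gmin_lower ltr01 (divr_gt0 d0 (ltr0n R 2)) fin1.
move/(filterI (nbhs_right_gt (0 : R)))/filter_ex => [eps /= [eps0]].
have := gmin_hermite eps0; rewrite -(real_normK (num_real (phi1 - phi2))).
by rewrite divr1; nra.
Qed.

Local Notation dens eps := (density (lattice (phi_mx_eps phi1 phi2 eps))).

Lemma densE eps : 0 < eps -> dens eps = pi / (4 * `|phi1 - phi2|) * gmin eps.
Proof.
move=> e0; rewrite density2E ?phi_mx_eps_unit// det_phi_mx_eps//.
by rewrite mulrAC.
Qed.

Lemma ereal_inf_dens_le M (V : set R) : 0 < M -> infinite_set (approx M) ->
  0^'+ V -> (ereal_inf [set (dens eps)%:E | eps in V] <= (pi / (2 * M))%:E)%E.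
Proof.
move=> M0 infM /nbhs_ballP[eps0/= eps00 hV]; apply/lee_addgt0Pr => e e0.
have d0 : 0 < `|phi1 - phi2| by rewrite normr_gt0 subr_eq0.
have pi0 := pi_gt0 R.
have [|eps [/andP[eps1 eps2] hg]] :=
    @gmin_upper M (e * (4 * `|phi1 - phi2|) / pi) eps0 M0 _ eps00 infM.
  by rewrite divr_gt0// mulr_gt0// mulr_gt0.
apply: ge_ereal_inf; exists (dens eps)%:E.
  by exists eps => //; apply: hV => //; rewrite /ball/= sub0r normrN gtr0_norm.
rewrite -EFinD lee_fin densE//.
have c0 : 0 <= pi / (4 * `|phi1 - phi2|) by rewrite ltW// divr_gt0// mulr_gt0.
by apply: le_trans (ler_wpM2l c0 hg) _; rewrite scaled_error.
Qed.

Lemma limf_dens_ge M e : 0 < M -> 0 < e -> finite_set (approx M) ->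
  ((pi / (2 * M) - e)%:E <= limf_einf (fun eps => (dens eps)%:E) 0^'+)%E.
Proof.
move=> M0 e0 finM; rewrite limf_einfE.
have d0 : 0 < `|phi1 - phi2| by rewrite normr_gt0 subr_eq0.
have pi0 := pi_gt0 R.
have e'0 : 0 < e * (4 * `|phi1 - phi2|) / pi by rewrite divr_gt0// mulr_gt0// mulr_gt0.
pose V := [set eps | 0 < eps /\
  2 * `|phi1 - phi2| / M - e * (4 * `|phi1 - phi2|) / pi <= gmin eps].
have hV : 0^'+ V by exact: (filterI (nbhs_right_gt (0 : R)) (gmin_lower M0 e'0 finM)).
apply: le_ereal_sup_tmp; exists (ereal_inf [set (dens eps)%:E | eps in V]).
  by exists V.
apply: le_ereal_inf_tmp => _ [eps /= [eps0 hg] <-]; rewrite lee_fin densE//.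
have c0 : 0 <= pi / (4 * `|phi1 - phi2|) by rewrite ltW// divr_gt0// mulr_gt0.
by apply: le_trans (ler_wpM2l c0 hg); rewrite -!mulNr scaled_error.
Qed.

(** Below the Lagrange number approximations are infinite in number and bound the lower limit from
    above; beyond it they are finite in number and bound it from below. *)
Theorem limf_density_lagrange :
  limf_einf (fun eps => (dens eps)%:E) 0^'+ =
  (pi%:E / (2%:E * lagrange_number phi1))%E.
Proof.
have pi0 := pi_gt0 R.
set L := lagrange_number phi1.
have LM M : 0 < M -> infinite_set (approx M) -> (M%:E <= L)%E.
  by move=> M0 iM; apply: ereal_sup_ubound; exists M.
have ML (x : R) : (x%:E < L)%E -> exists M, [/\ 0 < M, infinite_set (approx M) & x < M].
  by move=> /ereal_sup_gt[_ [M [M0 iM] <-]]; rewrite lte_fin; exists M.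
have Mfin M : 0 < M -> (L < M%:E)%E -> finite_set (approx M).
  by move=> M0 LltM; apply: contrapT => /(LM _ M0); rewrite leNgt LltM.
(* The Lagrange number is at least 1, which leaves only a positive real and [+oo] to consider. *)
have L1 := LM _ ltr01 approx1_infinite.
have le_y (y : R) : 0 < y -> ((pi / (2 * y))%:E < L)%E ->
    (limf_einf (fun eps => (dens eps)%:E) 0^'+ <= y%:E)%E.
  move=> y0 /ML[M [M0 iM yM]]; rewrite limf_einfE.
  apply: ge_ereal_sup => _ [V V0 <-].
  apply: le_trans (ereal_inf_dens_le M0 iM V0) _; rewrite lee_fin.
  rewrite ler_pdivrMr ?mulr_gt0// mulrCA mulrA -ler_pdivrMl ?mulr_gt0//.
  by rewrite mulrC ltW.
have lim0 : (0 <= limf_einf (fun eps => (dens eps)%:E) 0^'+)%E.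
  rewrite limf_einfE; apply: le_ereal_sup_tmp.
  exists (ereal_inf [set (dens eps)%:E | eps in [set eps : R | 0 < eps]]).
    by exists [set eps : R | 0 < eps] => //; exact: nbhs_right_gt.
  apply: le_ereal_inf_tmp => _ [eps /= eps0 <-]; rewrite lee_fin densE//.
  rewrite mulr_ge0 ?divr_ge0 ?mulr_ge0 ?(ltW pi0)//; apply: gmin_ge => // z _.
  exact: eps_form_ge0.
move: L1 LM ML Mfin le_y; case: L => [r| |]// r1 LM ML Mfin le_y.
- rewrite lee_fin in r1; have r0 : 0 < r by exact: lt_le_trans r1.
  rewrite -EFinM inver mulf_eq0 pnatr_eq0 (gt_eqF r0)/= -EFinM.
  apply/eqP; rewrite eq_le; apply/andP; split.
    apply/lee_addgt0Pr => e e0; rewrite -EFinD; apply: le_y.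
      by rewrite addr_gt0// divr_gt0// mulr_gt0.
    rewrite lte_fin ltr_pdivrMr ?mulr_gt0 ?addr_gt0 ?divr_gt0 ?mulr_gt0//.
    rewrite !mulrDr -[ltLHS]addr0; apply: ler_ltD; last by rewrite !mulr_gt0.
    by rewrite le_eqVlt; apply/orP; left; apply/eqP; field; rewrite gt_eqF.
  apply/lee_subgt0Pr => e e0; rewrite -EFinB.
  pose M := r + e * r ^+ 2 / pi.
  have x0 : 0 < e * r ^+ 2 / pi by rewrite divr_gt0// mulr_gt0// exprn_gt0.
  have M0 : 0 < M by rewrite addr_gt0.
  have Mr : r < M by rewrite ltrDl.
  have := @limf_dens_ge M (e / 2) M0 _ (Mfin _ M0 _).
  rewrite divr_gt0// lte_fin => /(_ isT Mr); apply: le_trans; rewrite lee_fin.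
  exact: perturbed_bound.
(* For an infinite Lagrange number the right-hand side is 0, and [le_y] applies to every positive
   [y]. *)
- rewrite gt0_muley ?lte_fin// invey mule0; apply/eqP; rewrite eq_le lim0 andbT.
  by apply/lee_addgt0Pr => e e0; rewrite add0e; apply: le_y => //; rewrite ltry.
Qed.

End BinaryForms.

(** * The four number fields *)

Section IntegerPolynomials.
Variable s : seq int.
Hypothesis last_s : last 0 s = 1.

Lemma Poly_seqE : Poly s = s :> seq int.
Proof. by apply: (@PolyK _ 0); rewrite last_s. Qed.

Lemma Poly_monic : Poly s \is monic.
Proof. by rewrite monicE lead_coefE Poly_seqE nth_last last_s. Qed.

Lemma root_Poly (F : idomainType) (x : F) :
  root (map_poly intr (Poly s)) x = (horner_rec [seq k%:~R | k <- s] x == 0).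
Proof. by rewrite map_Poly /root horner_Poly. Qed.

End IntegerPolynomials.

(** * Eisenstein descent and the control of denominators *)

Section Descent.
Variable F : numFieldType.
Local Notation Zint := (integralOver (intr : int -> F)).

(** Induction on [j]: once the lower terms are removed, multiplying by [x^(n-j)] gives each higher
    term a factor [x^(n+1)], which cancels [p]. So [a_j x^n / p] is integral. Its power of exponent
    [n + 1] is [a_j^(n+1) / p] times a unit, hence [p] divides [a_j]. *)
Lemma eisenstein_descent (n p : nat) (x eps eps' : F) :
  prime p -> Zint x -> Zint eps -> Zint eps' ->
  x ^+ n.+1 = p%:R * eps -> eps * eps' = 1 ->
  forall a : 'I_n.+1 -> int, Zint (\sum_j (a j)%:~R * x ^+ j / p%:R) ->
  exists b : 'I_n.+1 -> int, forall j, a j = b j * p%:Z.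
Proof.
move=> p_pr xi ei ei' xE ee a ai.
have p0 : p%:R != 0 :> F by rewrite pnatr_eq0 -lt0n prime_gt0.
suff : forall j : 'I_n.+1, exists c : int, a j = c * p%:Z by move=> /choice[b bE]; exists b.
move=> [j jn]; elim/ltn_ind: j jn => j ih jn.
pose j0 := Ordinal jn.
have lowi : Zint (\sum_(i < n.+1 | (i < j)%N) (a i)%:~R * x ^+ i / p%:R).
  apply: integralOver_sum => -[i i_n] /= ij; have [c ->] := ih _ ij i_n.
  rewrite intrM -pmulrn mulrAC mulfK//; apply: integral_mul; first exact: integralOver_int.
  exact: integralOver_exp.
have highi : Zint ((a j0)%:~R * x ^+ n / p%:R).
  have : Zint (\sum_(i < n.+1 | ~~ (i < j)%N) (a i)%:~R * x ^+ i / p%:R).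
    move: (integral_sub ai lowi); congr integralOver.
    by rewrite [X in X - _](bigID (fun i : 'I_n.+1 => (i < j)%N)) /= [X in X - _]addrC addrK.
  rewrite (bigD1 j0) /=; last by rewrite ltnn.
  move=> /(fun h => integral_mul h (integralOver_exp (n - j) xi)).
  rewrite mulrDl big_distrl /= => hi.
  have resti : Zint (\sum_(i < n.+1 | ~~ (i < j)%N && (i != j0))
      (a i)%:~R * x ^+ i / p%:R * x ^+ (n - j)).
    apply: integralOver_sum => i /andP[ji ij].
    have ji' : (j < i)%N by rewrite ltn_neqAle leqNgt ji andbT eq_sym -val_eqE in ij *.
    have -> : (a i)%:~R * x ^+ i / p%:R * x ^+ (n - j) = (a i)%:~R * (eps * x ^+ (i - j.+1)).
      transitivity ((a i)%:~R / p%:R * x ^+ (i + (n - j))); first by rewrite exprD; field.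
      have -> : (i + (n - j) = n.+1 + (i - j.+1))%N by lia.
      by rewrite exprD xE; field.
    apply: integral_mul; first exact: integralOver_int.
    by apply: integral_mul => //; exact: integralOver_exp.
  move: (integral_sub hi resti); congr integralOver; rewrite addrK.
  transitivity ((a j0)%:~R * (x ^+ j * x ^+ (n - j)) / p%:R); first by field.
  by rewrite -exprD subnKC.
have api : Zint ((a j0 ^+ n.+1)%:~R / p%:R).
  have := integral_mul (integralOver_exp n.+1 highi) (integralOver_exp n ei').
  congr integralOver.
  rewrite expr_div_n exprMn -exprM mulnC exprM xE exprMn rmorphXn/= [p%:R ^+ n.+1]exprS.
  transitivity ((a j0)%:~R ^+ n.+1 / p%:R * (eps * eps') ^+ n); last by rewrite ee expr1n mulr1.
  by rewrite exprMn; field; rewrite p0 expf_neq0.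
have /integral_rat/intrP[k kE] : Zint (ratr ((a j0 ^+ n.+1)%:~R / p%:R)).
  by rewrite fmorph_div/= ratr_int ratr_nat.
have {}kE : a j0 ^+ n.+1 = k * p%:Z.
  apply: (@intr_inj rat); rewrite intrM -kE -pmulrn divfK//.
  by rewrite pnatr_eq0 -lt0n prime_gt0.
have : (p %| absz (a j0))%N.
  have : (p %| absz (a j0) ^ n.+1)%N by rewrite -abszX kE abszM dvdn_mull.
  by rewrite Euclid_dvdX// andbT.
move=> pa; have /dvdzP[c cE] : a j0 \in dvdz p%:Z by rewrite dvdzE.
by exists c.
Qed.

End Descent.

Lemma denq_sq_dvd (c : rat) (d : nat) : c ^+ 2 * d%:Z%:~R \is a Num.int ->
  (absz (denq c) ^ 2 %| d)%N.
Proof.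
move=> /intrP[k kE].
have v0 : (denq c)%:~R != 0 :> rat by rewrite intr_eq0 denq_neq0.
have e : numq c ^+ 2 * d%:Z = k * denq c ^+ 2.
  apply: (@intr_inj rat); rewrite !intrM; move: v0 kE; rewrite -{2}(divq_num_den c).
  by move: (numq c) (denq c) => u v v0 <-; field.
have : (absz (denq c) ^ 2 %| absz (numq c) ^ 2 * d)%N.
  by rewrite -!abszX -[d]/(absz d%:Z) -abszM e abszM dvdn_mull.
by rewrite Gauss_dvdr// coprimeXl// coprimeXr// coprime_sym coprime_num_den.
Qed.

Lemma denq_dvd_int (c : rat) (k : nat) : (absz (denq c) %| k)%N ->
  c * k%:R \is a Num.int.
Proof.
move=> /dvdnP[q ->]; rewrite natrM mulrCA natr_absz gtr0_norm ?denq_gt0//.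
by rewrite -numqE rpredM// ?natr_int// intr_int.
Qed.

(** Vandermonde's formula, with the condition inside the product so that it unfolds by
    computation. *)
Lemma det_powers (F : comNzRingType) n (r : 'I_n -> F) :
  \det (\matrix_(i, j) r i ^+ j) = \prod_(i < n) \prod_(j < n) (if (i < j)%N then r j - r i else 1).
Proof.
rewrite -det_tr (_ : _^T = Vandermonde n (\row_i r i)) ?det_Vandermonde.
  by apply: eq_bigr => i _; rewrite big_mkcond; apply: eq_bigr => j _; rewrite !mxE.
by apply/matrixP => i j; rewrite !mxE.
Qed.

(* Certificate for an identity between polynomial expressions in a root of [G]. *)
Lemma eq_mod_root (F : comNzRingType) (G q u v : F) : G = 0 -> u - v = q * G -> u = v.
Proof. by move=> -> /eqP; rewrite mulr0 subr_eq0 => /eqP. Qed.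

(** * Cosine identities and the generators of the cyclotomic cases *)

Section Cosines.
Context {R : realType}.

(** The Chebyshev recurrence, which makes [cos (k x)] a polynomial in [cos x]. *)
Lemma cos_recl (x : R) k :
  cos (k.+2%:R * x) = 2 * cos x * cos (k.+1%:R * x) - cos (k%:R * x).
Proof.
have -> : k.+2%:R * x = k.+1%:R * x + x by rewrite -[k.+2]addn1 natrD; ring.
have -> : k%:R * x = k.+1%:R * x - x by rewrite -[k.+1]addn1 natrD; ring.
by rewrite cosD cosB; ring.
Qed.

Lemma cos_reflect (x y : R) : x + y = pi + pi -> cos x = cos y.
Proof.
move=> xy; have -> : x = (- y + pi) + pi by rewrite -addrA -xy; ring.
by rewrite !cosDpi opprK cosN.
Qed.

Lemma cos_2piV_neq1 m : (2 < m)%N -> cos (2 * pi / m%:R : R) - 1 != 0.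
Proof.
move=> m2; set x := 2 * pi / _.
have m0 : 0 < m%:R :> R by rewrite ltr0n (ltn_trans _ m2).
have s0 : 0 < sin x.
  apply: sin_gt0_pi; rewrite ?in_itv/= divr_gt0 ?mulr_gt0 ?pi_gt0//=.
  rewrite ltr_pdivrMr// mulrC ltr_pM2l ?pi_gt0//.
  by rewrite ltr_nat.
rewrite subr_eq0; apply: contraTneq s0 => c1.
have := cos2Dsin2 x; rewrite c1 expr1n => /eqP.
rewrite -subr_eq0 addrAC subrr add0r sqrf_eq0 => /eqP ->.
by rewrite ltxx.
Qed.

Lemma zetaD (m : nat) :
  zeta R m + (zeta R m)^-1 = ((2 * cos (2 * pi / m%:R))%:C)%C.
Proof.
rewrite /zeta; set x := 2 * pi / _.
have zz : ((cos x +i* sin x) * (cos x +i* (- sin x)))%C = 1 :> R[i].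
  have := cos2Dsin2 x; rewrite !expr2 => h; apply/eqP; rewrite eq_complex/=.
  by apply/andP; split; apply/eqP; [rewrite -[RHS]h|]; ring.
have z0 : (cos x +i* sin x)%C != 0 :> R[i].
  by apply: contra_eq_neq zz => ->; rewrite mul0r eq_sym oner_neq0.
have -> : ((cos x +i* sin x)%C)^-1 = (cos x +i* (- sin x))%C.
  by apply: (mulfI z0); rewrite zz mulfV.
by apply/eqP; rewrite eq_complex/=; apply/andP; split; apply/eqP; ring.
Qed.

(** This is [(1 - zeta) (1 - zeta^-1)]. It generates the same field as [zeta + zeta^-1], but for [m]
    = 5, 7, 11 its minimal polynomial is Eisenstein at [m]. *)
Definition gen_cyc m : R := 2 - 2 * cos (2 * pi / m%:R).

(* For [x = 2 pi / (2 k + 1)], [cos ((k + 1) x) = cos (k x)] is a polynomial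
   equation in [cos x], divisible by [cos x - 1]; the quotient is the minimal
   polynomial. *)
Lemma gen_cyc5 : gen_cyc 5 ^+ 2 - 5 * gen_cyc 5 + 5 = 0.
Proof.
rewrite /gen_cyc; have := @cos_2piV_neq1 5 isT; set x := 2 * pi / _.
have : cos (3%:R * x) = cos (2%:R * x) by apply: cos_reflect; rewrite /x; field.
have c1 : cos (1%:R * x) = cos x by rewrite mul1r.
have c0 : cos (0%:R * x) = 1 by rewrite mul0r cos0.
have c2 := cos_recl x 0; have c3 := cos_recl x 1.
rewrite c3 c2 c1 c0; move: (cos x) => c h cn; apply: (mulfI cn).
by rewrite mulr0; move/eqP: h; rewrite -subr_eq0 => /eqP h; apply: (eq_mod_root (q := 1) h); ring.
Qed.

Lemma gen_cyc7 :
  gen_cyc 7 ^+ 3 - 7 * gen_cyc 7 ^+ 2 + 14 * gen_cyc 7 - 7 = 0.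
Proof.
rewrite /gen_cyc; have := @cos_2piV_neq1 7 isT; set x := 2 * pi / _.
have : cos (4%:R * x) = cos (3%:R * x) by apply: cos_reflect; rewrite /x; field.
have c1 : cos (1%:R * x) = cos x by rewrite mul1r.
have c0 : cos (0%:R * x) = 1 by rewrite mul0r cos0.
have c2 := cos_recl x 0; have c3 := cos_recl x 1; have c4 := cos_recl x 2.
rewrite c4 c3 c2 c1 c0; move: (cos x) => c h cn; apply: (mulfI cn).
by rewrite mulr0; move/eqP: h; rewrite -subr_eq0 => /eqP h; apply: (eq_mod_root (q := -1) h); ring.
Qed.

Lemma gen_cyc11 :
  gen_cyc 11 ^+ 5 - 11 * gen_cyc 11 ^+ 4 + 44 * gen_cyc 11 ^+ 3
    - 77 * gen_cyc 11 ^+ 2 + 55 * gen_cyc 11 - 11 = 0.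
Proof.
rewrite /gen_cyc; have := @cos_2piV_neq1 11 isT; set x := 2 * pi / _.
have : cos (6%:R * x) = cos (5%:R * x) by apply: cos_reflect; rewrite /x; field.
have c1 : cos (1%:R * x) = cos x by rewrite mul1r.
have c0 : cos (0%:R * x) = 1 by rewrite mul0r cos0.
have c2 := cos_recl x 0; have c3 := cos_recl x 1; have c4 := cos_recl x 2.
have c5 := cos_recl x 3; have c6 := cos_recl x 4.
rewrite c6 c5 c4 c3 c2 c1 c0; move: (cos x) => c h cn; apply: (mulfI cn).
by rewrite mulr0; move/eqP: h; rewrite -subr_eq0 => /eqP h; apply: (eq_mod_root (q := -1) h); ring.
Qed.

End Cosines.

Section Fields.
Context {R : realType}.
Local Notation C := R[i].
Local Notation Zint := (integralOver (intr : int -> C)).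

Lemma theta_adjoinQ (theta : C) : theta \in adjoinQ theta.
Proof. by apply/asboolP. Qed.

(** The last two clauses amount to [normmin B = 1], attained at the coordinates of the element 1. *)
Definition norm_one_matrix n (d : int) (B : 'M[R]_n.+1) :=
  [/\ (\det B) ^+ 2 = d%:~R,
      forall z : 'cV[int]_n.+1, z != 0 -> 1 <= `|\prod_i ivec B z i 0| &
      exists2 z : 'cV[int]_n.+1, z != 0 & ivec B z = const_mx 1].

(** Reduces a cyclotomic case to polynomial identities. The lists hold coefficients in increasing
    degree: [s] those of the monic polynomial with roots [r], [eps] and [eps'] those of a unit and
    its inverse in powers of [x]. The discriminant is [d], and denominators divide [m^k]. *)
Lemma cyc_field (n m k : nat) (s : seq int) (r : 'I_n.+1 -> R) (d : nat)
    (eps eps' : seq int) :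
  let x := r 0 in let ev (t : seq int) := horner_rec [seq k%:~R | k <- t] x in
  prime m -> x = gen_cyc m -> last 0 s = 1 -> size s = n.+2 ->
  (forall i, horner_rec [seq k%:~R | k <- s] (r i) = 0) ->
  x ^+ n.+1 = m%:R * ev eps -> ev eps * ev eps' = 1 ->
  (0 < d)%N ->
  (\prod_(i < n.+1) \prod_(j < n.+1) (if (i < j)%N then r j - r i else 1)) ^+ 2 = d%:R ->
  (forall v : nat, (v ^ 2 %| d)%N -> (v %| m ^ k)%N) ->
  (exists B : 'M[R]_n.+1, embedding_matrix (zeta R m + (zeta R m)^-1) B) /\
  (forall B : 'M[R]_n.+1, embedding_matrix (zeta R m + (zeta R m)^-1) B ->
     norm_one_matrix d%:Z B).
Proof.
move=> x ev m_pr xE s1 ss s_root epsE epsV d0 dE d_sq.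
pose xC : C := (x%:C)%C.
pose evC (t : seq int) : C := ((ev t)%:C)%C.
set theta := zeta R m + _.
have thetaE : theta = 2 - xC.
  by rewrite /theta zetaD /xC xE /gen_cyc rmorphB/= rmorph_nat; ring.
have size_s : size (Poly s) = n.+2 by rewrite Poly_seqE.
have g_root i : root (map_poly intr (Poly s)) (r i) by rewrite root_Poly s_root.
have gen_theta : xC \in adjoinQ theta.
  by rewrite (_ : xC = 2 - theta) ?rpredB ?rpred_nat ?theta_adjoinQ// thetaE; ring.
have theta_gen : theta = (map_poly (ratr : rat -> C) (2%:P - 'X)).[xC].
  by rewrite thetaE rmorphB/= map_polyC map_polyX hornerD hornerN hornerC hornerX/= ratr_nat.
have xi : Zint xC by exact: (integral_r (Poly_monic s1) g_root 0).
have evi t : Zint (evC t).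
  elim: t => [|c t ih]; first by rewrite /evC /= rmorph0; exact: integralOver_zero.
  have -> : evC (c :: t) = evC t * xC + c%:~R.
    by rewrite /evC /= rmorphD rmorphM/= rmorph_int.
  by apply: integral_add; [exact: integral_mul|exact: integralOver_int].
have epsEC : xC ^+ n.+1 = m%:R * evC eps.
  by rewrite /xC /evC -rmorphXn epsE rmorphM rmorph_nat.
have epsVC : evC eps * evC eps' = 1 by rewrite /evC -rmorphM epsV rmorph1.
have l_desc := eisenstein_descent m_pr xi (evi eps) (evi eps') epsEC epsVC.
have d_neq0 : d%:Z != 0 by rewrite eqz_nat -lt0n.
have detV : \det (\matrix_(i, j) r i ^+ j : 'M[R]_n.+1) ^+ 2 = d%:Z%:~R.
  by rewrite det_powers dE.
have d_denom (c : rat) : c ^+ 2 * d%:Z%:~R \is a Num.int -> c * m%:R ^+ k \is a Num.int.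
  by move=> /denq_sq_dvd/d_sq/denq_dvd_int; rewrite natrX.
split.
  exists (\matrix_(i, j) r i ^+ j).
  exact: (embedding_matrix_power (Poly_monic s1) size_s g_root gen_theta theta_gen
    (prime_gt1 m_pr) l_desc d_neq0 detV d_denom).
move=> B eB.
exact: (embedding_matrix_norm (Poly_monic s1) size_s g_root gen_theta theta_gen
  (prime_gt1 m_pr) l_desc d_neq0 detV d_denom eB).
Qed.

Lemma field5 :
  (exists B : 'M[R]_2, embedding_matrix (zeta R 5 + (zeta R 5)^-1) B) /\
  (forall B : 'M[R]_2, embedding_matrix (zeta R 5 + (zeta R 5)^-1) B ->
     norm_one_matrix 5 B).
Proof.
pose x : R := gen_cyc 5; have hx : x ^+ 2 - 5 * x + 5 = 0 := gen_cyc5.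
pose r (i : 'I_2) := nth 0 [:: x; - x + 5] i.
(* The unit is [x - 1], with inverse [4 - x], since [x^2 = 5 (x - 1)]. *)
apply: (@cyc_field 1 5 1 [:: 5; -5; 1] r 5 [:: -1; 1] [:: 4; -1]) => //.
- case=> [[|[|//]] ?]; rewrite /r /=.
    by apply: (eq_mod_root (q := 1) hx); ring.
  by apply: (eq_mod_root (q := 1) hx); ring.
- by rewrite /r /=; apply: (eq_mod_root (q := 1) hx); ring.
- by rewrite /r /=; apply: (eq_mod_root (q := -1) hx); ring.
- rewrite !big_ord_recl !big_ord0 /r /=.
  by apply: (eq_mod_root (q := 4) hx); ring.
- by move=> v h; rewrite expn1 (dvdn_trans _ h)// dvdn_exp.
Qed.

Lemma field7 :
  (exists B : 'M[R]_3, embedding_matrix (zeta R 7 + (zeta R 7)^-1) B) /\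
  (forall B : 'M[R]_3, embedding_matrix (zeta R 7 + (zeta R 7)^-1) B ->
     norm_one_matrix 49 B).
Proof.
pose x : R := gen_cyc 7; have hx : x ^+ 3 - 7 * x ^+ 2 + 14 * x - 7 = 0 := gen_cyc7.
(* [u |-> 4 u - u^2] maps [2 - 2 cos x] to [2 - 2 cos (2 x)], hence permutes the
   conjugates. *)
have step (u : R) : u ^+ 3 - 7 * u ^+ 2 + 14 * u - 7 = 0 ->
    (4 * u - u ^+ 2) ^+ 3 - 7 * (4 * u - u ^+ 2) ^+ 2 + 14 * (4 * u - u ^+ 2) - 7 = 0.
  by move=> hu; apply: (eq_mod_root (q := - u ^+ 3 + 5 * u ^+ 2 - 6 * u + 1) hu); ring.
pose r1 := - x ^+ 2 + 4 * x; pose r2 := x ^+ 2 - 5 * x + 7.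
have r1E : r1 = 4 * x - x ^+ 2 by rewrite /r1; ring.
have r2E : r2 = 4 * r1 - r1 ^+ 2.
  by apply: esym; apply: (eq_mod_root (q := - x + 1) hx); rewrite /r2 /r1; ring.
have h1 := step _ hx; rewrite -r1E in h1; have h2 := step _ h1; rewrite -r2E in h2.
pose r (i : 'I_3) := nth 0 [:: x; r1; r2] i.
apply: (@cyc_field 2 7 1 [:: -7; 14; -7; 1] r 49 [:: 1; -2; 1] [:: 29; -19; 3]) => //.
- case=> [[|[|[|//]]] ?]; rewrite /r /=.
  + by apply: (eq_mod_root (q := 1) hx); ring.
  + by apply: (eq_mod_root (q := 1) h1); ring.
  + by apply: (eq_mod_root (q := 1) h2); ring.
- by rewrite /r /=; apply: (eq_mod_root (q := 1) hx); ring.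
- by rewrite /r /=; apply: (eq_mod_root (q := 3 * x - 4) hx); ring.
- rewrite !big_ord_recl !big_ord0 /r /=.
  (* The field is cyclic of degree 3, so the product of the root differences is rational. *)
  have prod7 : (r1 - x) * (r2 - x) * (r2 - r1) = 7.
    apply: (eq_mod_root (q := - 2 * x ^+ 3 + 13 * x ^+ 2 - 19 * x + 1) hx).
    by rewrite /r1 /r2; ring.
  transitivity (((r1 - x) * (r2 - x) * (r2 - r1)) ^+ 2); first by ring.
  by rewrite prod7; ring.
- by move=> v; rewrite (_ : 49 = 7 ^ 2)%N// dvdn_pexp2r.
Qed.

Lemma field11 :
  (exists B : 'M[R]_5, embedding_matrix (zeta R 11 + (zeta R 11)^-1) B) /\
  (forall B : 'M[R]_5, embedding_matrix (zeta R 11 + (zeta R 11)^-1) B ->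
     norm_one_matrix (11 ^ 4)%N B).
Proof.
pose G (x : R) := x ^+ 5 - 11 * x ^+ 4 + 44 * x ^+ 3 - 77 * x ^+ 2 + 55 * x - 11.
pose x : R := gen_cyc 11; have hx : G x = 0 := gen_cyc11.
have step (u : R) : G u = 0 -> G (4 * u - u ^+ 2) = 0.
  move=> hu; apply: (eq_mod_root (q :=
    - u ^+ 5 + 9 * u ^+ 4 - 28 * u ^+ 3 + 35 * u ^+ 2 - 15 * u + 1) hu).
  by rewrite /G; ring.
(* The conjugates, obtained by iterating [u |-> 4 u - u^2] from [x] and reducing modulo [G] to
   degree at most 4. *)
pose r1 := - x ^+ 2 + 4 * x.
pose r2 := - x ^+ 4 + 8 * x ^+ 3 - 20 * x ^+ 2 + 16 * x.
pose r3 := x ^+ 3 - 6 * x ^+ 2 + 9 * x.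
pose r4 := x ^+ 4 - 9 * x ^+ 3 + 27 * x ^+ 2 - 30 * x + 11.
have r1E : r1 = 4 * x - x ^+ 2 by rewrite /r1; ring.
have r2E : r2 = 4 * r1 - r1 ^+ 2 by rewrite /r2 /r1; ring.
have r3E : r3 = 4 * r2 - r2 ^+ 2.
  apply: esym; apply: (eq_mod_root (q := - x ^+ 3 + 5 * x ^+ 2 - 5 * x) hx).
  by rewrite /r3 /r2 /G; ring.
have r4E : r4 = 4 * r3 - r3 ^+ 2.
  by apply: esym; apply: (eq_mod_root (q := - x + 1) hx); rewrite /r4 /r3 /G; ring.
have h1 := step _ hx; rewrite -r1E in h1; have h2 := step _ h1; rewrite -r2E in h2.
have h3 := step _ h2; rewrite -r3E in h3; have h4 := step _ h3; rewrite -r4E in h4.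
pose r (i : 'I_5) := nth 0 [:: x; r1; r2; r3; r4] i.
apply: (@cyc_field 4 11 2 [:: -11; 55; -77; 44; -11; 1] r (11 ^ 4)%N
  [:: 1; -5; 7; -4; 1] [:: 6535; -12073; 7641; -2009; 188]) => //.
- case=> [[|[|[|[|[|//]]]]] ?]; rewrite /r /=.
  + by apply: (eq_mod_root (q := 1) hx); rewrite /G; ring.
  + by apply: (eq_mod_root (q := 1) h1); rewrite /G; ring.
  + by apply: (eq_mod_root (q := 1) h2); rewrite /G; ring.
  + by apply: (eq_mod_root (q := 1) h3); rewrite /G; ring.
  + by apply: (eq_mod_root (q := 1) h4); rewrite /G; ring.
- by rewrite /r /=; apply: (eq_mod_root (q := 1) hx); rewrite /G; ring.
- rewrite /r /=.
  by apply: (eq_mod_root (q := 188 * x ^+ 3 - 693 * x ^+ 2 + 1098 * x - 594) hx); rewrite /G; ring.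
- rewrite !big_ord_recl !big_ord0 /r /=.
  (* The product of the ten root differences is built up gradually and reduced modulo [G] each time,
     which keeps the identities small. It ends at -121. *)
  have p1 : (r1 - x) * (r2 - x) * (r3 - x) * (r4 - x) =
      5 * x ^+ 4 - 44 * x ^+ 3 + 132 * x ^+ 2 - 154 * x + 55.
    have e1 : (r1 - x) * (r2 - x) = 2 * x ^+ 3 - 10 * x ^+ 2 + 11 * x.
      by apply: (eq_mod_root (q := x) hx); rewrite /r1 /r2 /G; ring.
    have e2 : (2 * x ^+ 3 - 10 * x ^+ 2 + 11 * x) * (r3 - x) =
        - x ^+ 4 + 8 * x ^+ 3 - 22 * x ^+ 2 + 22 * x.
      by apply: (eq_mod_root (q := 2 * x) hx); rewrite /r3 /G; ring.
    rewrite e1 e2; apply: (eq_mod_root (q := - x ^+ 3 + 6 * x ^+ 2 - 11 * x + 5) hx).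
    by rewrite /r4 /G; ring.
  have p2 : (5 * x ^+ 4 - 44 * x ^+ 3 + 132 * x ^+ 2 - 154 * x + 55) * (r2 - r1) =
      11 * x ^+ 2 - 55 * x + 55.
    apply: (eq_mod_root (q := - 5 * x ^+ 3 + 29 * x ^+ 2 - 40 * x + 5) hx).
    by rewrite /r2 /r1 /G; ring.
  have p3 : (11 * x ^+ 2 - 55 * x + 55) * (r3 - r1) =
      11 * x ^+ 4 - 99 * x ^+ 3 + 297 * x ^+ 2 - 330 * x + 121.
    by apply: (eq_mod_root (q := 11) hx); rewrite /r3 /r1 /G; ring.
  have p4 : (11 * x ^+ 4 - 99 * x ^+ 3 + 297 * x ^+ 2 - 330 * x + 121) * (r4 - r1) =
      11 * x ^+ 4 - 99 * x ^+ 3 + 330 * x ^+ 2 - 484 * x + 242.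
    apply: (eq_mod_root (q := 11 * x ^+ 3 - 77 * x ^+ 2 + 165 * x - 99) hx).
    by rewrite /r4 /r1 /G; ring.
  have p5 : (11 * x ^+ 4 - 99 * x ^+ 3 + 330 * x ^+ 2 - 484 * x + 242) * (r3 - r2) =
      - 11 * x ^+ 4 + 110 * x ^+ 3 - 363 * x ^+ 2 + 484 * x - 242.
    apply: (eq_mod_root (q := 11 * x ^+ 3 - 55 * x ^+ 2 + 88 * x - 22) hx).
    by rewrite /r3 /r2 /G; ring.
  have p6 : (- 11 * x ^+ 4 + 110 * x ^+ 3 - 363 * x ^+ 2 + 484 * x - 242) * (r4 - r2) =
      22 * x ^+ 4 - 121 * x ^+ 3 + 121 * x ^+ 2 + 121 * x - 121.
    apply: (eq_mod_root (q := - 22 * x ^+ 3 + 165 * x ^+ 2 - 330 * x + 231) hx).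
    by rewrite /r4 /r2 /G; ring.
  have p7 : (22 * x ^+ 4 - 121 * x ^+ 3 + 121 * x ^+ 2 + 121 * x - 121) * (r4 - r3) = - 121.
    apply: (eq_mod_root (q := 22 * x ^+ 3 - 99 * x ^+ 2 + 110) hx).
    by rewrite /r4 /r3 /G; ring.
  move: p1 p2 p3 p4 p5 p6 p7; clearbody r1 r2 r3 r4 => p1 p2 p3 p4 p5 p6 p7.
  transitivity (((r1 - x) * (r2 - x) * (r3 - x) * (r4 - x) * (r2 - r1) * (r3 - r1)
    * (r4 - r1) * (r3 - r2) * (r4 - r2) * (r4 - r3)) ^+ 2); first by ring.
  by rewrite p1 p2 p3 p4 p5 p6 p7 natrX; ring.
- by move=> v; rewrite (expnM 11 2 2) dvdn_pexp2r.
Qed.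

End Fields.

(** * The quartic field of discriminant 725 *)

Section Quartic.
Context {R : realType}.
Local Notation C := R[i].
Local Notation Zint := (integralOver (intr : int -> C)).

(** The form has discriminant 28, a nonresidue modulo 5, so it represents 0 modulo 5 only trivially;
    the proof runs through the residues. *)
Lemma norm_form5 (x y : int) : (exists k, 2 * x ^+ 2 + 2 * x * y - 3 * y ^+ 2 = k * 5) ->
  (exists k, x = k * 5) /\ (exists k, y = k * 5).
Proof.
move=> [k kE].
have [qx [rx [xE rx0 rx5]]] : exists q r : int, [/\ x = 5 * q + r, 0 <= r & r < 5].
  exists (divz x 5), (modz x 5); split; first by rewrite mulrC -divz_eq.
    exact: modz_ge0.
  exact: ltz_pmod.
have [qy [ry [yE ry0 ry5]]] : exists q r : int, [/\ y = 5 * q + r, 0 <= r & r < 5].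
  exists (divz y 5), (modz y 5); split; first by rewrite mulrC -divz_eq.
    exact: modz_ge0.
  exact: ltz_pmod.
pose e := k - (10 * qx ^+ 2 + 4 * qx * rx + 10 * qx * qy + 2 * qx * ry + 2 * qy * rx
  - 15 * qy ^+ 2 - 6 * qy * ry).
have eE : 2 * rx ^+ 2 + 2 * rx * ry - 3 * ry ^+ 2 = e * 5.
  by rewrite /e mulrBl -kE xE yE; ring.
have rxc : rx = 0 \/ rx = 1 \/ rx = 2 \/ rx = 3 \/ rx = 4.
  by clear -rx0 rx5; lia.
have ryc : ry = 0 \/ ry = 1 \/ ry = 2 \/ ry = 3 \/ ry = 4.
  by clear -ry0 ry5; lia.
suff [rx00 ry00] : rx = 0 /\ ry = 0.
  by split; [exists qx; rewrite xE rx00|exists qy; rewrite yE ry00]; ring.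
move: eE; clearbody e; clear -rxc ryc.
by case: rxc => [->|[->|[->|[->|->]]]]; case: ryc => [->|[->|[->|[->|->]]]] => //; lia.
Qed.

Lemma intdiv_integral (k : int) : Zint (k%:~R / 5%:R) -> exists k', k = k' * 5.
Proof.
move=> h; have /integral_rat/intrP[k' kE] : Zint (ratr (k%:~R / 5%:R)).
  by rewrite fmorph_div/= ratr_int ratr_nat.
exists k'; apply: (@intr_inj rat); rewrite intrM -kE.
by rewrite -[5%:~R]/(5%:R) divfK.
Qed.

(** [s] stands for the square root of 5 and [w] for [(1 + theta) / 2], of degree 2 over it. *)
Variables (s w : C).
Hypotheses (s2 : s ^+ 2 = 5) (w2 : 2 * (w ^+ 2 - w) = 3 + s).
Hypotheses (si : Zint s) (wi : Zint w).

Let s0 : s != 0.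
Proof. by apply: contra_eq_neq s2 => ->; rewrite expr0n/= eq_sym pnatr_eq0. Qed.

(* [1 - w] is the conjugate of [w] over [Q(s)], and
   [2 (x + y w) (x + y (1 - w)) = M - s y^2] for the form [M] of [norm_form5],
   so [M / s] is integral. *)
Let half_descent (x y : int) : Zint ((x%:~R + y%:~R * w) / s) ->
  (exists k, x = k * 5) /\ (exists k, y = k * 5).
Proof.
move=> hi; apply: norm_form5.
pose M : int := 2 * x ^+ 2 + 2 * x * y - 3 * y ^+ 2.
have ME : M%:~R = 2 * x%:~R ^+ 2 + 2 * x%:~R * y%:~R - 3 * y%:~R ^+ 2 :> C.
  by rewrite /M intrB intrD !intrM; ring.
have Mi : Zint (M%:~R / s).
  have ci : Zint (2 * (x%:~R + y%:~R * (1 - w))).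
    apply: integral_mul; first exact: integral_nat.
    apply: integral_add; first exact: integralOver_int.
    apply: integral_mul; first exact: integralOver_int.
    by apply: integral_sub => //; exact: integral1.
  have yi : Zint (y ^+ 2)%:~R by exact: integralOver_int.
  move: (integral_add (integral_mul hi ci) yi); congr integralOver.
  rewrite ME rmorphXn/=; apply: (mulIf s0); rewrite mulrDl divfK//.
  transitivity ((x%:~R + y%:~R * w) * (2 * (x%:~R + y%:~R * (1 - w))) + y%:~R ^+ 2 * s).
    by field.
  have -> : s = 2 * (w ^+ 2 - w) - 3 by rewrite w2; ring.
  by ring.
apply: intdiv_integral; rewrite -[2 * x ^+ 2 + _ - _]/M.
(* As [s^2 = 5], integrality of [M / s] makes [M^2 / 5] an integer, and 5 is prime. *)
have : exists k, M ^+ 2 = k * 5.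
  apply: intdiv_integral; rewrite rmorphXn/= -s2.
  by move: (integralOver_exp 2 Mi); rewrite expr_div_n.
move=> [k kE].
have : (5 %| absz M)%N.
  have : (5 %| absz M ^ 2)%N by rewrite -abszX kE abszM dvdn_mull.
  by rewrite Euclid_dvdX// andbT.
move=> pa; have /dvdzP[c cE] : M \in dvdz 5%:Z by rewrite dvdzE.
rewrite cE intrM -[X in _ * X / _]/(5%:R) mulfK ?pnatr_eq0//.
exact: integralOver_int.
Qed.

(** Division by 5 is division by [s] twice. Multiplying by [s] isolates [(A0 + A2 w) / s] up to an
    integral term; once [A0] and [A2] are divided out, [(A1 + A3 w) / s] remains. *)
Lemma quartic_descent_basis (A0 A1 A2 A3 : int) :
  Zint ((A0%:~R + A1%:~R * s + (A2%:~R + A3%:~R * s) * w) / 5) ->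
  [/\ exists k, A0 = k * 5, exists k, A1 = k * 5, exists k, A2 = k * 5 &
      exists k, A3 = k * 5].
Proof.
move=> hi; have n5 : 5 != 0 :> C by rewrite pnatr_eq0.
have [[B0 B0E] [B2 B2E]] : (exists k, A0 = k * 5) /\ (exists k, A2 = k * 5).
  apply: half_descent.
  have ri : Zint (A1%:~R + A3%:~R * w).
    apply: integral_add; first exact: integralOver_int.
    by apply: integral_mul => //; exact: integralOver_int.
  move: (integral_sub (integral_mul hi si) ri); congr integralOver.
  by rewrite -s2; field.
have [B1E B3E] : (exists k, A1 = k * 5) /\ (exists k, A3 = k * 5).
  apply: half_descent.
  have ri : Zint (B0%:~R + B2%:~R * w).
    apply: integral_add; first exact: integralOver_int.
    by apply: integral_mul => //; exact: integralOver_int.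
  move: (integral_sub hi ri); congr integralOver.
  rewrite B0E B2E !intrM -[5%:~R]/(5%:R) -s2; field.
  by rewrite s0.
by split=> //; [exists B0|exists B2].
Qed.

(** [2 w^2] and [2 w^3] are integer combinations of [1, s, w, s w], so the double of the element
    falls under the previous descent; the factor 2 is invertible modulo 5. *)
Lemma quartic_descent (a : 'I_4 -> int) :
  Zint (\sum_j (a j)%:~R * w ^+ j / 5%:R) ->
  exists b : 'I_4 -> int, forall j, a j = b j * 5%:Z.
Proof.
have lift1 : lift ord0 ord0 = 1 :> 'I_4 by exact/val_inj.
have lift2 : lift ord0 (lift ord0 ord0) = 2 :> 'I_4 by exact/val_inj.
have lift3 : lift ord0 (lift ord0 (lift ord0 ord0)) = 3 :> 'I_4 by exact/val_inj.
rewrite !big_ord_recl big_ord0 !lift3 !lift2 !lift1 /= => hi.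
have w3 : 2 * w ^+ 2 = 2 * w + 3 + s.
  by rewrite -addrA -w2; ring.
have w4 : 2 * w ^+ 3 = 3 + s + (5 + s) * w.
  rewrite exprSr mulrA w3 mulrDl mulrDl -mulrA -expr2 w3; ring.
have hi2 : Zint (((2 * a 0 + 3 * a 2 + 3 * a 3)%:~R + (a 2 + a 3)%:~R * s +
    ((2 * a 1 + 2 * a 2 + 5 * a 3)%:~R + (a 3)%:~R * s) * w) / 5).
  move: (integral_mul (integral_nat _ 2) hi); congr integralOver.
  transitivity ((2 * (a 0)%:~R + 2 * (a 1)%:~R * w + (a 2)%:~R * (2 * w ^+ 2)
    + (a 3)%:~R * (2 * w ^+ 3)) / 5%:R); first by rewrite expr0 expr1; field.
  by rewrite w3 w4; field.
have [[k0 e0] [k1 e1] [k2 e2] [k3 e3]] := quartic_descent_basis hi2.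
have [c0 [c1 [c2 [c3 [h0 h1 h2 h3]]]]] : exists c0 c1 c2 c3 : int,
    [/\ a 0 = c0 * 5, a 1 = c1 * 5, a 2 = c2 * 5 & a 3 = c3 * 5].
  (* The system is triangular. Halving modulo 5 is multiplication by 3: from [2 a = 5 k] follows
     [a = 5 (3 k - a)]. *)
  exists (3 * (k0 - 3 * k1) - a 0), (3 * (k2 - 2 * k1 - 3 * k3) - a 1), (k1 - k3), k3.
  by split; lia.
exists (fun j => nth 0 [:: c0; c1; c2; c3] j).
move=> [[|[|[|[|//]]]] jlt] /=.
- by rewrite -h0; congr a; exact/val_inj.
- by rewrite -h1; congr a; exact/val_inj.
- by rewrite -h2; congr a; exact/val_inj.
- by rewrite -h3; congr a; exact/val_inj.
Qed.

End Quartic.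

Section QuarticField.
Context {R : realType}.
Local Notation C := R[i].
Local Notation Zint := (integralOver (intr : int -> C)).
Let theta : C := ((Num.sqrt (7 + 2 * Num.sqrt 5))%:C)%C.

Lemma field_quartic :
  (exists B : 'M[R]_4, embedding_matrix theta B) /\
  (forall B : 'M[R]_4, embedding_matrix theta B -> norm_one_matrix 725 B).
Proof.
pose s : R := Num.sqrt 5; have s2 : s ^+ 2 = 5 by rewrite sqr_sqrtr.
have s0 : 0 <= s by exact: sqrtr_ge0.
have s3 : s <= 3 by rewrite -(@ler_pXn2r _ 2)// ?nnegrE// s2; lra.
pose a : R := Num.sqrt (7 + 2 * s); have a2 : a ^+ 2 = 7 + 2 * s by rewrite sqr_sqrtr; lra.
(* The conjugate of [a] under [s |-> -s]; it is real since [s <= 3]. *)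
pose b : R := Num.sqrt (7 - 2 * s); have b2 : b ^+ 2 = 7 - 2 * s by rewrite sqr_sqrtr; lra.
(* In terms of [y = x^2 - x] the polynomial is [y^2 - 3 y + 1], with roots [(3 + s) / 2] and
   [(3 - s) / 2]. *)
pose g : seq int := [:: 1; 3; -2; -2; 1].
have groot (u v : R) : v ^+ 2 = 5 -> u ^+ 2 = 7 + 2 * v ->
    horner_rec [seq k%:~R | k <- g] ((1 + u) / 2) = 0.
  move=> v2 u2; set x := (1 + u) / 2.
  have xE : x ^+ 2 - x = (3 + v) / 2.
    transitivity ((u ^+ 2 - 1) / 4); first by rewrite /x; field.
    by rewrite u2; field.
  transitivity ((x ^+ 2 - x - 1) ^+ 2 - (x ^+ 2 - x - 1) - 1); first by rewrite /=; ring.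
  rewrite xE; transitivity ((v ^+ 2 - 5) / 4); first by field.
  by rewrite v2 subrr mul0r.
pose r (i : 'I_4) := nth 0 [:: (1 + a) / 2; (1 + - a) / 2; (1 + b) / 2; (1 + - b) / 2] i.
have g_rec i : horner_rec [seq k%:~R | k <- g] (r i) = 0.
  case: i => [[|[|[|[|//]]]] ?]; rewrite /r [nth _ _ _]/=.
  - exact: (groot _ s).
  - by apply: (groot _ s); rewrite ?sqrrN.
  - by apply: (groot _ (- s)); rewrite ?sqrrN// b2; ring.
  - by apply: (groot _ (- s)); rewrite ?sqrrN// b2; ring.
have g_root i : root (map_poly intr (Poly g)) (r i) by rewrite root_Poly// g_rec.
have size_g : size (Poly g) = 5%N by rewrite Poly_seqE.
pose w : C := ((r 0)%:C)%C.
have wE : w = (1 + theta) / 2.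
  by rewrite /w /r /= fmorph_div rmorphD rmorph1 rmorph_nat.
have gen_theta : w \in adjoinQ theta.
  by rewrite wE rpred_div ?rpredD ?rpred1 ?rpred_nat ?theta_adjoinQ.
have theta_gen : theta = (map_poly (ratr : rat -> C) (2%:P * 'X - 1)).[w].
  rewrite rmorphB rmorphM/= map_polyC map_polyX rmorph1 hornerD hornerN hornerM.
  by rewrite !hornerC hornerX/= ratr_nat wE; field.
have wi : Zint w by exact: (integral_r (Poly_monic (s := g) erefl) g_root 0).
pose sC : C := (s%:C)%C.
have sC2 : sC ^+ 2 = 5 by rewrite /sC -rmorphXn/= s2 rmorph_nat.
have si : Zint sC.
  exists ('X^2 - 5%:P).
    by rewrite monicE lead_coefDl ?lead_coefXn// size_polyXn size_polyN size_polyC.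
  rewrite /root rmorphB/= map_polyXn map_polyC/= hornerD hornerN hornerXn hornerC.
  by rewrite sC2 subrr.
have w2 : 2 * (w ^+ 2 - w) = 3 + sC.
  have : 2 * (r 0 ^+ 2 - r 0) = 3 + s.
    transitivity ((a ^+ 2 - 1) / 2); first by rewrite /r /=; field.
    by rewrite a2; field.
  move=> /(congr1 (real_complex R)).
  by rewrite rmorphM rmorphB rmorphXn !rmorph_nat rmorphD !rmorph_nat.
have l_desc := quartic_descent sC2 w2 si wi.
have detV : \det (\matrix_(i, j) r i ^+ j : 'M[R]_4) ^+ 2 = 725%:Z%:~R.
  rewrite det_powers !big_ord_recl !big_ord0 /r /=.
  transitivity (a ^+ 2 * b ^+ 2 * ((a ^+ 2 - b ^+ 2) / 4) ^+ 4); first by field.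
  rewrite a2 b2; transitivity ((49 - 4 * s ^+ 2) * (s ^+ 2) ^+ 2); first by field.
  by rewrite s2; ring.
have d_denom (c : rat) : c ^+ 2 * 725%:Z%:~R \is a Num.int -> c * 5%:R ^+ 1 \is a Num.int.
  move=> /denq_sq_dvd; set v := absz _ => v2; rewrite expr1; apply: denq_dvd_int.
  (* [725 = 5^2 * 29], so the square of [v] divides it only for [v] = 1 or 5. As [27^2 > 725],
     checking [v < 27] suffices. *)
  rewrite -/v; have v27 : (v < 27)%N.
    have := dvdn_leq (isT : (0 < 725)%N) v2; rewrite ltnNge; apply: contraTN => v27.
    by rewrite -ltnNge (leq_trans _ (leq_mul v27 v27)).
  by move: v v27 v2; do 27 case=> //.
split.
  exists (\matrix_(i, j) r i ^+ j).
  exact: (embedding_matrix_power (l := 5%N) (m := 1) (d := 725)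
    (Poly_monic (s := g) erefl) size_g g_root gen_theta theta_gen isT l_desc isT detV d_denom).
move=> B eB.
exact: (embedding_matrix_norm (l := 5%N) (m := 1) (d := 725)
    (Poly_monic (s := g) erefl) size_g g_root gen_theta theta_gen isT l_desc isT detV d_denom eB).
Qed.

End QuarticField.

(** * Optimal densities *)

Section OptimalDensities.
Context {R : realType}.

Lemma powR_half_odd (x : R) k : 0 < x ->
  x `^ ((k.*2.+1)%:R / 2) = x ^+ k * Num.sqrt x.
Proof.
move=> x0; rewrite -powR12_sqrt ?ltW// -powR_mulrn ?ltW// -powRD.
  by congr (_ `^ _); rewrite -addn1 natrD -mul2n natrM; field.
by rewrite (gt_eqF x0) implybT.
Qed.

Lemma ball_const3 : ball_const 3 = 4 / 3 * pi :> R.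
Proof.
have p0 := pi_gt0 R; rewrite /ball_const Gamma52 (powR_half_odd 1 p0).
by move: (pi : R) p0 => p p0; field; rewrite sqrtr_eq0 -ltNge p0.
Qed.

Lemma ball_const4 : ball_const 4 = pi ^+ 2 / 2 :> R.
Proof.
rewrite /ball_const Gamma3 (_ : 4 / 2 = 2%:R); last by field.
by rewrite powR_mulrn// pi_ge0.
Qed.

Lemma ball_const5 : ball_const 5 = 8 / 15 * pi ^+ 2 :> R.
Proof.
have p0 := pi_gt0 R; rewrite /ball_const Gamma72 (powR_half_odd 2 p0).
by move: (pi : R) p0 => p p0; field; rewrite sqrtr_eq0 -ltNge p0.
Qed.

Lemma norm_one_optimal n (d : int) (B : 'M[R]_n.+1) :
  norm_one_matrix d B -> 0 < d -> B \in unitmx /\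
  density' B = (ball_const n.+1 *
    (n.+1%:R `^ (n.+1%:R / 2) / (2 ^+ n.+1 * Num.sqrt d%:~R)))%:E.
Proof.
move=> [dB h1 [z z0 zB]] d0.
have detB : `|\det B| = Num.sqrt d%:~R by rewrite -dB sqrtr_sqr.
have Bu : B \in unitmx.
  by rewrite unitmxE unitfE -normr_gt0 detB sqrtr_gt0 ltr0z.
split => //; rewrite density'E// /optimal_density detB.
suff -> : normmin B = 1 by rewrite mulr1.
apply/eqP; rewrite eq_le; apply/andP; split; last exact: normmin_ge.
apply: le_trans (normmin_le B z0) _; rewrite zB.
by under eq_bigr do rewrite mxE; rewrite big1// normr1.
Qed.

(** The inequality for all [A] caps the ratio of [normmin A] to [|\det A|] at [1 / c], and
    [density' B] is the value belonging to that ratio. *)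
Lemma sup_density'E n (B : 'M[R]_n.+1) (c : R) : 0 < c -> B \in unitmx ->
  (forall A : 'M[R]_n.+1, A \in unitmx -> c * normmin A <= `|\det A|) ->
  density' B = (ball_const n.+1 *
    (n.+1%:R `^ (n.+1%:R / 2) / (2 ^+ n.+1 * c)))%:E ->
  sup_density' n.+1 = density' B.
Proof.
move=> c0 Bu hA BE; apply/eqP; rewrite eq_le; apply/andP; split; last first.
  by apply: ereal_sup_ubound; exists B.
apply: ge_ereal_sup => _ [A Au <-]; rewrite BE density'E// lee_fin.
rewrite /optimal_density ler_wpM2l ?ball_const_ge0// -mulrA ler_wpM2l ?powR_ge0//.
have a0 := unitmx_normdet_gt0 Au.
rewrite ler_pdivrMr ?mulr_gt0 ?exprn_gt0// mulrC -mulrA.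
rewrite -(ler_pM2l c0) (le_trans (hA _ Au))// le_eqVlt; apply/orP; left; apply/eqP.
by field; rewrite !gt_eqF// exprn_gt0.
Qed.

Lemma sqrt_nat_sq (a b : nat) : Num.sqrt ((a ^ 2 * b)%N%:R : R) = a%:R * Num.sqrt b%:R.
Proof. by rewrite natrM natrX sqrtrM ?sqr_ge0// sqrtr_sqr ger0_norm. Qed.

End OptimalDensities.

Theorem theorem1 (R : realType) :
  [/\ (exists B : 'M[R]_2, embedding_matrix (zeta R 5 + (zeta R 5)^-1) B) /\
      (forall B : 'M[R]_2, embedding_matrix (zeta R 5 + (zeta R 5)^-1) B ->
        [/\ B \in unitmx, sup_density' 2 = density' B &
            density' B = (pi / (2 * Num.sqrt 5))%:E]),
      (exists B : 'M[R]_3, embedding_matrix (zeta R 7 + (zeta R 7)^-1) B) /\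
      (forall B : 'M[R]_3, embedding_matrix (zeta R 7 + (zeta R 7)^-1) B ->
        [/\ B \in unitmx, sup_density' 3 = density' B &
            density' B = (Num.sqrt 3 * pi / 14)%:E]),
      (exists B : 'M[R]_4,
        embedding_matrix (Num.sqrt (7 + 2 * Num.sqrt 5))%:C%C B) /\
      (forall B : 'M[R]_4,
        embedding_matrix (Num.sqrt (7 + 2 * Num.sqrt 5))%:C%C B ->
        [/\ B \in unitmx, (density' B <= sup_density' 4)%E &
            density' B = (pi ^+ 2 / (10 * Num.sqrt 29))%:E]) &
      (exists B : 'M[R]_5, embedding_matrix (zeta R 11 + (zeta R 11)^-1) B) /\
      (forall B : 'M[R]_5, embedding_matrix (zeta R 11 + (zeta R 11)^-1) B ->
        [/\ B \in unitmx, (density' B <= sup_density' 5)%E &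
            density' B = (5 * Num.sqrt 5 * pi ^+ 2 / (12 * 11 ^+ 2))%:E])] /\
  (forall phi1 phi2 : R, irrational phi1 -> irrational phi2 -> phi1 != phi2 ->
    limf_einf (fun eps => (density (lattice (phi_mx_eps phi1 phi2 eps)))%:E) 0^'+
      = (pi%:E / (2%:E * lagrange_number phi1))%E /\
    (forall f : quadform,
      (forall x y : R, qfeval f x y = (x - phi1 * y) * (x - phi2 * y)) ->
      density' (phi_mx phi1 phi2) =
        ereal_inf [set (density (lattice (phi_mx_eps phi1 phi2 eps)))%:E
                  | eps in [set eps : R | 0 < eps]] /\
      ereal_inf [set (density (lattice (phi_mx_eps phi1 phi2 eps)))%:E
                | eps in [set eps : R | 0 < eps]]
        = (pi%:E / (2%:E * markoff f))%E)).
Proof.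
split; last first.
  move=> phi1 phi2 irr1 irr2 phi12; split; first exact: limf_density_lagrange.
  move=> f fE; rewrite (inf_density_eps phi12 irr1 irr2).
  by split; [exact/density'E/phi_mx_unit|exact: optimal_density_markoff].
have s5 : Num.sqrt (5 : R) != 0 by rewrite gt_eqF// sqrtr_gt0.
have s29 : Num.sqrt (29 : R) != 0 by rewrite gt_eqF// sqrtr_gt0.
split.
- have [? allB] := @field5 R; split=> // B /allB hB; have [Bu BE] := norm_one_optimal hB isT.
  split=> //; first exact: (sup_density'E _ Bu normmin_upper2 BE).
  rewrite BE ball_const2 divff// powRr1// -[5%:~R]/(5 : R); congr EFin.
  by move: (pi : R) => p; field.
- have [? allB] := @field7 R; split=> // B /allB hB; have [Bu BE] := norm_one_optimal hB isT.
  have s49 : Num.sqrt 49%:~R = 7 :> R.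
    by rewrite -[49%:~R]/((7 ^ 2 * 1)%N%:R : R) sqrt_nat_sq sqrtr1 mulr1.
  rewrite s49 in BE; split=> //; first exact: (sup_density'E _ Bu normmin_upper3 BE).
  rewrite BE ball_const3 (powR_half_odd 1)//; congr EFin.
  by move: (pi : R) => p; field.
- have [? allB] := @field_quartic R; split=> // B /allB hB; have [Bu BE] := norm_one_optimal hB isT.
  split=> //; first by apply: ereal_sup_ubound; exists B.
  have s725 : Num.sqrt 725%:~R = 5 * Num.sqrt 29 :> R.
    by rewrite -[725%:~R]/((5 ^ 2 * 29)%N%:R : R) sqrt_nat_sq.
  rewrite BE s725 ball_const4 (_ : 4%:R / 2 = 2%:R :> R); last by field.
  rewrite powR_mulrn//; congr EFin.
  by move: (pi : R) => p; field.
- have [? allB] := @field11 R; split=> // B /allB hB; have [Bu BE] := norm_one_optimal hB isT.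
  split=> //; first by apply: ereal_sup_ubound; exists B.
  have s11 : Num.sqrt (11 ^ 4)%N%:~R = 121 :> R.
    rewrite -[_%:~R]/((11 ^ 4)%N%:R : R) (expnM 11 2 2) -[((11 ^ 2) ^ 2)%N]muln1.
    by rewrite sqrt_nat_sq sqrtr1 mulr1.
  rewrite BE s11 ball_const5 (powR_half_odd 2)//; congr EFin.
  by move: (pi : R) => p; field.
Qed.
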